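(* Consider the dNLS lattice with cubic Schrödinger potential $h(x)=x$. For $n\in\{6,7,\dots\}$ and each $k\in\{3,\dots,[n/2]\}$ there is a global bifurcation of relative equilibria (from the rotating wave $\bar a$) with maximal symmetry $\tilde D_d$, $d$ being the greatest common divisor of $k$ and $n$, from the amplitude $\sqrt{\delta_k}$.
   Context: dNLS lattice with $h(x)=x$: $i\dot q_j=|q_j|^2q_j+(q_{j+1}-2q_j+q_{j-1})$, $q_j\in\mathbb{C}$, $q_{j+n}=q_j$. Put $\zeta=2\pi/n$. Writing $q_j=\mu e^{i\omega t}x_j$ with $x_j$ constant, $x=(x_1,\dots,x_n)\in\mathbb{C}^n=\mathbb{R}^{2n}$ is a relative equilibrium when $F(x,\mu)=0$, where $$F(x,\mu)_j=\omega x_j+\mu^2|x_j|^2x_j+(x_{j+1}-2x_j+x_{j-1}),\qquad \omega=4\sin^2(\zeta/2)-\mu^2,$$ indices modulo $n$. With this $\omega$ the rotating wave $\bar a=(e^{i\zeta},e^{2i\zeta},\dots,e^{ni\zeta})$ is a solution for every $\mu$. The numbers $\delta_k$ are $$\delta_k=\frac{\alpha_k^2-\gamma_k^2}{2\alpha_k},\qquad \alpha_k=4\cos\zeta\,\sin^2(k\zeta/2),\qquad \gamma_k=2\sin(k\zeta)\sin\zeta ,$$ and $\delta_k>0$ for $3\le k\le n/2$. Symmetries: $\Gamma=D_n\times O(2)$ acts on $\mathbb{R}^{2n}$, $D_n$ (generated by $j\mapsto j+1$, $j\mapsto n-j$) permuting the indices and $O(2)$ rotating/reflecting all $x_j$ simultaneously.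 For $d$ dividing $n$, $\tilde D_d$ is the group generated by $x\mapsto y$, $y_j=e^{-2\pi i/d}x_{j+n/d}$, and $x\mapsto y$, $y_j=\bar x_{n-j}$; $E_d$ is its fixed-point space and $f_d=F|_{E_d}:E_d\to E_d$. Bifurcation: $T=\Gamma\bar a\times\mathbb{R}$; $S$ the zero set of $f_d$ in $E_d\times\mathbb{R}$; $G=S\setminus T$; bifurcation points are the elements of $\overline G\setminus G\subset T$; the local degree at a bifurcation point is $\eta_d(x_*,\mu_* )=\operatorname{sgn}\det D_xf_d(x_*,\mu_*-\rho)-\operatorname{sgn}\det D_xf_d(x_*,\mu_*+\rho)$ for small $\rho>0$. ''Global bifurcation from $\mu_k$ with maximal symmetry $\tilde D_d$'' means: (i) $(\bar a,\mu_k)$ is a bifurcation point (in $E_d$), and the local branch (elements of $G$ near $(\bar a,\mu_k)$) has symmetry $\tilde D_d$ but not symmetry $\tilde D_p$ for any bigger group $\tilde D_p\supsetneq\tilde D_d$, $p\mid n$; (ii) whenever the connected component $C$ of $\overline G$ containing $(\bar a,\mu_k)$ is admissible (i.e. bounded: neither the parameter $\mu$ nor the norm of $x$ goes to infinity along it), $C$ returns to other bifurcation points and the sum of the local degrees over all bifurcation points in $C\cap T$ (including $(\bar a,\mu_k)$) is zero. *)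

(* Defs.v *)
From HB Require Import structures.
From mathcomp Require Import all_boot all_order all_algebra all_fingroup.
From mathcomp Require Import all_classical all_reals all_analysis.
From mathcomp Require Import complex.

Set Implicit Arguments.
Unset Strict Implicit.
Unset Printing Implicit Defensive.

Import Order.TTheory GRing.Theory Num.Theory.
Import numFieldNormedType.Exports.

Local Open Scope classical_set_scope.
Local Open Scope ring_scope.
Local Open Scope complex_scope.

(* Sites are the residues mod n, as elements of 'I_n, site n being the        *)
(* ordinal 0; ordS, ord_pred and ord_neg below are j |-> j + 1, j - 1 and     *)
(* n - j mod n. A state x in C^n = R^2n is the row vector of length n + n     *)
(* made of all the Re x_j, then all the Im x_j.                               *)

Section Lattice.
Variables (R : realType) (n : nat).

Implicit Types (x y : 'rV[R]_(n + n)) (mu : R) (d : nat).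

Definition cis (t : R) : R[i] := cos t +i* sin t.

Definition site x (j : 'I_n) : R[i] := x 0 (lshift n j) +i* x 0 (rshift n j).

Definition of_sites (z : 'I_n -> R[i]) : 'rV[R]_(n + n) :=
  row_mx (\row_j complex.Re (z j)) (\row_j complex.Im (z j)).

Lemma of_sitesK z j : site (of_sites z) j = z j.
Proof. by rewrite /site row_mxEl row_mxEr !mxE; case: (z j). Qed.

Lemma siteP x y : site x =1 site y -> x = y.
Proof.
move=> xy; apply/rowP => i.
by case: (split_ordP i) => j ->; have [] := xy j.
Qed.

Definition zeta : R := 2 * pi / n%:R.

Definition omega mu : R := 4 * sin (zeta / 2) ^+ 2 - mu ^+ 2.

Definition dnlsF x mu : 'rV[R]_(n + n) := of_sites (fun j =>
  (omega mu)%:C * site x j + (mu ^+ 2)%:C * `|site x j| ^+ 2 * site x j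
  + (site x (ordS j) - 2 * site x j + site x (ord_pred j))).

Definition abar : 'rV[R]_(n + n) := of_sites (fun j => cis (j%:R * zeta)).

Definition alphak (k : nat) : R := 4 * cos zeta * sin (k%:R * zeta / 2) ^+ 2.
Definition gammak (k : nat) : R := 2 * sin (k%:R * zeta) * sin zeta.
Definition deltak (k : nat) : R :=
  (alphak k ^+ 2 - gammak k ^+ 2) / (2 * alphak k).

Lemma ord_neg_proof (j : 'I_n) : ((n - j) %% n < n)%N.
Proof. by rewrite ltn_pmod // (leq_ltn_trans _ (ltn_ord j)). Qed.
Definition ord_neg (j : 'I_n) : 'I_n := Ordinal (ord_neg_proof j).

Lemma ord_negK : involutive ord_neg.
Proof.
move=> j; apply: val_inj => /=.
have n0 : (0 < n)%N by rewrite (leq_ltn_trans _ (ltn_ord j)).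
have [j0|j0] := posnP j; first by rewrite j0 subn0 modnn subn0 modnn.
have njn : (n - j < n)%N by rewrite ltn_subrL j0.
by rewrite (modn_small njn) subKn ?modn_small // ltnW.
Qed.

Lemma ord_negS j : ord_neg (ordS j) = ord_pred (ord_neg j).
Proof.
apply: val_inj => /=; have jn := ltn_ord j.
have n0 : (0 < n)%N by rewrite (leq_ltn_trans _ jn).
have [j0|j0] := posnP j.
  rewrite j0 subn0 modnn add0n; case: n n0 => [//|[//|m]] _.
  by rewrite !modn_small.
have njn : (n - j < n)%N by rewrite ltn_subrL n0 j0.
rewrite (modn_small njn) -subn1 -addnBAC ?subn_gt0 // modnDr subn1 -subnS.
move: (jn); rewrite leq_eqVlt => /orP[/eqP ->|jn']; last by rewrite (modn_small jn').
by rewrite modnn subn0 modnn subnn mod0n.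
Qed.

Lemma ord_neg_pred j : ord_neg (ord_pred j) = ordS (ord_neg j).
Proof. by rewrite -{2}(ord_predK j) ord_negS ord_predK. Qed.

Definition dihedral : {set 'S_n} :=
  <<[set perm (can_inj (@ordSK n)); perm (inv_inj ord_negK)]%SET>>%g.

Definition O2 : set (R[i] -> R[i]) := [set h | exists2 u : R[i], `|u| = 1 &
  h = (fun z => u * z) \/ h = (fun z => u * z^*%C)].

Definition Gamma_orbit x : set 'rV[R]_(n + n) :=
  [set y | exists2 s, s \in dihedral &
    exists2 h, O2 h & y = of_sites (fun j => h (site x (s j)))].

Definition rot d x : 'rV[R]_(n + n) := of_sites (fun j =>
  cis (- (2 * pi / d%:R)) * site x (iter (n %/ d) (@ordS n) j)).

Definition refl x : 'rV[R]_(n + n) := of_sites (fun j => (site x (ord_neg j))^*).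

End Lattice.

Inductive generated (X : Type) (A : set (X -> X)) : set (X -> X) :=
| Generated_id : generated A idfun
| Generated_gen g of A g : generated A g
| Generated_comp g h of generated A g & generated A h : generated A (g \o h)
| Generated_inv g h of generated A g & cancel g h & cancel h g : generated A h.

Section Bifurcation.
Variables (R : realType) (n : nat).

Implicit Types (x : 'rV[R]_(n + n)) (mu : R) (d p : nat).
Implicit Types (z : 'rV[R]_(n + n) * R).

(* As a group of transformations of R^2n: D_n * O(2) acts faithfully there    *)
(* when n >= 3.                                                               *)
Definition tildeD d : set ('rV[R]_(n + n) -> 'rV[R]_(n + n)) :=
  generated [set rot d; @refl R n].

Definition Ed d : set 'rV[R]_(n + n) :=
  [set x | forall g, tildeD d g -> g x = x].

Lemma EdP d x : Ed d x <-> rot d x = x /\ refl x = x.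
Proof.
split=> [xE|[xr xs] g].
  by split; apply: xE; apply: Generated_gen; [left|right].
elim=> {g} [//|g [->|->]//|g h _ gx _ hx /=|g h _ gx gh _].
  by rewrite hx.
by rewrite -[in LHS]gx gh.
Qed.

Definition Ed_mx d : 'M[R]_(n + n) :=
  (eigenspace (lin1_mx (@rot R n d)) 1 :&: eigenspace (lin1_mx (@refl R n)) 1)%MS.

Lemma siteD (a : R) x y j :
  site (a *: x + y) j = a%:C * site x j + site y j.
Proof. by rewrite /site !mxE; apply/eqP; rewrite eq_complex /= !mul0r subr0 addr0 !eqxx. Qed.

Lemma rot_linear d : linear (@rot R n d).
Proof.
move=> a x y; apply: siteP => j.
by rewrite siteD !of_sitesK siteD mulrDr mulrCA.
Qed.

Lemma refl_linear : linear (@refl R n).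
Proof.
move=> a x y; apply: siteP => j.
by rewrite siteD !of_sitesK siteD rmorphD rmorphM /= oppr0.
Qed.

Lemma Ed_mxP d x : (x <= Ed_mx d)%MS <-> Ed d x.
Proof.
pose r := HB.pack_for {linear 'rV[R]_(n + n) -> 'rV[R]_(n + n)} (@rot R n d)
  (GRing.isLinear.Build _ _ _ _ _ (@rot_linear d)).
pose s := HB.pack_for {linear 'rV[R]_(n + n) -> 'rV[R]_(n + n)} (@refl R n)
  (GRing.isLinear.Build _ _ _ _ _ refl_linear).
rewrite EdP /Ed_mx sub_capmx; split.
  case/andP=> /eigenspaceP + /eigenspaceP.
  by rewrite (mul_rV_lin1 r) (mul_rV_lin1 s) !scale1r.
case=> xr xs; apply/andP; split; apply/eigenspaceP.
  by rewrite (mul_rV_lin1 r) scale1r.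
by rewrite (mul_rV_lin1 s) scale1r.
Qed.

Lemma norm_cis (t : R) : `|cis t| = 1.
Proof. by rewrite normc_def /= cos2Dsin2 sqrtr1. Qed.

Lemma dnlsF_Ed d x mu : Ed d x -> Ed d (dnlsF x mu).
Proof.
rewrite !EdP => -[xr xs]; split; apply: siteP => j.
- set m := (n %/ d)%N; set c := cis (- (2 * pi / d%:R) : R).
  have xc i : site x i = c * site x (iter m (@ordS n) i).
    by rewrite -{1}xr of_sitesK.
  have predm i : ord_pred (iter m (@ordS n) i) = iter m (@ordS n) (ord_pred i).
    by rewrite -{1}(ord_predK i) -iterSr iterS ordSK.
  rewrite /rot /dnlsF !of_sitesK -/m -/c predm -iterS iterSr !(xc j) (xc (ordS j)).
  rewrite (xc (ord_pred j)) normrM norm_cis mul1r.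
  by rewrite !mulrDr mulrN 2!(mulrCA c) (mulrCA c 2).
- have xc i : (site x (ord_neg i))^* = site x i by rewrite -{2}xs of_sitesK.
  have norm_conj i : `|site x (ord_neg i)| = `|site x i|.
    by rewrite -(xc i) !normc_def; case: (site x _) => u v /=; rewrite sqrrN.
  rewrite /refl /dnlsF !of_sitesK norm_conj -ord_neg_pred -ord_negS.
  have nE : `|site x j| = (complex.Re `|site x j|)%:C by rewrite normc_def.
  have cM (u v : R[i]) : (u * v)^* = u^*%C * v^*%C by rewrite -rmorphM.
  have cD (u v : R[i]) : (u + v)^* = u^*%C + v^*%C by rewrite -rmorphD.
  have cN (u : R[i]) : (- u)^* = - u^*%C by rewrite -rmorphN.
  rewrite nE !expr2 !(cD, cN, cM, xc, conjc_real, conjc_nat).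
  by congr (_ + _); rewrite addrC [X in _ + X]addrC addrA.
Qed.

(* f_d = F|E_d : E_d -> E_d (well-defined by dnlsF_Ed), read in the basis of  *)
(* E_d formed by the rows of row_base (Ed_mx d): the point with coordinates u *)
(* is u *m row_base (Ed_mx d), and pinvmx recovers the coordinates.           *)
Definition fd d mu (u : 'rV[R]_(\rank (Ed_mx d))) : 'rV[R]_(\rank (Ed_mx d)) :=
  dnlsF (u *m row_base (Ed_mx d)) mu *m pinvmx (row_base (Ed_mx d)).

Definition Dxfd d x mu : 'M[R]_(\rank (Ed_mx d)) :=
  jacobian (@fd d mu) (x *m pinvmx (row_base (Ed_mx d))).

(* T, S and G; the closure of G may be taken in R^2n * R since E_d is closed. *)
Definition trivial_set : set ('rV[R]_(n + n) * R) :=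
  Gamma_orbit (@abar R n) `*` setT.

Definition zero_set d : set ('rV[R]_(n + n) * R) :=
  [set z | Ed d z.1 /\ dnlsF z.1 z.2 = 0].

Definition nontrivial_set d := zero_set d `\` trivial_set.

Definition bifurcation_points d :=
  closure (nontrivial_set d) `\` nontrivial_set d.

(* A relation rather than a function: eta is unique when it exists, and the   *)
(* existence of the limiting value is part of the claim below.                *)
Definition is_local_degree d z (eta : int) := \forall rho \near (0 : R)^'+,
  sgz (\det (Dxfd d z.1 (z.2 - rho))) - sgz (\det (Dxfd d z.1 (z.2 + rho))) = eta.

Definition maximal_symmetry d z0 := \forall w \near z0, nontrivial_set d w ->
  Ed d w.1 /\
  forall p, (p %| n)%N -> tildeD d `<` tildeD p -> ~ Ed p w.1.

(* Finiteness of B is required because \sum_(z \in B) would be 0 by           *)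
(* convention on an infinite support.                                         *)
Definition global_bifurcation d mu0 :=
  let z0 := (@abar R n, mu0) in
  [/\ bifurcation_points d z0, maximal_symmetry d z0
    & let C := connected_component (closure (nontrivial_set d)) z0 in
      let B := C `&` trivial_set `&` bifurcation_points d in
      bounded_set C ->
      [/\ finite_set B, B `\ z0 !=set0 &
          exists2 eta : 'rV[R]_(n + n) * R -> int,
            forall z, B z -> is_local_degree d z (eta z) &
            \sum_(z \in B) eta z = 0]].

End Bifurcation.

(* Main.v *)
Require Import Defs.
From HB Require Import structures.
From mathcomp Require Import all_boot all_order all_algebra all_fingroup ring lra zify.
From mathcomp Require Import all_classical all_reals all_analysis.
From mathcomp Require Import complex.
Import Defs.

(** Along the rotating wave the linearization of F restricted to E_d is
    symmetric, and depends on the amplitude mu only through mu ^ 2. Discrete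
    Fourier analysis splits it into blocks of size at most 2, indexed by the
    pairs {k, n - k}, and the block of k is singular exactly at mu ^ 2 =
    delta_k; there the kernel in the reflection-symmetric states is a line
    spanned by one explicit mode, which lies in E_p if and only if p divides
    k. So on E_d, with d = gcd (k, n), the determinant changes sign at sqrt
    delta_k, while on E_p with p not dividing k it does not vanish there and
    the wave is an isolated zero. The second fact is the maximality of the
    symmetry; the first one must be turned into a branch.

    What turns a sign change into a branch, and a bounded branch into a
    vanishing sum, is a topological degree. Over a cubical grid, the signs
    of the N components of a map are N integer cochains of degree 0; the cup
    product of their coboundaries is an N-cocycle, and it vanishes on every
    cell on which some component keeps its sign, that is away from the
    zeros. The degree of a map at a point is the sum of this cocycle over
    the cells near the point ([grid_degree]). In dimension N + 1, Stokes'
    formula for the cocycle ([cup_stokes]) says that a bounded set whose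
    boundary meets the zeros of f only at finitely many points of horizontal
    lids has balanced degrees on its upper and lower lids ([balance]).
    Applied to a cylinder this is homotopy invariance
    ([grid_degree_homotopy]); a homotopy from an invertible matrix to a
    monomial one, along which the determinant is constant, and a direct
    count for monomial matrices then give that the degree of an invertible
    linear map is the sign of its determinant ([linear_degree]), and the
    same holds near a zero with invertible derivative ([local_degree]).

    Suppose that the zeros outside the trivial lines are contained in a
    compact set Z0 and a closed set L disjoint from it. A neighbourhood of
    Z0, with thin tubes removed along the trivial lines and short tubes put
    back around the bifurcation points, has its only zeros on the boundary
    at the ends of the short tubes; balancing the degrees gives that the
    local degrees in Z0 add up to zero ([degree_balance]). With Z0 empty, a
    single point of the trivial line with nonzero local degree must be in
    the closure of the nontrivial zeros: this is bifurcation. A bounded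
    component C of the bifurcation point need not be isolated in the closure
    of the nontrivial zeros, but it is contained in a compact, relatively
    open piece which avoids the finitely many critical points not in C
    ([bounded_component_isolated]: in a compact space components are
    quasicomponents). Taking this piece for Z0 gives the sum over C. The sum
    has finitely many terms because, on each of the at most four waves of
    the orbit that lie in E_d, the determinant is a polynomial in mu, and it
    is not zero since the linearization is invertible at mu ^ 2 = 3; and C
    contains another bifurcation point since the local degree at the first
    one is not zero. *)

Set Implicit Arguments.
Unset Strict Implicit.
Unset Printing Implicit Defensive.

Import Order.TTheory GRing.Theory Num.Theory.
Import numFieldNormedType.Exports.

Local Open Scope classical_set_scope.
Local Open Scope ring_scope.

(** * Alternating sums and cup products of integer cochains *)

Section AlternatingSums.
Variable V : zmodType.
Implicit Types (D r : seq V) (phi psi : V -> seq V -> int).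

(** The entries of [D] are removed one after the other, with alternating
    signs: for [D = [:: v_0; v_1; ...]] this is the sum over i of
    (-1)^i phi v_i (D without v_i). When [D] lists the edges of a cube, it is a
    signed sum over its faces. *)
Fixpoint altsum D phi : int :=
  if D is v :: D' then phi v D' - altsum D' (fun w r => phi w (v :: r)) else 0.

Lemma eq_altsum D phi psi :
  (forall v r, perm_eq (v :: r) D -> phi v r = psi v r) ->
  altsum D phi = altsum D psi.
Proof.
elim: D phi psi => [//|v D IH] phi psi eq_phi /=.
rewrite eq_phi //; congr (_ - _); apply: IH => w r wr; apply: eq_phi.
apply: (perm_trans (permEl (perm_catCA [:: w] [:: v] r))).
by rewrite perm_cons.
Qed.

Lemma altsum0 D phi :
  (forall v r, perm_eq (v :: r) D -> phi v r = 0) -> altsum D phi = 0.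
Proof.
move=> phi0; rewrite (eq_altsum phi0).
by elim: D {phi0} => //= v D ->; rewrite subr0.
Qed.

Lemma altsumB D phi psi :
  altsum D (fun v r => phi v r - psi v r) = altsum D phi - altsum D psi.
Proof. by elim: D phi psi => [|v D IH] phi psi //=; rewrite IH; ring. Qed.

Lemma altsumZ c D phi : altsum D (fun v r => c * phi v r) = c * altsum D phi.
Proof. by elim: D phi => [|v D IH] phi /=; rewrite ?IH; ring. Qed.

Lemma altsum_sum (I : finType) (P : I -> V -> seq V -> int) D :
  altsum D (fun v r => \sum_i P i v r) = \sum_i altsum D (P i).
Proof.
elim: D P => [|v D IH] P /=; first by rewrite big1.
by rewrite IH sumrB.
Qed.

(** Removing v and then w from [D] carries the opposite sign of removing w and
    then v: this is d o d = 0 in its asymmetric form. *)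
Lemma altsum_swap D (phi : V -> V -> seq V -> int) :
  altsum D (fun v r => altsum r (phi v)) =
  - altsum D (fun v r => altsum r (fun w => phi w v)).
Proof.
elim: D phi => [|u D IH] phi /=; first by rewrite oppr0.
rewrite !altsumB (IH (fun v w r => phi v w (u :: r))); ring.
Qed.

Lemma altsum_sym D (phi : V -> V -> seq V -> int) :
  (forall v w r, phi v w r = phi w v r) ->
  altsum D (fun v r => altsum r (phi v)) = 0.
Proof.
move=> phiC; have := altsum_swap D phi.
rewrite [in RHS](@eq_altsum _ _ (fun v r => altsum r (phi v))); last first.
  by move=> v r _; apply: eq_altsum => w s _.
by move=> ?; lia.
Qed.

Lemma altsum_enum n (e : 'I_n.+1 -> V) phi :
  altsum [seq e i | i <- enum 'I_n.+1] phi =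
  \sum_(i < n.+1) (-1) ^+ i * phi (e i) [seq e (lift i j) | j <- enum 'I_n].
Proof.
elim: n e phi => [|n IH] e phi.
  rewrite enum_ordSl /= !big_ord_recl big_ord0 expr0 mul1r addr0.
  by rewrite (size0nil (size_enum_ord 0)) /= subr0.
rewrite enum_ordSl /= -map_comp /= IH [in RHS]big_ord_recl expr0 mul1r.
have E0 : [seq e (lift ord0 j) | j <- enum 'I_n.+1] =
  e (lift ord0 ord0) :: [seq e (lift ord0 (lift ord0 j)) | j <- enum 'I_n].
  by rewrite enum_ordSl /= -map_comp.
congr (_ + _); rewrite -sumrN; apply: eq_bigr => i _.
rewrite [in RHS]/= /bump /= add1n exprS mulN1r mulNr; congr (- (_ * phi _ _)).
rewrite enum_ordSl /= -map_comp; congr (_ :: _).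
  by congr e; apply: val_inj.
apply: eq_map => j /=; congr e; apply: val_inj => /=.
by rewrite /bump /=; lia.
Qed.

(** The cup product of the coboundaries of the functions [Hs], evaluated on the
    cube with corner [p] and edges [D]: expanded, it is the sum over the
    monotone paths along the edges, with the sign of the permutation, of the
    product of the increments of the successive functions of [Hs]. *)
Fixpoint cup (Hs : seq (V -> int)) (p : V) (D : seq V) : int :=
  if Hs is H :: Hs' then
    altsum D (fun v r => (H (p + v) - H p) * cup Hs' (p + v) r)
  else 1.

(** A coboundary is a cocycle, and so is a product of cocycles. The induction
    is the Leibniz rule written out: of the four double sums, [T1] and [T4]
    vanish by symmetry in the two removed edges, and [T2], [T3] cancel by
    antisymmetry. *)
Lemma cup_cocycle Hs p D :
  altsum D (fun v r => cup Hs (p + v) r - cup Hs p r) = 0.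
Proof.
elim: Hs p D => [|H Hs IH] p D /=.
  by apply: altsum0 => v r _; rewrite subrr.
pose S F := altsum D (fun v r => altsum r (F v)).
pose w := cup Hs.
have T1 : S (fun v v' r => H (p + v + v') * w (p + v + v') r) = 0.
  by apply: altsum_sym => v v' r; rewrite -!addrA (addrC v).
have T2 : S (fun v v' r => H (p + v) * w (p + v + v') r) =
          S (fun v v' r => H (p + v) * w (p + v) r).
  apply: eq_altsum => v r _; rewrite !altsumZ; congr (_ * _).
  by apply/eqP; rewrite -subr_eq0 -altsumB; apply/eqP; apply: IH.
have T3 : S (fun v v' r => H (p + v') * w (p + v') r) =
          - S (fun v v' r => H (p + v) * w (p + v) r) by exact: altsum_swap.
have T4 : S (fun v v' r => H p * w (p + v') r) = 0.
  rewrite /S (_ : altsum D _ = S (fun v v' r => H p * w p r)); last first.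
    apply: eq_altsum => v r _; rewrite !altsumZ; congr (_ * _).
    by apply/eqP; rewrite -subr_eq0 -altsumB; apply/eqP; apply: IH.
  by apply: altsum_sym.
rewrite altsumB.
have -> : altsum D (fun v r => altsum r (fun v' r' =>
      (H (p + v + v') - H (p + v)) * cup Hs (p + v + v') r')) =
   S (fun v v' r => H (p + v + v') * w (p + v + v') r) -
   S (fun v v' r => H (p + v) * w (p + v + v') r).
  rewrite /S -altsumB; apply: eq_altsum => v r _; rewrite -altsumB.
  by apply: eq_altsum => v' r' _; rewrite mulrBl.
have -> : altsum D (fun v r => altsum r (fun v' r' =>
      (H (p + v') - H p) * cup Hs (p + v') r')) =
   S (fun v v' r => H (p + v') * w (p + v') r) -
   S (fun v v' r => H p * w (p + v') r).
  rewrite /S -altsumB; apply: eq_altsum => v r _; rewrite -altsumB.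
  by apply: eq_altsum => v' r' _; rewrite mulrBl.
by rewrite T1 T2 T3 T4; ring.
Qed.

(** Every path across the cell uses one increment of each function, so a single
    function that is constant on the cell makes every term vanish. The points of
    a cell are the corner plus the sums of parts of the edges; these are the
    left pieces [s] of the rearrangements [s ++ s'] of [D]. *)
Lemma cup_const (T : eqType) (Hf : T -> V -> int) (ts : seq T) t p D :
  t \in ts ->
  (forall s s', perm_eq (s ++ s') D -> Hf t (p + \sum_(v <- s) v) = Hf t p) ->
  cup [seq Hf t | t <- ts] p D = 0.
Proof.
elim: ts p D => [//|t' ts IH] p D; rewrite inE => tts Hc /=.
apply: altsum0 => v r vr.
have Hv : Hf t (p + v) = Hf t p.
  by have := Hc [:: v] r vr; rewrite big_seq1.
case/orP: tts => [/eqP <-|tts]; first by rewrite Hv subrr mul0r.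
rewrite (IH _ _ tts) ?mulr0 // => s s' ss'; rewrite Hv.
rewrite -addrA -(Hc (v :: s) s') ?big_cons //.
by apply: perm_trans vr; rewrite /= perm_cons.
Qed.

End AlternatingSums.

Lemma altsum_map (V W : zmodType) (g : W -> V) (D : seq W) phi :
  altsum (map g D) phi = altsum D (fun v r => phi (g v) (map g r)).
Proof. by elim: D phi => [//|v D IH] phi /=; rewrite IH. Qed.

Lemma cup_map (V W : zmodType) (f g : W -> V) (Hs : seq (V -> int)) p D :
  (forall q v, f (q + v) = f q + g v) ->
  cup Hs (f p) (map g D) = cup [seq H \o f | H <- Hs] p D.
Proof.
move=> fg; elim: Hs p D => [//|H Hs IH] p D /=.
by rewrite altsum_map; apply: eq_altsum => v r _; rewrite -fg IH.
Qed.

(** If the increment of each function along an edge does not depend on the other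
    edges, then the sum over the paths is the Leibniz formula for the
    determinant of the increments. *)
Lemma cup_det (V : zmodType) n (H : 'I_n -> V -> int) (e : 'I_n -> V) p :
  (forall j i i' q, i != i' -> H j (q + e i + e i') - H j (q + e i) =
     H j (q + e i') - H j q) ->
  cup [seq H j | j <- enum 'I_n] p [seq e i | i <- enum 'I_n] =
  \det (\matrix_(j, i) (H j (p + e i) - H j p)).
Proof.
elim: n H e p => [|n IH] H e p He.
  by rewrite (size0nil (size_enum_ord 0)) /= det_mx00.
rewrite {1}enum_ordSl /= altsum_enum (expand_det_row _ ord0).
apply: eq_bigr => i _; rewrite !mxE /cofactor add0n mulrCA; congr (_ * (_ * _)).
rewrite -map_comp (IH (H \o lift ord0) (e \o lift i)); last first.
  by move=> j k k' q kk' /=; apply: He; rewrite (inj_eq (lift_inj (h := i))).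
congr (\det _); apply/matrixP => j k; rewrite !mxE /=.
by apply: He; rewrite neq_lift.
Qed.

(** * Stokes' formula, and neighbourhoods without zeros *)

(** Stokes' formula for the set with indicator [U]. In a finite group, summation
    by parts has no boundary terms: it moves the differences of [cup] onto [U].
    The cocycle identity for the edges [a :: D] then relates the lids, across
    which [U] jumps in the direction [a], to the sides, across which it jumps in
    a direction of [D]; the sides contribute nothing by hypothesis. *)
Lemma cup_stokes (V : finZmodType) (U : V -> int) (Hs : seq (V -> int)) (a : V) (D : seq V) :
  (forall g v r, perm_eq (v :: r) D -> U (g - v) != U g -> cup Hs g (a :: r) = 0) ->
  \sum_g (U (g - a) - U g) * cup Hs g D = 0.
Proof.
move=> side.
have shift F v : \sum_g U g * (F (g + v) - F g) = \sum_g (U (g - v) - U g) * F g.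
  rewrite (eq_bigr (fun g => U g * F (g + v) - U g * F g)); last by move=> g _; rewrite mulrBr.
  rewrite sumrB (reindex_inj (addIr (- v))) -sumrB /=.
  by apply: eq_bigr => g _; rewrite subrK mulrBl.
rewrite -shift (eq_bigr (fun g => altsum D (fun v r =>
    U g * (cup Hs (g + v) (a :: r) - cup Hs g (a :: r))))).
  rewrite -altsum_sum; apply: altsum0 => v r vr.
  rewrite (shift (fun g => cup Hs g (a :: r))) big1 // => g _.
  have [->|Ug] := eqVneq (U (g - v)) (U g); first by rewrite subrr mul0r.
  by rewrite (side _ _ _ vr Ug) mulr0.
move=> g _; rewrite altsumZ; congr (_ * _).
have /= /eqP := cup_cocycle Hs g (a :: D).
by rewrite subr_eq0 => /eqP.
Qed.

Section Norms.
Variable R : realType.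
Lemma near_dist (V : normedModType R) (z : V) (e : R) : 0 < e -> \forall z' \near z, `|z - z'| < e.
Proof. by move=> e0; have /cvgrPdist_lt := @cvg_id _ (nbhs z); apply. Qed.

(** The bound is twice [e] so that the [e]-neighbourhoods of the two sets are
    disjoint. *)
Lemma compact_gap (V : normedModType R) (A B : set V) : compact A -> closed B -> (forall z, A z -> ~ B z) ->
  exists2 e : R, 0 < e & forall z, A z -> forall z', `|z - z'| < e + e -> ~ B z'.
Proof.
move=> Ac Bc AB.
have cov : \forall e \near (0 : R)^'+, A `<=` (fun z => forall z', `|z - z'| < e + e -> ~ B z').
  have /compact_near_coveringP := Ac; apply => z Az.
  have /nbhs_normP[d /= d0 dL] : \forall z' \near z, ~ B z'.
    by apply: open_nbhs_nbhs; split; [exact: closed_openC|exact: AB].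
  have d40 : 0 < d / 4 by rewrite divr_gt0.
  exists ([set z' | `|z - z'| < d / 4], [set e | e < d / 4]) => /=.
    by split; [exact: (near_dist z)|exact: nbhs_right_lt].
  move=> [z' e] /= [zz' ed] z'' z'z''.
  by apply: dL => /=; have := ler_normD (z - z') (z' - z''); rewrite addrA subrK; lra.
near (0 : R)^'+ => e; exists e; first by near: e; exact: nbhs_right_gt.
by near: e.
Unshelve. all: by end_near. Qed.

Lemma rV_normE n (x : 'rV[R]_n) : `|x| = \big[Num.max/0]_ij `|x ij.1 ij.2|.
Proof. exact: mx_normrE. Qed.

Lemma rV_normP n (x : 'rV[R]_n) (e : R) : 0 <= e -> (`|x| <= e) <-> (forall i, `|x 0 i| <= e).
Proof.
move=> e0; rewrite rV_normE; split=> [xe i|xe].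
  by apply: le_trans xe; apply: (le_bigmax _ (fun ij => `|x ij.1 ij.2|) (0, i)).
by apply: bigmax_le => // -[i j] _ /=; rewrite (ord1 i).
Qed.

Lemma rV_normlt n (x : 'rV[R]_n) (e : R) : 0 < e -> (`|x| < e) <-> (forall i, `|x 0 i| < e).
Proof.
move=> e0; split=> [xe i|xe].
  by apply: le_lt_trans xe; apply: (rV_normP x (normr_ge0 x)).1.
by rewrite rV_normE; apply: bigmax_lt => // -[i j] _ /=; rewrite (ord1 i).
Qed.

Lemma pair_normE n (z : 'rV[R]_n * R) : `|z| = Num.max `|z.1| `|z.2|.
Proof. by []. Qed.
Lemma pair_norm1 n (z : 'rV[R]_n * R) : `|z.1| <= `|z|.
Proof. by rewrite pair_normE le_max lexx. Qed.
Lemma pair_norm2 n (z : 'rV[R]_n * R) : `|z.2| <= `|z|.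
Proof. by rewrite pair_normE le_max lexx orbT. Qed.

Lemma compact_sphere n : compact [set v : 'rV[R]_n | `|v| = 1].
Proof.
apply: bounded_closed_compact.
  by exists 1; split=> [|M M1 x /= ->]; [exact: num_real|exact: ltW].
rewrite (_ : [set _ | _] = (fun x : 'rV[R]_n => `|x|) @^-1` [set 1])//.
by apply: closed_comp => [x _|]; [exact: norm_continuous|exact: closed_eq].
Qed.

End Norms.

Section Boundary.
Variables (R : realType) (N : nat).
Notation X := 'rV[R]_N.
Notation Z := ('rV[R]_N * R)%type.

(** Continuous convergence, that is locally uniform convergence to a continuous
    limit, as the mesh [h] decreases to 0. Maps that depend on the mesh occur
    because a slice of a map at a given level is replaced by the slice at the
    nearest layer of the grid. *)
Definition cont_conv (fh : R -> Z -> X) (f : Z -> X) :=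
  forall (z : Z) e, 0 < e -> \forall z' \near z & h \near (0 : R)^'+, `|fh h z' - f z| < e.

Lemma near_left (z : Z) (P : Z -> Prop) : (\forall z' \near z, P z') ->
  \forall z' \near z & h \near (0 : R)^'+, P z'.
Proof. by move=> Pz; exists (P, setT) => /= [|[z' h] []//]; split=> //; exact: filterT. Qed.

Lemma near_right (z : Z) (P : R -> Prop) : (\forall h \near (0 : R)^'+, P h) ->
  \forall z' \near z & h \near (0 : R)^'+, P h.
Proof. by move=> Pz; exists (setT, P) => /= [|[z' h] []//]; split=> //; exact: filterT. Qed.

(** This passes from points to whole grid cells, whose size is [h]. *)
Lemma near_fatten (Q : R -> Z -> Prop) (z : Z) :
  (\forall z' \near z & h \near (0 : R)^'+, Q h z') ->
  \forall z' \near z & h \near (0 : R)^'+, forall z'', `|z'' - z'| <= h -> Q h z''.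
Proof.
case=> -[A B] /= [/nbhs_normP [e /= e0 Ae] Bh] AB.
exists ([set z' | `|z - z'| < e / 2], B `&` [set h | h < e / 2]) => /=.
  split; first by apply: (near_dist z); rewrite divr_gt0.
  by apply: filterI => //; apply: nbhs_right_lt; rewrite divr_gt0.
move=> [z' h] /= [z'z [Bh' he]] z'' z''z'; apply: (AB (z'', h)); split=> //=.
apply: Ae => /=; rewrite -(subrK z' z) -addrA (le_lt_trans (ler_normD _ _))//.
by rewrite (splitr e) ltrD// (le_lt_trans _ he)// distrC.
Qed.

Lemma ball_compact (c : R) : compact [set z : Z | `|z| <= c].
Proof.
have -> : [set z : Z | `|z| <= c] = [set x : X | `|x| <= c] `*` `[- c, c].
  apply/seteqP; split=> -[x t] /=; rewrite pair_normE /= ge_max in_itv /= -ler_norml.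
    by case/andP.
  by case=> -> ->.
apply: compact_setX; last exact: segment_compact.
apply: bounded_closed_compact.
  by exists c; split=> [|M cM]; [exact: num_real|]; move=> x /= xc; exact: le_trans xc (ltW cM).
rewrite (_ : [set _ | _] = (fun x : X => `|x|) @^-1` [set t | t <= c])//.
by apply: closed_comp => [x _|]; [exact: norm_continuous|exact: closed_le].
Qed.

Variables (fh : R -> Z -> X) (f : Z -> X).
Hypothesis fhf : cont_conv fh f.
Variables (U : set Z) (E : seq Z) (s : Z -> bool).
Hypothesis zeros : forall z, f z = 0 -> z \in E \/ \forall z' \near z, U z' <-> U z.

(** Locally this is the alternative between f z <> 0 and f z = 0, and compactness
    of the ball makes it uniform. The first kind of cell will have a vanishing
    cup product, the second will not meet the boundary of [U], and the third is
    close to one of the finitely many boundary zeros. *)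
Lemma cell_trichotomy (c tau : R) : 0 < tau ->
  \forall h \near (0 : R)^'+, forall z', `|z'| <= c ->
  [\/ exists j, forall z'', `|z'' - z'| <= h ->
         (0 < fh h z'' 0 j) = (0 < fh h z' 0 j),
      forall z'', `|z'' - z'| <= h -> (U z'' <-> U z') |
      exists2 e, e \in E & `|z' - e| < tau ].
Proof.
move=> tau0; have /compact_near_coveringP := @ball_compact c.
move=> /(_ R (0 : R)^'+ (fun h z' => [\/ exists j, forall z'', `|z'' - z'| <= h ->
         (0 < fh h z'' 0 j) = (0 < fh h z' 0 j),
      forall z'', `|z'' - z'| <= h -> (U z'' <-> U z') |
      exists2 e, e \in E & `|z' - e| < tau ])) H.
apply: H => z _.
have [fz0|fz0] := eqVneq (f z) 0.
  case: (zeros fz0) => [zE|Uz].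
    apply: filterS (near_left (near_dist z tau0)) => -[z' h] /= z'z.
    by apply: Or33; exists z => //; rewrite distrC.
  have := @near_fatten (fun h z' => U z' <-> U z) z (near_left Uz).
  apply: filterS2 (near_right z (nbhs_right_gt 0)).
    move=> [z' h] /= h0 HU; apply: Or32 => z'' /HU ->.
    by rewrite HU // subrr normr0 ltW.
have [j fj] : exists j, f z 0 j != 0.
  apply/existsP; apply: contraR fz0 => /existsPn fz; apply/eqP/rowP => j.
  by rewrite mxE; apply/eqP; move: (fz j); rewrite negbK.
have fj0 : 0 < `|f z 0 j| by rewrite normr_gt0.
have := @near_fatten (fun h z' => `|fh h z' - f z| < `|f z 0 j|) z (fhf z fj0).
apply: filterS2 (near_right z (nbhs_right_gt 0)).
move=> [z' h] /= h0 Hf; apply: Or31; exists j.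
have sg z'' : `|z'' - z'| <= h -> (0 < fh h z'' 0 j) = (0 < f z 0 j).
  move=> /Hf; rewrite rV_normlt ?normr_gt0// => /(_ j); rewrite !mxE.
  have [f0|f0] := ltP 0 (f z 0 j).
    by rewrite (gtr0_norm f0) ltr_distl => /andP[]; rewrite subrr.
  rewrite (ler0_norm f0) ltr_distl => /andP[_]; rewrite subrr => flt.
  by apply/negbTE; rewrite -leNgt ltW.
by move=> z'' /sg ->; rewrite sg // subrr normr0 ltW.
Qed.

End Boundary.

(** * The degree of a map on a cubical grid *)

Lemma near_all (T : eqType) (I : Type) (F : set_system I) (FF : Filter F)
    (E : seq T) (P : T -> I -> Prop) :
  (forall e, e \in E -> \forall t \near F, P e t) ->
  \forall t \near F, forall e, e \in E -> P e t.
Proof.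
elim: E => [_|e E IH PE]; first by apply: filterE => t e; rewrite in_nil.
apply: filterS2 (PE e (mem_head _ _)) (IH _); last first.
  by move=> e' e'E; apply: PE; rewrite inE e'E orbT.
by move=> t Pe PEt e'; rewrite inE => /orP[/eqP ->|/PEt].
Qed.

Section Grid.
Variables (R : realType) (N : nat).
Notation X := 'rV[R]_N.
Notation Z := ('rV[R]_N * R)%type.

Section Mesh.
Variables (b h : R).

(** The nodes start at [- b] and reach beyond [b + 1]. They are indexed by
    the cyclic group 'I_(mesh_size.+2), whose addition is a translation of the
    grid as long as it does not wrap around; the margin ensures that this happens
    only outside of the bounded sets in use. *)
Definition mesh_size : nat := Num.truncn ((2 * b + 2) / h).
Notation K := mesh_size.

Definition nodepos (t : 'I_K.+2) : R := h * (t : nat)%:R - b.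
Definition gridpos (x : 'rV['I_K.+2]_N) : X := \row_i nodepos (x 0 i).
Definition positive_at (phi : X -> X) (j : 'I_N) (x : 'rV['I_K.+2]_N) : int :=
  ((0 < phi (gridpos x) 0 j)%R : nat)%:Z.
(** The functions are the indicators of the half spaces where a component is
    positive, and the edges of the cells are the coordinate vectors. The sum
    counts, with signs, the zeros near [y]. *)
Definition grid_degree (phi : X -> X) (y : X) (tau : R) : int :=
  \sum_(x : 'rV['I_K.+2]_N | `|gridpos x - y| < tau)
    cup [seq positive_at phi j | j <- enum 'I_N] x [seq delta_mx 0 i | i <- enum 'I_N].
Definition layer_index (m : R) : nat := `|Num.ceil ((m + b) / h)|%N.
(** The first level of the grid that is not below [m]. *)
Definition layer (m : R) : R := h * (layer_index m)%:R - b.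

Hypotheses (h0 : 0 < h) (h1 : h <= 1) (b0 : 0 < b).

Lemma mesh_sizeP : 2 * b + 2 < h * K.+1%:R.
Proof.
have r0 : 0 <= (2 * b + 2) / h by apply: divr_ge0; [move: b0; lra|exact: ltW].
by have /andP[_] := truncn_itv r0; rewrite ltr_pdivrMr // (mulrC _ h).
Qed.

Lemma nodepos_last : b < nodepos ord_max.
Proof. by rewrite /nodepos /=; move: b0 mesh_sizeP; lra. Qed.

Lemma nodeposS t : nodepos t <= b + 1 -> nodepos (t + 1) = nodepos t + h.
Proof.
rewrite /nodepos => tb.
have tK : (t.+1 < K.+2)%N.
  rewrite ltnS -(ltr_nat R) -(ltr_pM2l h0) (le_lt_trans _ mesh_sizeP)//; move: h1 b0 tb; lra.
by rewrite /= (@modn_small 1)// addn1 modn_small// -natr1; ring.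
Qed.

Lemma nodeposB t : t != 0 -> nodepos (t - 1) = nodepos t - h.
Proof.
move=> t0; have t0' : (0 < t)%N by rewrite lt0n.
rewrite /nodepos /=.
have -> : ((t + (K.+2 - 1 %% K.+2) %% K.+2) %% K.+2 = t.-1)%N.
  rewrite (@modn_small 1)// subn1 /= (@modn_small K.+1)//.
  rewrite -{1}(prednK t0') addSnnS modnDr modn_small//.
  by rewrite (leq_ltn_trans _ (ltn_ord t))// leq_pred.
by rewrite -{2}(prednK t0') -natr1; ring.
Qed.

Lemma nodepos0 : nodepos 0 = - b.
Proof. by rewrite /nodepos mulr0 sub0r. Qed.

Lemma nodepos0B : nodepos (0 - 1) > b.
Proof.
suff -> : (0 - 1 : 'I_K.+2) = ord_max by exact: nodepos_last.
apply: val_inj => /=; rewrite add0n (@modn_small 1)// subn1 /= (@modn_small K.+1)//.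
by rewrite modn_small.
Qed.

Lemma layer_indexP m : `|m| < b ->
  m <= layer m < m + h /\ (layer_index m < K.+2)%N.
Proof.
rewrite ltr_norml => /andP[mb bm]; rewrite /layer /layer_index.
have x0 : 0 < (m + b) / h by rewrite divr_gt0//; move: b0 mb; lra.
set x := (m + b) / h in x0 *.
have xh : x * h = m + b by rewrite /x divfK// gt_eqF.
have /andP[c1 c2] := ceil_itv x.
have c0 : (0 <= Num.ceil x)%R by rewrite ceil_ge0 //; move: x0; lra.
have E : (`|Num.ceil x|%N)%:R = (Num.ceil x)%:~R :> R.
  by rewrite -[in RHS](gez0_abs c0).
split.
  rewrite E -lerBlDr opprK ltrBlDr; apply/andP; split.
    by rewrite -xh mulrC ler_pM2l.
  have : h * (Num.ceil x - 1)%:~R < h * x by rewrite ltr_pM2l.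
  by rewrite intrD mulrDr mulrN1 mulrC (mulrC h x) xh; lra.
rewrite -(ltr_nat R) -(ltr_pM2l h0) E.
have : h * (Num.ceil x - 1)%:~R < h * x by rewrite ltr_pM2l.
rewrite intrD mulrDr mulrN1 (mulrC h x) xh.
move: h1 bm mesh_sizeP; rewrite -[in X in _ -> _ -> _ -> _ -> _ < X]natr1; move: h0; lra.
Qed.

(** The layer of [m] is the node at which the indicator of m <= t jumps. *)
Lemma eq_layer m (t : 'I_K.+2) : `|m| < b ->
  (t == layer_index m :> nat) = (nodepos t - h < m <= nodepos t).
Proof.
move=> mb; have [/andP[l1 l2] lK] := layer_indexP mb.
rewrite /layer in l1 l2; rewrite /nodepos.
apply/eqP/idP => [->|/andP[t1 t2]]; first by apply/andP; split; move: h0; lra.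
have : (h * t%:R < h * (layer_index m)%:R + h) && (h * (layer_index m)%:R < h * t%:R + h).
  by apply/andP; split; lra.
rewrite -[X in _ < _ * _ + X]mulr1 -[X in _ && (_ < _ * _ + X)]mulr1 -!mulrDr !ltr_pM2l// !natr1 !ltr_nat !ltnS.
by rewrite -eqn_leq => /eqP.
Qed.

End Mesh.
End Grid.

(** * Balance of degrees between the lids of a bounded set *)

(* The product of two cyclic grids is a finite group, as Stokes' formula needs. *)
HB.instance Definition _ (A B : finZmodType) := Finite.on (A * B)%type.

Section Balance.
Variables (R : realType) (N : nat).
Notation X := 'rV[R]_N.
Notation Z := ('rV[R]_N * R)%type.

Section OneMesh.
Variables (b h : R).
Hypotheses (h0 : 0 < h) (h1 : h <= 1) (b0 : 0 < b).
Notation K := (mesh_size b h).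
Notation W := ('rV['I_K.+2]_N * 'I_K.+2)%type.

Definition cellpos (g : W) : Z := (gridpos g.1, nodepos g.2).
Definition hdir (i : 'I_N) : W := (delta_mx 0 i, 0).
Definition tdir : W := (0, 1).
Definition hdirs := [seq hdir i | i <- enum 'I_N].

Lemma hdir_inj : injective hdir.
Proof.
move=> i j [] /matrixP /(_ 0 j); rewrite !mxE eqxx /=.
by case: eqVneq => //= _ /esym/eqP; rewrite eqxx oner_eq0.
Qed.

Lemma uniq_dirs : uniq (tdir :: hdirs).
Proof.
rewrite /= (map_inj_uniq hdir_inj) enum_uniq andbT.
apply/mapP => -[i _] [] _ /eqP; by rewrite oner_eq0.
Qed.

Lemma cellposP g (c : R) : 0 <= c -> `|cellpos g| <= c <->
  (forall i, `|nodepos (g.1 0 i)| <= c) /\ `|nodepos g.2| <= c.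
Proof.
move=> c0; rewrite pair_normE ge_max; split.
  by case/andP=> /rV_normP-/(_ c0) gc ->; split=> // i; have := gc i; rewrite mxE.
by case=> gc ->; rewrite andbT; apply/rV_normP => // i; rewrite mxE.
Qed.

Lemma cellpos_ltP g (c : R) : 0 < c -> `|cellpos g| < c <->
  (forall i, `|nodepos (g.1 0 i)| < c) /\ `|nodepos g.2| < c.
Proof.
move=> c0; rewrite pair_normE gt_max; split.
  by case/andP=> /rV_normlt-/(_ c0) gc ->; split=> // i; have := gc i; rewrite mxE.
by case=> gc ->; rewrite andbT; apply/rV_normlt => // i; rewrite mxE.
Qed.

Lemma cellpos_distP g g' (c : R) : 0 <= c -> `|cellpos g - cellpos g'| <= c <->
  (forall i, `|nodepos (g.1 0 i) - nodepos (g'.1 0 i)| <= c) /\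
  `|nodepos g.2 - nodepos g'.2| <= c.
Proof.
move=> c0; rewrite pair_normE ge_max; split.
  by case/andP=> /rV_normP-/(_ c0) gc ->; split=> // i; have := gc i; rewrite !mxE.
by case=> gc ->; rewrite andbT; apply/rV_normP => // i; rewrite !mxE.
Qed.

(** So a point of a cell is at most one step away from the corner in each
    coordinate. *)
Lemma subsum01 (s : seq W) : uniq s -> {subset s <= tdir :: hdirs} ->
  (forall i, (\sum_(v <- s) v).1 0 i \in [:: 0; 1]) /\ (\sum_(v <- s) v).2 \in [:: 0; 1].
Proof.
move=> us sD.
have cnt (u : W) : (\sum_(v <- s) (v == u)%:R : 'I_K.+2) \in [:: 0; 1].
  rewrite -natr_sum (_ : (\sum_(v <- s) _)%N = (u \in s)) ?inE; last first.
    rewrite -(count_uniq_mem u us) -sum1_count [RHS]big_mkcond /=.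
    by apply: eq_bigr => v _ /=; case: (v == u).
  by case: (u \in s); rewrite eqxx ?orbT.
split=> [i|].
  rewrite (_ : _ 0 i = \sum_(v <- s) (v == hdir i)%:R); first exact: cnt.
  rewrite (raddf_sum fst) summxE !big_seq; apply: eq_bigr => v /sD.
  rewrite inE => /orP[/eqP ->|/mapP[j _ ->]]; rewrite !mxE.
    rewrite (_ : (_ == _) = false) //; apply/eqP => -[_ /eqP]; by rewrite oner_eq0.
  rewrite eqxx /= eq_sym; congr (_%:R); congr nat_of_bool.
  by rewrite (inj_eq hdir_inj).
rewrite (_ : (\sum_(v <- s) v).2 = \sum_(v <- s) (v == tdir)%:R); first exact: cnt.
rewrite (raddf_sum snd) !big_seq; apply: eq_bigr => v /sD.
rewrite inE => /orP[/eqP ->|/mapP[j _ ->]]; first by rewrite eqxx.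
by rewrite (_ : (_ == _) = false) //; apply/eqP => -[_ /eqP]; rewrite eq_sym oner_eq0.
Qed.

Lemma cell_diam g (s : seq W) : `|cellpos g| <= b + 1 ->
  uniq s -> {subset s <= tdir :: hdirs} ->
  `|cellpos (g + \sum_(v <- s) v) - cellpos g| <= h.
Proof.
move=> gb us sD; have [sh st] := subsum01 us sD.
have b1 : 0 <= b + 1 by move: b0; lra.
have [gh gt] := (cellposP g b1).1 gb.
have step (t d : 'I_K.+2) : `|nodepos t| <= b + 1 -> d \in [:: 0; 1] ->
    `|nodepos (t + d) - nodepos t| <= h.
  rewrite !inE => tb /orP[] /eqP ->; first by rewrite addr0 subrr normr0 ltW.
  rewrite nodeposS //; last by rewrite (le_trans (ler_norm _)).
  by rewrite addrC addKr ger0_norm // ltW.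
apply/cellpos_distP; first exact: ltW.
by split=> [i|]; rewrite ?mxE; apply: step.
Qed.

(** A cell across which the bounded set changes cannot be one at which the cyclic
    grid wraps around, since this happens only outside of the set. *)
Lemma crossing (U : set Z) g v : (forall z, U z -> `|z| < b) ->
  v \in tdir :: hdirs -> ~ (U (cellpos (g - v)) <-> U (cellpos g)) ->
  `|cellpos g| <= b + 1 /\ `|cellpos (g - v) - cellpos g| <= h.
Proof.
move=> Ub vD nU.
have : `|cellpos (g - v)| < b \/ `|cellpos g| < b.
  by have [Ug|nUg] := pselect (U (cellpos g)); [right; exact: Ub|left; apply: Ub; apply: contrapT => nUv; tauto].
rewrite !cellpos_ltP // => near_b.
have step (t d : 'I_K.+2) : (`|nodepos (t - d)| < b \/ `|nodepos t| < b) ->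
    d \in [:: 0; 1] -> `|nodepos t| <= b + 1 /\ `|nodepos (t - d) - nodepos t| <= h.
  rewrite !inE => tb /orP[] /eqP dE; rewrite dE in tb *.
    by rewrite subr0 subrr normr0 in tb *; case: tb => /ltW tb; split; rewrite ?(ltW h0)// (le_trans tb)// lerDl.
  have t0 : t != 0.
    apply/eqP => t0; rewrite t0 in tb; case: tb; rewrite ?nodepos0 ?normrN ?(gtr0_norm b0) ?ltxx //.
    by move/(le_lt_trans (ler_norm _)); rewrite ltNge ltW // nodepos0B.
  rewrite nodeposB // in tb *; split; last by rewrite addrC addKr normrN ger0_norm // ltW.
  case: tb => [tb|/ltW tb]; last by rewrite (le_trans tb)// lerDl.
  rewrite -[X in `|X|](subrK h) (le_trans (ler_normD _ _))// lerD // ?(ltW tb)//.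
  by rewrite ger0_norm // ltW.
have b1 : 0 <= b + 1 by move: b0; lra.
have d01 : (forall i, v.1 0 i \in [:: 0; 1]) /\ v.2 \in [:: 0; 1].
  have := @subsum01 [:: v]; rewrite big_seq1 /=; apply=> // w.
  by rewrite inE => /eqP ->.
rewrite cellposP // cellpos_distP ?(ltW h0)//.
have hs i : (`|nodepos (g.1 0 i - v.1 0 i)| < b \/ `|nodepos (g.1 0 i)| < b).
  by case: near_b => -[/(_ i) + _]; rewrite ?mxE => ?; [left|right].
have ts : (`|nodepos (g.2 - v.2)| < b \/ `|nodepos g.2| < b).
  by case: near_b => -[_ +] => ?; [left|right].
by split; split=> [i|]; rewrite ?mxE;
  [have [] := step _ _ (hs i) (d01.1 i)|have [] := step _ _ ts d01.2
  |have [] := step _ _ (hs i) (d01.1 i)|have [] := step _ _ ts d01.2].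
Qed.

Variables (f : Z -> X) (U : set Z) (E : seq Z) (s : Z -> bool) (tau : R).
Hypotheses (Ub : forall z, U z -> `|z| < b)
  (ht : h < tau)
  (Eb : forall e, e \in E -> `|e| + tau < b)
  (EU : forall e, e \in E -> forall z, `|z - e| < 2 * tau ->
     (U z <-> if s e then e.2 <= z.2 else z.2 < e.2))
  (Esep : forall e e', e \in E -> e' \in E -> `|e - e'| < 2 * tau -> e = e')
  (uE : uniq E)
  (tri : forall z', `|z'| <= b + 1 ->
  [\/ exists j, forall z'', `|z'' - z'| <= h ->
         (0 < f z'' 0 j) = (0 < f z' 0 j),
      forall z'', `|z'' - z'| <= h -> (U z'' <-> U z') |
      exists2 e, e \in E & `|z' - e| < tau ]).

Definition positivity := [seq (fun g => ((0 < f (cellpos g) 0 j)%R : nat)%:Z) | j <- enum 'I_N].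

(** A cell that contributes to Stokes' formula is close to a boundary zero: of the
    three kinds of cells, the first has a vanishing cup product, and on the
    second [U] has no boundary. *)
Lemma cup_crossing g v D r : v \in tdir :: hdirs -> perm_eq D (tdir :: hdirs) ->
  {subset r <= D} -> uniq r ->
  ~ (U (cellpos (g - v)) <-> U (cellpos g)) -> cup positivity g r != 0 ->
  exists2 e, e \in E & `|cellpos g - e| < tau.
Proof.
move=> vD /perm_mem Dp rD ur nU cn0.
have [gb gv] := crossing Ub vD nU.
case: (tri gb) => [[j Hj]|HU|//]; last by case: nU; apply: HU.
move: cn0; rewrite /positivity.
rewrite (@cup_const _ _ (fun j g => ((0 < f (cellpos g) 0 j)%R : nat)%:Z) _ j) ?eqxx ?mem_enum //.
move=> l l' /[dup] /perm_uniq + /perm_mem ll'; rewrite ur cat_uniq => /and3P[ul _ _].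
rewrite Hj //; apply: cell_diam => // w wl.
by rewrite -Dp rD // -ll' mem_cat wl.
Qed.

(** A product over the horizontal directions only sees one layer. *)
Lemma cup_slice x t :
  cup positivity (x, t) hdirs =
  cup [seq @positive_at R N b h (fun x => f (x, nodepos t)) j | j <- enum 'I_N] x
    [seq delta_mx 0 i | i <- enum 'I_N].
Proof.
pose g (v : 'rV['I_K.+2]_N) : W := (v, 0).
have -> : hdirs = [seq g v | v <- [seq delta_mx 0 i | i <- enum 'I_N]].
  by rewrite -map_comp.
rewrite (@cup_map W _ (fun x => (x, t)) g).
  by rewrite /positivity -map_comp.
by move=> q v; congr pair; rewrite /= addr0.
Qed.

(** The statement for one mesh. Near a boundary zero [e] the set is a half space
    above or below the level of [e], so its sides do not meet the zeros and its
    lid is the layer of [e]; there the jump of the indicator of [U] is the sign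
    given by [s e]. All other terms of Stokes' formula vanish. *)
Lemma balance_mesh :
  \sum_(e <- E) (-1) ^+ (s e : nat) *
    grid_degree b h (fun x => f (x, layer b h e.2)) e.1 tau = 0.
Proof.
pose V (g : W) : int := (`[< U (cellpos g) >] : nat)%:Z.
have Vneq g v : V (g - v) != V g -> ~ (U (cellpos (g - v)) <-> U (cellpos g)).
  by move=> /eqP VV UU; apply: VV; rewrite /V; congr (_%:Z); congr nat_of_bool; apply: asbool_equiv_eq.
have tau0 : 0 < tau by apply: lt_trans ht.
(* The sides: next to a boundary zero the set is a half space, which does not
   change in a horizontal direction. *)
have hs0 : \sum_(g : W) (V (g - tdir) - V g) * cup positivity g hdirs = 0.
  apply: (@cup_stokes (W : finZmodType) V positivity tdir hdirs) => g v r vr Vg; apply/eqP; apply: contraT => cn0.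
  have := uniq_dirs; rewrite /= -(perm_uniq vr) -(perm_mem vr) => /andP[tvr /andP[vr' ur]].
  have vD : v \in hdirs by rewrite -(perm_mem vr) mem_head.
  have [||||e eE ge] := @cup_crossing g v (tdir :: hdirs) (tdir :: r) _ _ _ _ (Vneq _ _ Vg) cn0.
  - by rewrite inE vD orbT.
  - by [].
  - move=> w; rewrite !inE => /orP[->//|wr].
    by rewrite -(perm_mem vr) inE wr !orbT.
  - by apply/andP; split; [apply: contra tvr; rewrite inE orbC => ->|exact: ur].
  have [|gb gv] := @crossing U g v Ub _ (Vneq _ _ Vg); first by rewrite inE vD orbT.
  case: (Vneq _ _ Vg); rewrite (EU eE); last first.
    rewrite -(subrK (cellpos g) (cellpos (g - v))) -addrA (le_lt_trans (ler_normD _ _))//.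
    by move: gv ge ht; lra.
  rewrite (EU eE); last by move: ge tau0; lra.
  case/mapP: vD => i _ ->; by rewrite /cellpos /= subr0.
have Ecell e x (t : 'I_K.+2) : e \in E -> `|gridpos x - e.1| < tau ->
    t == layer_index b h e.2 :> nat -> `|cellpos (x, t) - e| < tau.
  move=> eE xe; have eb : `|e.2| < b.
    by have := Eb eE; have := pair_norm2 e; move: tau0; lra.
  rewrite eq_layer // => /andP[t1 t2].
  by rewrite pair_normE gt_max /= xe /= ltr_norml; apply/andP; split; move: ht; lra.
(* The lids, cell by cell: each cell is close to at most one point of E. *)
have pw g : (V (g - tdir) - V g) * cup positivity g hdirs =
  \sum_(e <- E) (if (`|gridpos g.1 - e.1| < tau) && (g.2 == layer_index b h e.2 :> nat)
                 then (-1) ^+ (s e : nat) * cup positivity g hdirs else 0).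
  have [->|cn0] := eqVneq (cup positivity g hdirs) 0.
    by rewrite mulr0 big1 // => e _; case: ifP; rewrite ?mulr0.
  have [[e eE ge]|ne] := pselect (exists2 e, e \in E & `|cellpos g - e| < tau).
    rewrite (bigD1_seq e) //= big_seq_cond big1 ?addr0; last first.
      move=> e' /andP[e'E ne']; case: ifP => // /andP[ge'1 ge'2]; case/eqP: ne'.
      apply: Esep => //; have := Ecell _ _ _ e'E ge'1 ge'2; case: {ge'1 ge'2} g ge {cn0} => x t ge ge'.
      rewrite -(subrK (cellpos (x, t)) e') -addrA (le_lt_trans (ler_normD _ _))// distrC.
      by move: ge ge'; lra.
    have [e2b et] : `|e.2| < b /\ `|e.2| + tau < b.
      by have := Eb eE; have := pair_norm2 e; move: tau0; lra.
    move: (ge); rewrite pair_normE gt_max => /andP[/= -> gt2] /=.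
    rewrite ltr_norml in gt2; case/andP: gt2 => gt1 gt2.
    have g20 : g.2 != 0.
      apply/eqP => g20; move: gt1; rewrite g20 nodepos0.
      by have := ler_norm (- e.2); rewrite normrN; move: et; lra.
    have gte : nodepos (g - tdir).2 = nodepos g.2 - h by rewrite /= nodeposB.
    have Ug : U (cellpos g) <-> if s e then e.2 <= nodepos g.2 else nodepos g.2 < e.2.
      by apply: EU => //; move: ge tau0; lra.
    have Ugt : U (cellpos (g - tdir)) <->
        if s e then e.2 <= nodepos g.2 - h else nodepos g.2 - h < e.2.
      rewrite -gte; apply: EU => //.
      move: ge; rewrite !pair_normE !gt_max /= subr0 => /andP[g1 _].
      rewrite (lt_trans g1) /=; last by move: tau0; lra.
      by rewrite nodeposB // ltr_norml; apply/andP; split; move: ht h0; lra.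
    have AB : e.2 <= nodepos g.2 - h -> e.2 <= nodepos g.2 by move: h0; lra.
    rewrite eq_layer // /V (asbool_equiv_eq Ug) (asbool_equiv_eq Ugt) !ltNge.
    case: (s e); rewrite !asboolb; move: AB;
      case: (e.2 <= nodepos g.2 - h); case: (e.2 <= nodepos g.2) => //= AB;
      by rewrite ?subrr ?mul0r ?sub0r ?subr0 ?expr0 ?expr1 //; have := AB isT.
  rewrite big_seq big1; last first.
    move=> e eE; case: ifP => // /andP[g1 g2]; case: ne; exists e => //.
    by case: g g1 g2 {cn0} => x t; apply: Ecell.
  have [->|Vg] := eqVneq (V (g - tdir)) (V g); first by rewrite subrr mul0r.
  case: ne; apply: (@cup_crossing g tdir (tdir :: hdirs) hdirs) => //.
  - by rewrite mem_head.
  - by move=> w wD; rewrite inE wD orbT.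
  - by have /andP[] := uniq_dirs.
  - exact: Vneq.
move: hs0; rewrite (eq_bigr _ (fun g _ => pw g)) exchange_big /= => hs1; rewrite -[RHS]hs1.
rewrite [LHS]big_seq [RHS]big_seq; apply: eq_bigr => e eE.
have eb : `|e.2| < b.
  by have := Eb eE; have := pair_norm2 e; move: tau0; lra.
have [_ eK] := layer_indexP h0 h1 b0 eb.
rewrite /grid_degree mulr_sumr.
rewrite (eq_bigr (fun g : W => if (`|gridpos g.1 - e.1| < tau) && (g.2 == Ordinal eK)
   then (-1) ^+ (s e : nat) * cup positivity (g.1, g.2) hdirs else 0)); last by case.
rewrite -(pair_bigA _ (fun x t => if (`|gridpos x - e.1| < tau) && (t == Ordinal eK)
   then (-1) ^+ (s e : nat) * cup positivity (x, t) hdirs else 0)) /=.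
rewrite big_mkcond; apply: eq_bigr => x _.
case: ifP => _ /=; last by rewrite big1.
by rewrite -big_mkcond big_pred1_eq cup_slice.
Qed.

End OneMesh.

(** Stokes' formula in the limit of small meshes. Near each zero on its boundary
    the set [U] is a half space, so that the lids contribute and the sides do
    not; [s] distinguishes the lower lids from the upper ones. *)
Lemma balance (fh : R -> Z -> X) (f : Z -> X) (U : set Z) (E : seq Z) (s : Z -> bool) (b : R) :
  0 < b -> cont_conv fh f -> (forall z, U z -> `|z| < b) -> uniq E ->
  (forall e, e \in E -> `|e| < b) ->
  (forall e, e \in E -> \forall z \near e, U z <-> if s e then e.2 <= z.2 else z.2 < e.2) ->
  (forall z, f z = 0 -> z \in E \/ \forall z' \near z, U z' <-> U z) ->
  \forall tau \near (0 : R)^'+, \forall h \near (0 : R)^'+,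
  \sum_(e <- E) (-1) ^+ (s e : nat) *
    grid_degree b h (fun x => fh h (x, layer b h e.2)) e.1 tau = 0.
Proof.
move=> b0 fhf Ub uE Eb EU zeros.
have EU' : \forall tau \near (0 : R)^'+, forall e, e \in E -> forall z, `|z - e| < 2 * tau ->
     (U z <-> if s e then e.2 <= z.2 else z.2 < e.2).
  apply: near_all => e /EU /nbhs_normP[r /= r0 re].
  have r20 : 0 < r / 2 by rewrite divr_gt0.
  apply: filterS (nbhs_right_lt r20) => t tr z ze; apply: re => /=.
  by rewrite distrC (lt_le_trans ze)// mulrC -ler_pdivlMr // ltW.
have Eb' : \forall tau \near (0 : R)^'+, forall e, e \in E -> `|e| + tau < b.
  apply: near_all => e /Eb eb; have r0 : 0 < b - `|e| by rewrite subr_gt0.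
  by apply: filterS (nbhs_right_lt r0) => t; rewrite ltrBrDl.
have Esep : \forall tau \near (0 : R)^'+, forall e, e \in E -> forall e', e' \in E ->
    `|e - e'| < 2 * tau -> e = e'.
  apply: near_all => e eE; apply: near_all => e' e'E.
  have [->|ne] := eqVneq e e'; first exact: filterE.
  have r0 : 0 < `|e - e'| / 2 by rewrite divr_gt0 // normr_gt0 subr_eq0.
  apply: filterS (nbhs_right_lt r0) => t; rewrite ltr_pdivlMr // mulrC => t1 t2.
  by have := lt_trans t1 t2; rewrite ltxx.
near=> tau.
have tau0 : 0 < tau by near: tau; exact: nbhs_right_gt.
have Es : forall e, e \in E -> forall e', e' \in E ->
    `|e - e'| < 2 * tau -> e = e' by near: tau.
near=> h; apply: (@balance_mesh b h _ _ _ (fh h) U) => //.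
- by near: h; exact: nbhs_right_le.
- by near: tau.
- by near: tau.
- by move=> e e' eE e'E; apply: Es.
- by near: h; exact: (cell_trichotomy fhf zeros).
Unshelve. all: by end_near. Qed.

End Balance.

(** * Limits of row vectors; extending a homotopy beyond its parameter interval *)

Section Limits.
Variable R : realType.

Lemma cvg_rV (T : Type) (F : set_system T) (FF : Filter F) n (g : T -> 'rV[R]_n) (l : 'rV[R]_n) :
  (forall j, g x 0 j @[x --> F] --> l 0 j) -> g @ F --> l.
Proof.
move=> gl; apply/cvgrPdist_lt => e e0.
have : \forall x \near F, forall j, j \in enum 'I_n -> `|l 0 j - g x 0 j| < e.
  by apply: near_all => j _; have /cvgrPdist_lt := gl j; apply.
apply: filterS => x gx; rewrite rV_normlt // => j.
by rewrite !mxE; apply: gx; rewrite mem_enum.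
Qed.

Lemma cvg_coord (T : Type) (F : set_system T) (FF : Filter F) m n (g : T -> 'M[R]_(m, n)) (l : 'M[R]_(m, n)) i j :
  g @ F --> l -> g x i j @[x --> F] --> l i j.
Proof. by move=> gl; apply: (@cvg_comp _ _ _ g (fun M : 'M[R]_(m, n) => M i j) _ _ _ gl); exact: coord_continuous. Qed.

Lemma cvg_mulmx (T : Type) (F : set_system T) (FF : Filter F) n m (g : T -> 'rV[R]_n) (l : 'rV[R]_n) (A : 'M[R]_(n, m)) :
  g @ F --> l -> (fun x => g x *m A) @ F --> (l *m A).
Proof.
move=> gl; apply: cvg_rV => j; rewrite mxE.
under eq_cvg do rewrite mxE.
apply: cvg_big => [|i _]; first exact: add_continuous.
apply: cvgM; last exact: cvg_cst.
exact: cvg_coord.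
Qed.

Lemma mulmx_fst_continuous (T : topologicalType) n m (A : 'M[R]_(n, m)) :
  continuous (fun z : 'rV[R]_n * T => (z.1 *m A, z.2)).
Proof.
move=> z; have c1 : (fun z : 'rV[R]_n * T => z.1 *m A) @ z --> (z.1 *m A).
  by apply: cvg_mulmx; exact: cvg_fst.
have c2 : (fun z : 'rV[R]_n * T => z.2) @ z --> z.2 by exact: cvg_snd.
exact: (cvg_pair c1 c2).
Qed.

End Limits.

Section Homotopy.
Variables (R : realType) (N : nat).
Notation X := 'rV[R]_N.
Notation Z := ('rV[R]_N * R)%type.

Lemma cont_convP (fh : R -> Z -> X) (f : Z -> X) :
  (forall z : Z, fh p.2 p.1 @[p --> filter_prod (nbhs z) (0 : R)^'+] --> f z) ->
  cont_conv fh f.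
Proof.
move=> H z e e0; have /cvgrPdist_lt := H z => /(_ _ e0).
by apply: filterS => -[z' h] /=; rewrite distrC.
Qed.

Definition clamp (t : R) : R := if t < 0 then 0 else if 1 <= t then 1 else t.
(** The layer of level 0 lies in [0, h), and this variant of [clamp] maps it to 0,
    so that the homotopy at that layer is exactly its initial map. It stays
    within [h] of [clamp], and thus has the same limit. *)
Definition clamp_late (h t : R) : R := if t < h then 0 else if 1 <= t then 1 else t.

Lemma clamp01 t : 0 <= clamp t <= 1.
Proof. by rewrite /clamp; case: (ltP t 0) => ?; case: (leP 1 t) => ?; apply/andP; split; lra. Qed.

Lemma clamp_late_close h t : 0 < h -> h <= 1 -> `|clamp_late h t - clamp t| <= h.
Proof.
move=> h0 h1; rewrite ler_norml /clamp /clamp_late.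
by case: (ltP t h) => ?; case: (ltP t 0) => ?; case: (leP 1 t) => ?; apply/andP; split; lra.
Qed.

Lemma clamp_lip t t' : `|clamp t - clamp t'| <= `|t - t'|.
Proof.
have [a b] : t - t' <= `|t - t'| /\ t' - t <= `|t - t'|.
  by rewrite ler_norm distrC ler_norm.
rewrite ler_norml /clamp.
by case: (ltP t' 0) => ?; case: (ltP t 0) => ?; case: (leP 1 t) => ?; case: (leP 1 t') => ?; apply/andP; split; lra.
Qed.

Lemma cont_conv_clamp (fh : R -> Z -> X) f : cont_conv fh f ->
  cont_conv (fun h z => fh h (z.1, clamp_late h z.2)) (fun z => f (z.1, clamp z.2)).
Proof.
move=> fhf z e e0; have [[A B] /= [/nbhs_normP [d /= d0 Ad] Bh] AB] := fhf (z.1, clamp z.2) e e0.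
have d20 : 0 < d / 2 by rewrite divr_gt0.
apply: filterS2 (near_left (near_dist z d20)) (near_right z (_ : \forall h \near (0:R)^'+, [/\ B h, 0 < h, h <= 1 & h < d / 2])).
  move=> [z' h] /= zz' [Bh' h0 h1 hd]; apply: (AB ((z'.1, clamp_late h z'.2), h)); split=> //.
  apply: Ad => /=; rewrite pair_normE gt_max /=.
  have := le_lt_trans (pair_norm1 _) zz'; have := le_lt_trans (pair_norm2 _) zz'.
  move=> /= z2 z1; rewrite (lt_trans z1) /=; last by lra.
  have := clamp_late_close z'.2 h0 h1; have := clamp_lip z.2 z'.2.
  have : `|clamp z.2 - clamp_late h z'.2| <= `|clamp z.2 - clamp z'.2| + `|clamp_late h z'.2 - clamp z'.2|.
    rewrite (distrC (clamp_late h z'.2) (clamp z'.2)).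
    by have := ler_normD (clamp z.2 - clamp z'.2) (clamp z'.2 - clamp_late h z'.2); rewrite addrA subrK.
  lra.
near=> h; split; near: h => //; [exact: nbhs_right_gt|exact: nbhs_right_le|exact: nbhs_right_lt].
Unshelve. all: by end_near. Qed.

End Homotopy.

(** * Homotopy invariance of the grid degree *)

Section Homotopy.
Variables (R : realType) (N : nat).
Notation X := 'rV[R]_N.
Notation Z := ('rV[R]_N * R)%type.

(** [balance] for the cylinder |x - y| <= r, 0 <= t < 1: the zeros of the homotopy
    in the cylinder are at x = y, so the lids are the only part of the boundary
    that meets them. The homotopy is extended by [clamp] to all times. *)
Lemma grid_degree_homotopy (fh : R -> Z -> X) f (y : X) (r b : R) :
  cont_conv fh f -> 0 < r -> `|y| + r < b -> 1 < b ->
  (forall x t, 0 <= t <= 1 -> 0 < `|x - y| <= r -> f (x, t) != 0) ->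
  \forall tau \near (0 : R)^'+, \forall h \near (0 : R)^'+,
    grid_degree b h (fun x => fh h (x, 0)) y tau = grid_degree b h (fun x => fh h (x, 1)) y tau.
Proof.
move=> fhf r0 yb b1 f0.
pose U := [set z : Z | `|z.1 - y| <= r /\ 0 <= z.2 < 1].
pose E : seq Z := [:: (y, 0); (y, 1)].
pose s (z : Z) := z.2 == 0.
have yb' : `|y| < b by lra.
have bal := @balance R N _ _ U E s b _ (cont_conv_clamp fhf).
have near1 (z : Z) (e : R) : 0 < e -> \forall z' \near z, `|z'.1 - z.1| < e /\ `|z'.2 - z.2| < e.
  move=> e0; apply: filterS (near_dist z e0) => z' zz'.
  by split; rewrite distrC; [exact: le_lt_trans (pair_norm1 (z - z')) zz'|exact: le_lt_trans (pair_norm2 (z - z')) zz'].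
have {bal} : \forall tau \near (0 : R)^'+, \forall h \near (0 : R)^'+,
  \sum_(e <- E) (-1) ^+ (s e : nat) *
    grid_degree b h (fun x => fh h (x, clamp_late h (layer b h e.2))) e.1 tau = 0.
  apply: bal.
  - by lra.
  - move=> z [zr zt]; rewrite pair_normE gt_max; apply/andP; split.
      rewrite -(subrK y z.1) (le_lt_trans (ler_normD _ _))//; lra.
    by rewrite ltr_norml; apply/andP; split; lra.
  - by rewrite /E /= inE andbT; apply/eqP => -[] /eqP; rewrite eq_sym oner_eq0.
  - move=> e; rewrite !inE => /orP[]/eqP ->; rewrite pair_normE gt_max /= yb' ?normr0 ?normr1; lra.
  - move=> e; rewrite !inE => /orP[]/eqP -> /=; rewrite /s /= ?eqxx ?oner_eq0.
      apply: filterS2 (near1 (y, 0) _ r0) (near1 (y, 0) _ ltr01) => z /= [zr _] [_ zt].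
      rewrite /U /=; rewrite subr0 ltr_norml in zt; case/andP: zt => zt1 zt2.
      by split=> [[_ /andP[]]//|->]; split=> //; exact: ltW.
    apply: filterS2 (near1 (y, 1) _ r0) (near1 (y, 1) _ ltr01) => z /= [zr _] [_ zt].
    rewrite /U /=; rewrite ltr_norml in zt; case/andP: zt => zt1 zt2.
    split=> [[_ /andP[]]//|->]; split; first exact: ltW.
    by rewrite andbT; lra.
  (* A zero with |x - y| > r is outside of the cylinder; the others have x = y,
     and lie on a lid or have a time different from 0 and 1. *)
  - move=> z fz; have [zr|zr] := leP `|z.1 - y| r; last first.
      right; have d0 : 0 < `|z.1 - y| - r by rewrite subr_gt0.
      apply: filterS (near1 z _ d0) => z' [z'z _]; rewrite /U /=; split=> -[] ab _; exfalso; last by lra.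
      have := ler_normD (z.1 - z'.1) (z'.1 - y); rewrite addrA subrK (distrC z.1 z'.1).
      lra.
    have zy : z.1 = y.
      apply/eqP; rewrite -subr_eq0 -normr_le0 leNgt; apply/negP => zy0.
      by have := f0 _ _ (clamp01 z.2) (_ : 0 < `|z.1 - y| <= r); rewrite zy0 zr fz eqxx => /(_ isT).
    case: z zy fz zr => x t /= -> _ _.
    have [t0|t0|<-] := ltgtP 0 t; [|right|by left; rewrite inE eqxx].
      have [t1|t1|->] := ltgtP t 1; [right|right|by left; rewrite !inE eqxx orbT].
        have d0 : 0 < Num.min t (1 - t) by rewrite lt_min; apply/andP; split; lra.
        apply: filterS2 (near1 (y, t) _ r0) (near1 (y, t) _ d0) => z [zr _] [_] /=.
        rewrite lt_min !ltr_norml /U /= subrr normr0 => /andP[/andP[h1 _] /andP[_ h2]].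
        by split=> _; split; [exact: ltW|apply/andP; split; lra|exact: ltW|apply/andP; split; lra].
      have d0 : 0 < t - 1 by lra.
      apply: filterS (near1 (y, t) _ d0) => z [_ /=]; rewrite ltr_norml /U /= => /andP[h1 h2].
      by split=> -[_ /andP[a1 a2]]; exfalso; lra.
    have d0 : 0 < - t by lra.
    apply: filterS (near1 (y, t) _ d0) => z [_ /=]; rewrite ltr_norml /U /= => /andP[h1 h2].
    by split=> -[_ /andP[a1 a2]]; exfalso; lra.
apply: filterS => tau; apply: filterS3 (nbhs_right_gt 0) (nbhs_right_lt ltr01) => h h0 h1.
rewrite !big_cons big_nil /s /= eqxx oner_eq0 expr0 expr1 mul1r mulN1r addr0.
have b0 : 0 < b by lra.
have b0' : `|0 : R| < b by rewrite normr0.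
have b1' : `|1 : R| < b by rewrite normr1.
have [/andP[la lb] _] := layer_indexP h0 (ltW h1) b0 b0'.
have [/andP[lc ld] _] := layer_indexP h0 (ltW h1) b0 b1'.
rewrite /clamp_late; rewrite add0r in lb; rewrite lb lc.
rewrite ifF; last by apply/negbTE; rewrite -leNgt; lra.
by move/eqP; rewrite addrC subr_eq0 => /eqP.
Qed.

End Homotopy.

(** * The degree of a monomial matrix *)

(** An invertible matrix is Q L U with Q a permutation matrix, L unipotent
    lower triangular and U upper triangular. Scaling the strictly triangular
    parts of L and U by t joins Q diag(U) at t = 0 to the matrix itself at t = 1,
    and the determinant does not change. *)
Lemma lup_path (R : realType) n (A : 'M[R]_n.+1) : A \in unitmx ->
  exists s : 'S_n.+1, exists d : 'rV[R]_n.+1, exists C1 C2 : 'M[R]_n.+1,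
    (forall t, \det (perm_mx s *m diag_mx d + t *: C1 + t ^+ 2 *: C2) = \det A) /\
    perm_mx s *m diag_mx d + C1 + C2 = A.
Proof.
move=> uA; have := cormen_lup_correct A; have := cormen_lup_perm A.
have := @cormen_lup_lower _ _ A; have := @cormen_lup_upper _ _ A.
case: (cormen_lup A) => [[P L] U] /= upU loL /is_perm_mxP[s ->{P}] PA.
pose d := \row_i U i i.
pose Q : 'M[R]_n.+1 := perm_mx s^-1%g.
have QP : Q * perm_mx s = 1 by rewrite /Q -mulmxE -perm_mxM mulVg perm_mx1.
have AE : A = Q * (L * U) by rewrite -PA mulrA QP mul1r.
exists s^-1%g, d, (Q * ((L - 1) * diag_mx d + (U - diag_mx d))), (Q * ((L - 1) * (U - diag_mx d))).
rewrite -/Q !mulmxE.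
have BE t : Q * diag_mx d + t *: (Q * ((L - 1) * diag_mx d + (U - diag_mx d))) +
   t ^+ 2 *: (Q * ((L - 1) * (U - diag_mx d))) =
   Q * ((1 + t *: (L - 1)) * (diag_mx d + t *: (U - diag_mx d))).
  move: (diag_mx d) (U - diag_mx d) (L - 1) => D V M.
  rewrite mulrDl mul1r !mulrDr -!scalerAl -!scalerAr !scalerDr scalerA -expr2 !addrA.
  by congr (_ + _); rewrite -!addrA; congr (_ + _); rewrite addrC.
split; last first.
  have := BE 1; rewrite expr1n !scale1r => ->.
  by rewrite AE [1 + _]addrC subrK [diag_mx d + _]addrC subrK.
have oneE t i j : (1 + t *: (L - 1)) i j = (i == j)%:R + t * (L i j - (i == j)%:R).
  by rewrite -[1]/(1%:M) !mxE.
move=> t; rewrite BE AE !detM; congr (_ * (_ * _)).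
  rewrite [LHS]det_trig; last first.
    by apply/is_trig_mxP => i j ij; rewrite oneE (loL _ _ (ltnW ij)) subrr mulr0 addr0 -val_eqE /= (ltn_eqF ij).
  rewrite [RHS]det_trig; last first.
    by apply/is_trig_mxP => i j ij; rewrite (loL _ _ (ltnW ij)) -val_eqE /= (ltn_eqF ij).
  by apply: eq_bigr => i _; rewrite oneE loL // subrr mulr0 addr0 eqxx.
rewrite -[LHS]det_tr -[RHS]det_tr [LHS]det_trig; last first.
  by apply/is_trig_mxP => i j ij; rewrite !mxE (upU _ _ ij) -val_eqE /= (gtn_eqF ij) mulr0n subrr mulr0 addr0.
rewrite [RHS]det_trig; last by apply/is_trig_mxP => i j ij; rewrite mxE (upU _ _ ij).
by apply: eq_bigr => i _; rewrite !mxE eqxx mulr1n subrr mulr0 addr0.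
Qed.

Section Monomial.
Variables (R : realType) (b h : R) (N : nat).
Hypotheses (h0 : 0 < h) (h1 : h <= 1) (b0 : 0 < b).
Variables (y : 'rV[R]_N) (tau : R) (s : 'S_N) (d : 'rV[R]_N).
Hypotheses (yb : `|y| + tau < b) (htau : h < tau) (d0 : forall j, d 0 j != 0).
Notation K := (mesh_size b h).

Let tau0 : 0 < tau. Proof. exact: lt_trans htau. Qed.

Let yjb j : `|y 0 j| + tau < b.
Proof.
have := (rV_normP y (normr_ge0 y)).1 (lexx _) j; move: yb; lra.
Qed.

(** The sign of c (t - m) changes at one node: if c > 0 it is the last node
    that is at most m, if c < 0 it is the last node below m, since positivity is
    strict. *)
Lemma sign_jump (c m : R) : c != 0 -> `|m| + tau < b ->
  exists t0 : 'I_K.+2, `|nodepos t0 - m| < tau /\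
  forall t : 'I_K.+2, `|nodepos t - m| < tau ->
    ((0 < c * (nodepos (t + 1) - m))%R : nat)%:Z - ((0 < c * (nodepos t - m))%R : nat)%:Z =
    if t == t0 then sgz c else 0.
Proof.
move=> c0 mb.
have mb' : `|m| < b by move: tau0 mb; lra.
have [/andP[l1 l2] lK] := layer_indexP h0 h1 b0 mb'.
have lpos : (0 < layer_index b h m)%N.
  rewrite lt0n; apply/eqP => l0; move: l1; rewrite /layer l0 mulr0 => l1.
  by have := ler_norm (- m); rewrite normrN; move: mb' l1; lra.
have posS (t : 'I_K.+2) : `|nodepos t - m| < tau -> nodepos (t + 1) = nodepos t + h.
  move=> /(le_lt_trans (ler_norm _)) tm; apply: nodeposS => //.
  by have := ler_norm m; move: tm mb; lra.
have sgn (x : R) : (0 < c * x) = if 0 < c then 0 < x else x < 0.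
  case: (ltP 0 c) => [c1|c1]; first by rewrite pmulr_rgt0.
  by rewrite nmulr_rgt0 // lt_neqAle c0.
have natS (n1 n2 : nat) : h * n1%:R - h < h * n2%:R -> h * n2%:R - h < h * n1%:R -> n1 = n2.
  have le (p q : nat) : h * p%:R - h < h * q%:R -> (p <= q)%N.
    by move=> pq; rewrite -ltnS -(ltr_nat R) -natr1 -(ltr_pM2l h0) mulrDr mulr1; move: pq; lra.
  by move=> /le a1 /le a2; apply/eqP; rewrite eqn_leq a1 a2.
have [cp|cn] := ltP 0 c.
  (* The last node that is at most m is the layer of m or the node before. *)
  pose k := if layer b h m == m then layer_index b h m else (layer_index b h m).-1.
  have kK : (k < K.+2)%N.
    by rewrite /k; case: ifP => // _; rewrite (leq_ltn_trans (leq_pred _)).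
  have kp : nodepos (Ordinal kK) <= m < nodepos (Ordinal kK) + h.
    rewrite /nodepos /= /k; have [lm|lm] := eqVneq (layer b h m) m.
      by rewrite -/(layer b h m) lm lexx ltrDl.
    have lm' : m < layer b h m by rewrite lt_neqAle eq_sym lm.
    move: l2 lm'; rewrite /layer -(prednK lpos) -natr1 /= => ? ?.
    by apply/andP; split; lra.
  exists (Ordinal kK); case/andP: kp => k1 k2; split.
    by rewrite ltr_norml; apply/andP; split; move: htau tau0; lra.
  move=> t /posS ->; rewrite !sgn cp gtr0_sgz // !subr_gt0.
  have -> : (t == Ordinal kK) = (nodepos t <= m < nodepos t + h).
    apply/eqP/idP => [->|/andP[t1 t2]]; first by rewrite k1.
    apply: val_inj; apply: natS => //; move: k1 k2 t1 t2; rewrite /nodepos /=; lra.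
  by rewrite leNgt; move: h0; case: (ltP m (nodepos t)); case: (ltP m (nodepos t + h)) => //= ? ? ?; exfalso; lra.
have kK : ((layer_index b h m).-1 < K.+2)%N by rewrite (leq_ltn_trans (leq_pred _)).
have kp : nodepos (Ordinal kK) < m <= nodepos (Ordinal kK) + h.
  move: l1 l2; rewrite /nodepos /layer -[in X in X -> _](prednK lpos) -[in X in _ -> X -> _](prednK lpos) -natr1 /= => ? ?.
  by apply/andP; split; lra.
exists (Ordinal kK); case/andP: kp => k1 k2; split.
  by rewrite ltr_norml; apply/andP; split; move: htau tau0; lra.
have cF : (0 < c) = false by apply/negbTE; rewrite -leNgt.
have cN : c < 0 by rewrite lt_neqAle c0.
move=> t /posS ->; rewrite !sgn cF (ltr0_sgz cN) !subr_lt0.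
have -> : (t == Ordinal kK) = (nodepos t < m <= nodepos t + h).
  apply/eqP/idP => [->|/andP[t1 t2]]; first by rewrite k1.
  apply: val_inj; apply: natS => //; move: k1 k2 t1 t2; rewrite /nodepos /=; lra.
by rewrite [m <= _]leNgt; move: h0; case: (ltP (nodepos t) m); case: (ltP (nodepos t + h) m) => //= ? ? ?; exfalso; lra.
Qed.

(** Each component depends on a single coordinate, so the cup product is a
    determinant ([cup_det]) with one nonzero entry per row, and that entry is
    nonzero in one cell only ([sign_jump]). *)
Lemma grid_degree_monomial :
  grid_degree b h (fun x => (x - y) *m (perm_mx s *m diag_mx d)) y tau =
  sgz (\det (perm_mx s *m diag_mx d)).
Proof.
pose s' := s^-1%g.
pose eta j (t : 'I_K.+2) : int := ((0 < d 0 j * (nodepos t - y 0 (s' j)))%R : nat)%:Z.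
have phiE x j : ((x - y) *m (perm_mx s *m diag_mx d)) 0 j = d 0 j * (x 0 (s' j) - y 0 (s' j)).
  rewrite mulmxA mul_mx_diag mxE (_ : (x - y) *m perm_mx s = col_perm s' (x - y)).
    by rewrite !mxE mulrC.
  by rewrite col_permE invgK.
have posE j : @positive_at R N b h (fun x => (x - y) *m (perm_mx s *m diag_mx d)) j =
    fun x => eta j (x 0 (s' j)).
  by apply: boolp.funext => x; rewrite /positive_at phiE mxE.
pose jump j (t : 'I_K.+2) := eta j (t + 1) - eta j t.
have cupE (x : 'rV['I_K.+2]_N) :
    cup [seq @positive_at R N b h (fun x => (x - y) *m (perm_mx s *m diag_mx d)) j | j <- enum 'I_N]
      x [seq delta_mx 0 i | i <- enum 'I_N] = (-1) ^+ s' * \prod_j jump j (x 0 (s' j)).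
  have dE (q : 'rV['I_K.+2]_N) i j : (q + delta_mx 0 i) 0 j = q 0 j + (j == i)%:R.
    by rewrite !mxE eqxx.
  rewrite cup_det; last first.
    move=> j i i' q ii'; rewrite posE !dE.
    have [->|] := eqVneq (s' j) i'; last by rewrite !addr0 !subrr.
    by rewrite eq_sym (negbTE ii') addr0.
  rewrite (_ : (\matrix_(j, i) _) = diag_mx (\row_j jump j (x 0 (s' j))) *m perm_mx s').
    rewrite det_mulmx det_diag det_perm mulrC; congr (_ * _).
    by apply: eq_bigr => j _; rewrite mxE.
  apply/matrixP => j i; rewrite mul_diag_mx !mxE posE dE /jump.
  by case: eqVneq; rewrite ?mulr1 // addr0 subrr mulr0.
rewrite /grid_degree (eq_bigr _ (fun x _ => cupE x)) -mulr_sumr.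
have /choice[T TP] : forall j, exists t0 : 'I_K.+2, `|nodepos t0 - y 0 (s' j)| < tau /\
   forall t : 'I_K.+2, `|nodepos t - y 0 (s' j)| < tau -> jump j t = if t == t0 then sgz (d 0 j) else 0.
  by move=> j; apply: sign_jump.
pose x0 : 'rV['I_K.+2]_N := \row_i T (s i).
have x0j j : x0 0 (s' j) = T j by rewrite mxE permKV.
have winP (x : 'rV['I_K.+2]_N) : (`|gridpos x - y| < tau) <-> forall j, `|nodepos (x 0 (s' j)) - y 0 (s' j)| < tau.
  rewrite rV_normlt //; split=> [H j|H i]; first by have := H (s' j); rewrite !mxE.
  by have := H (s i); rewrite /s' permK !mxE.
rewrite (bigD1 x0) /=; last by apply/winP => j; rewrite x0j; have [] := TP j.
rewrite [X in _ * (_ + X)]big1 ?addr0; last first.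
  move=> x /andP[/winP xw xx0].
  have [i xi] : exists i, x 0 i != x0 0 i.
    apply/existsP; apply: contraR xx0 => /existsPn H; apply/eqP/rowP => i.
    by apply/eqP; have := H i; rewrite negbK.
  rewrite (bigD1 (s i)) //= (TP (s i)).2 // permK.
  by move: xi; rewrite mxE => /negbTE ->; rewrite mul0r.
rewrite det_mulmx det_diag det_perm sgzM; congr (_ * _).
  rewrite sgzX sgzN1 odd_permV; by case: (odd_perm s).
rewrite (big_morph (@sgz R) (@sgzM R) (sgz1 R)).
by apply: eq_bigr => j _; rewrite x0j (TP j).2 ?eqxx //; have [] := TP j.
Qed.

End Monomial.

(** * Linear maps, and zeros with invertible derivative *)

Lemma mulmx_unit_neq0 (R : realType) N (A : 'M[R]_N) (v : 'rV[R]_N) : A \in unitmx -> v != 0 -> v *m A != 0.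
Proof. by move=> uA; apply: contra_neq => vA; rewrite -(mulmxK uA v) vA mul0mx. Qed.

Section LocalDegree.
Variables (R : realType) (N : nat).
Notation X := 'rV[R]_N.
Notation Z := ('rV[R]_N * R)%type.

(** Homotopy invariance along [lup_path] reduces the degree of an invertible
    matrix to the monomial case. *)
Lemma linear_degree (A : 'M[R]_N) (y : X) (b : R) : A \in unitmx -> `|y| < b -> 1 < b ->
  \forall tau \near (0 : R)^'+, \forall h \near (0 : R)^'+,
    grid_degree b h (fun x => (x - y) *m A) y tau = sgz (\det A).
Proof.
(* In dimension 0 the grid has one node and the empty cup product is 1. *)
move=> uA yb b1; case: N A y uA yb => [|n] A y uA yb.
  apply: filterS (nbhs_right_gt 0) => tau tau0; apply: filterE => h.
  rewrite det_mx00 sgz1 /grid_degree (bigD1 0) /=; last first.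
    by apply/rV_normlt => // -[].
  rewrite (size0nil (size_enum_ord 0)) /= big1 ?addr0 // => x /andP[_].
  by case/eqP; apply/rowP => -[].
have [s [d [C1 [C2 [detC CA]]]]] := lup_path uA.
set C0 := _ *m _ in detC CA.
pose f (z : 'rV[R]_n.+1 * R) := (z.1 - y) *m C0 + z.2 *: ((z.1 - y) *m C1) + z.2 ^+ 2 *: ((z.1 - y) *m C2).
have fE x t : f (x, t) = (x - y) *m (C0 + t *: C1 + t ^+ 2 *: C2).
  by rewrite /f /= !mulmxDr -!scalemxAr.
have r0 : 0 < (b - `|y|) / 2 by rewrite divr_gt0 // subr_gt0.
have yr : `|y| + (b - `|y|) / 2 < b by lra.
have fc : cont_conv (fun _ => f) f.
  apply: cont_convP => z.
  have z1 : (fun p : ('rV[R]_n.+1 * R) * R => p.1.1) @ filter_prod (nbhs z) (0 : R)^'+ --> z.1.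
    by apply: (@cvg_comp _ _ _ fst fst) cvg_fst _; exact: cvg_fst.
  have z2 : (fun p : ('rV[R]_n.+1 * R) * R => p.1.2) @ filter_prod (nbhs z) (0 : R)^'+ --> z.2.
    by apply: (@cvg_comp _ _ _ fst snd) cvg_fst _; exact: cvg_snd.
  have zy : (fun p : ('rV[R]_n.+1 * R) * R => p.1.1 - y) @ filter_prod (nbhs z) (0 : R)^'+ --> z.1 - y.
    by apply: cvgB => //; exact: cvg_cst.
  apply: cvgD; [apply: cvgD|].
  - exact: cvg_mulmx.
  - by apply: cvgZ => //; exact: cvg_mulmx.
  - apply: cvgZ; last exact: cvg_mulmx.
    by rewrite expr2; under eq_cvg do rewrite expr2; apply: cvgM.
have f0 x t : 0 <= t <= 1 -> 0 < `|x - y| <= (b - `|y|) / 2 -> f (x, t) != 0.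
  move=> _ /andP[xy _]; rewrite fE mulmx_unit_neq0 ?unitmxE ?detC -?unitmxE // -normr_gt0//.
have yb' : 0 < b - `|y| by rewrite subr_gt0.
apply: filterS3 (nbhs_right_gt 0) (nbhs_right_lt yb') (grid_degree_homotopy fc r0 yr b1 f0) => tau tau0 tb.
have mt0 : 0 < Num.min tau 1 by rewrite lt_min tau0 ltr01.
apply: filterS3 (nbhs_right_gt 0) (nbhs_right_lt mt0) => h h0.
rewrite lt_min => /andP[htau h1].
have -> : (fun x => f (x, 0)) = (fun x => (x - y) *m C0).
  by apply: boolp.funext => x; rewrite fE expr0n /= !scale0r !addr0.
have -> : (fun x => f (x, 1)) = (fun x => (x - y) *m A).
  by apply: boolp.funext => x; rewrite fE expr1n !scale1r CA.
have detC0 : \det C0 = \det A by have := detC 0; rewrite expr0n /= !scale0r !addr0.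
move=> <-; rewrite -detC0; apply: grid_degree_monomial => //; first exact: ltW.
- by lra.
- by lra.
- move=> j; have : \det A != 0 by rewrite -unitfE -unitmxE.
  rewrite -detC0 /C0 det_mulmx mulf_eq0 negb_or det_diag => /andP[_].
  by rewrite (bigD1 j) //= mulf_eq0 negb_or => /andP[].
Qed.

(** The line {y} x R consists of zeros of [f], and [g] is the divided difference
    of [f] in the direction [v]. Continuity of [g] up to s = 0, where it is the
    derivative, makes the behaviour of [f] near the line uniform; it replaces
    differentiability assumptions and estimates of remainders. *)
Record blowup (f : Z -> X) (y : X) (g : X -> R -> R -> X) (A : R -> 'M[R]_N) : Prop := Blowup {
  blowupE : forall v s m, f (y + s *: v, m) = s *: g v s m;
  blowup_cont : continuous (fun p : X * (R * R) => g p.1 p.2.1 p.2.2);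
  blowup0 : forall v m, g v 0 m = v *m A m }.

Section Blowup.
Variables (f : Z -> X) (y : X) (g : X -> R -> R -> X) (A : R -> 'M[R]_N) (m : R).
Hypotheses (fg : blowup f y g A) (uA : A m \in unitmx).

(** At s = 0 the combination is v A(m), which has no zero on the unit sphere, and
    the sphere is compact. *)
Lemma blowup_nonzero : \forall p \near ((0 : R), m),
  forall v t, `|v| = 1 -> 0 <= t <= 1 ->
    (1 - t) *: g v p.1 p.2 + t *: (v *m A m) != 0.
Proof.
have Kc : compact ([set v : X | `|v| = 1] `*` `[(0 : R), 1]).
  by apply: compact_setX; [exact: compact_sphere|exact: segment_compact].
have /compact_near_coveringP := Kc.
move=> /(_ _ (nbhs ((0 : R), m)) (fun p vt => (1 - vt.2) *: g vt.1 p.1 p.2 + vt.2 *: (vt.1 *m A m) != 0)).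
move=> H; have {}H := H (nbhs_filter _).
apply: filterS (H _) => [p Hp v t v1 t01|]; first by apply: (Hp (v, t)); split=> //=; rewrite in_itv.
move=> [v t] [/= v1 _].
have l0 : v *m A m != 0 by apply: mulmx_unit_neq0 => //; rewrite -normr_gt0 v1.
have cv : (fun q : (X * R) * (R * R) => (1 - q.1.2) *: g q.1.1 q.2.1 q.2.2 + q.1.2 *: (q.1.1 *m A m))
    @ filter_prod (nbhs (v, t)) (nbhs ((0 : R), m)) --> v *m A m.
  rewrite -[v *m A m]scale1r -[X in X *: _](subrK t) scalerDl -{1}(blowup0 fg).
  have c1 : (fun q : (X * R) * (R * R) => q.1.1) @ filter_prod (nbhs (v, t)) (nbhs ((0 : R), m)) --> v.
    by apply: (@cvg_comp _ _ _ fst fst) cvg_fst _; exact: cvg_fst.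
  have c2 : (fun q : (X * R) * (R * R) => q.1.2) @ filter_prod (nbhs (v, t)) (nbhs ((0 : R), m)) --> t.
    by apply: (@cvg_comp _ _ _ fst snd) cvg_fst _; exact: cvg_snd.
  have c3 : (fun q : (X * R) * (R * R) => q.2) @ filter_prod (nbhs (v, t)) (nbhs ((0 : R), m)) --> ((0 : R), m).
    exact: cvg_snd.
  apply: cvgD; apply: cvgZ => //; last exact: cvg_mulmx.
    by apply: cvgB => //; exact: cvg_cst.
  apply: (@cvg_comp _ _ _ (fun q : (X * R) * (R * R) => (q.1.1, q.2)) (fun p => g p.1 p.2.1 p.2.2)).
    exact: (cvg_pair c1 c3).
  exact: (@blowup_cont _ _ _ _ fg (v, (0, m))).
have nl0 : 0 < `|v *m A m| by rewrite normr_gt0.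
have /cvgrPdist_lt /(_ _ nl0) := cv.
apply: filterS => q; apply: contraTneq => /= ->; by rewrite subr0 ltxx.
Qed.

(** The case t = 0 of [blowup_nonzero]: zeros close to the line and off it would
    give a zero of [g] in a unit direction. *)
Lemma blowup_isolated : \forall z \near (y, m), f z = 0 -> z.1 = y.
Proof.
have [[B C] /= [/nbhs_normP[r /= r0 Br] Cm] BC] := blowup_nonzero.
exists ([set x | `|y - x| < r], C) => /=; first by split; [exact: (near_dist y)|exact: Cm].
move=> [x mu] /= [xy Cmu] fz; apply/eqP; apply: contraT => xny.
have s0 : 0 < `|x - y| by rewrite normr_gt0 subr_eq0.
pose v := `|x - y|^-1 *: (x - y).
have v1 : `|v| = 1 by rewrite normrZ normfV normr_id mulVf // gt_eqF.
have xE : x = y + `|x - y| *: v by rewrite scalerA divff ?gt_eqF // scale1r addrC subrK.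
have := BC (`|x - y|, mu) _ v 0 v1; rewrite lexx ler01 subr0 scale1r scale0r addr0.
have : (`|x - y|, mu).1 *: g v (`|x - y|, mu).1 (`|x - y|, mu).2 = 0 by rewrite /= -(blowupE fg) -xE.
move=> /eqP; rewrite scaler_eq0 gt_eqF //= => /eqP ->; rewrite eqxx => H.
by have : false by apply: H => //; split=> //; apply: Br => /=; rewrite sub0r normrN normr_id distrC.
Qed.

(** [f] is homotopic to its derivative without zeros near [y]
    ([blowup_nonzero]). The level [mh h] only tends to m, as the level of a layer
    does. *)
Lemma local_degree (b : R) (mh : R -> R) : continuous f -> `|y| < b -> 1 < b ->
  mh h @[h --> (0 : R)^'+] --> m ->
  \forall tau \near (0 : R)^'+, \forall h \near (0 : R)^'+,
    grid_degree b h (fun x => f (x, mh h)) y tau = sgz (\det (A m)).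
Proof.
move=> fc yb b1 mhm.
have [[B C] /= [/nbhs_normP[r /= r0 Br] Cm] BC] := blowup_nonzero.
pose r' := Num.min (r / 2) ((b - `|y|) / 2).
have r'0 : 0 < r' by rewrite lt_min !divr_gt0 // subr_gt0.
have yr' : `|y| + r' < b.
  by have : r' <= (b - `|y|) / 2 by [rewrite ge_min lexx orbT]; move: yb; lra.
have r'r : r' < r.
  by have : r' <= r / 2 by [rewrite ge_min lexx]; move: r0; lra.
pose fh h (z : Z) := (1 - z.2) *: f (z.1, mh h) + z.2 *: ((z.1 - y) *m A m).
pose f' (z : Z) := (1 - z.2) *: f (z.1, m) + z.2 *: ((z.1 - y) *m A m).
have fhf : cont_conv fh f'.
  apply: cont_convP => z.
  have z1 : (fun p : Z * R => p.1.1) @ filter_prod (nbhs z) (0 : R)^'+ --> z.1.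
    by apply: (@cvg_comp _ _ _ fst fst) cvg_fst _; exact: cvg_fst.
  have z2 : (fun p : Z * R => p.1.2) @ filter_prod (nbhs z) (0 : R)^'+ --> z.2.
    by apply: (@cvg_comp _ _ _ fst snd) cvg_fst _; exact: cvg_snd.
  apply: cvgD; apply: cvgZ => //.
  - by apply: cvgB => //; exact: cvg_cst.
  - have fm : f @ (z.1, m) --> f (z.1, m) by apply: fc.
    apply: (@cvg_comp _ _ _ (fun p : Z * R => (p.1.1, mh p.2)) f _ _ _ _ fm).
    have cm : (fun p : Z * R => mh p.2) @ filter_prod (nbhs z) (0 : R)^'+ --> m.
      by apply: (@cvg_comp _ _ _ snd mh) mhm; exact: cvg_snd.
    exact: (cvg_pair z1 cm).
  - by apply: cvg_mulmx; apply: cvgB => //; exact: cvg_cst.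
have f0 x t : 0 <= t <= 1 -> 0 < `|x - y| <= r' -> f' (x, t) != 0.
  move=> t01 /andP[s0 sr].
  pose v := `|x - y|^-1 *: (x - y).
  have v1 : `|v| = 1 by rewrite normrZ normfV normr_id mulVf // gt_eqF.
  have xyE : x - y = `|x - y| *: v by rewrite scalerA divff ?gt_eqF // scale1r.
  have xE : x = y + `|x - y| *: v by rewrite -xyE addrC subrK.
  rewrite /f' /= {1}xE (blowupE fg) {3}xyE -scalemxAl !scalerA (mulrC (1 - t)) (mulrC t) -!scalerA -scalerDr.
  rewrite scaler_eq0 gt_eqF //=; apply: (BC (`|x - y|, m)) => //; split=> /=.
    by apply: Br => /=; rewrite sub0r normrN normr_id (le_lt_trans sr).
  exact: nbhs_singleton Cm.
have := linear_degree uA yb b1.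
apply: filterS2 (grid_degree_homotopy fhf r'0 yr' b1 f0) => tau.
apply: filterS2 => h; rewrite /fh /=.
have -> : (fun x => (1 - 0) *: f (x, mh h) + 0 *: ((x - y) *m A m)) = (fun x => f (x, mh h)).
  by apply: boolp.funext => x; rewrite subr0 scale1r scale0r addr0.
have -> : (fun x => (1 - 1) *: f (x, mh h) + 1 *: ((x - y) *m A m)) = (fun x => (x - y) *m A m).
  by apply: boolp.funext => x; rewrite subrr scale0r scale1r add0r.
by move=> -> ->.
Qed.

End Blowup.
End LocalDegree.

(** * Local degrees along trivial lines add up to zero *)

Lemma cvg_layer (R : realType) (b m : R) : 0 < b -> `|m| < b ->
  layer b h m @[h --> (0 : R)^'+] --> m.
Proof.
move=> b0 mb; apply/cvgrPdist_lt => e e0.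
have me0 : 0 < Num.min e 1 by rewrite lt_min e0 ltr01.
apply: filterS2 (nbhs_right_gt 0) (nbhs_right_lt me0) => h h0.
rewrite lt_min => /andP[he h1]; have [/andP[l1 l2] _] := layer_indexP h0 (ltW h1) b0 mb.
by rewrite ltr_norml; apply/andP; split; lra.
Qed.

Section DegreeBalance.
Variables (R : realType) (N : nat).
Notation X := 'rV[R]_N.
Notation Z := ('rV[R]_N * R)%type.
Variables (f : Z -> X) (A : X -> R -> 'M[R]_N) (Z0 L : set Z) (Y : seq X) (P : seq Z).
Hypotheses (fc : continuous f)
  (zeros : forall z, f z = 0 -> [\/ Z0 z, L z | z.1 \in Y])
  (Zc : compact Z0) (Lc : closed L) (ZL : forall z, Z0 z -> ~ L z)
  (ZP : forall z, Z0 z -> z.1 \in Y -> z \in P)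
  (PY : forall p, p \in P -> p.1 \in Y) (PL : forall p, p \in P -> ~ L p)
  (uP : uniq P)
  (fA : forall p, p \in P -> exists g, blowup f p.1 g (A p.1))
  (uA : forall p, p \in P -> \forall rho \near (0 : R)^'+,
     (A p.1 (p.2 - rho) \in unitmx) /\ (A p.1 (p.2 + rho) \in unitmx)).

Let near_norm1 (z : Z) (e : R) : 0 < e -> \forall z' \near z, `|z.1 - z'.1| < e.
Proof. by move=> /(near_dist z); apply: filterS => z'; apply: le_lt_trans; exact: (pair_norm1 (z - z')). Qed.
Let near_norm2 (z : Z) (e : R) : 0 < e -> \forall z' \near z, `|z.2 - z'.2| < e.
Proof. by move=> /(near_dist z); apply: filterS => z'; apply: le_lt_trans; exact: (pair_norm2 (z - z')). Qed.
Let near_out (z : Z) (y : X) (r : R) : r < `|z.1 - y| -> \forall z' \near z, r < `|z'.1 - y|.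
Proof.
rewrite -subr_gt0 => /(near_norm1 z); apply: filterS => z' zz'.
by have := ler_normD (z.1 - z'.1) (z'.1 - y); rewrite addrA subrK; lra.
Qed.
Let near_gt2 (z : Z) (m : R) : m < z.2 -> \forall z' \near z, m < z'.2.
Proof.
rewrite -subr_gt0 => /(near_norm2 z); apply: filterS => z'.
by rewrite ltr_norml => /andP[]; lra.
Qed.
Let near_lt2 (z : Z) (m : R) : z.2 < m -> \forall z' \near z, z'.2 < m.
Proof.
rewrite -subr_gt0 => /(near_norm2 z); apply: filterS => z'.
by rewrite ltr_norml => /andP[]; lra.
Qed.

Let near_allZ (T : eqType) (z : Z) (E : seq T) (Q : T -> Z -> Prop) :
  (forall e, e \in E -> \forall z' \near z, Q e z') ->
  \forall z' \near z, forall e, e \in E -> Q e z'.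
Proof. exact: (@near_all _ _ _ (nbhs_filter z)). Qed.

Section FixedRho.
Variable rho : R.
Hypotheses (rho0 : 0 < rho)
  (Pseg : forall p, p \in P -> forall mu, `|mu - p.2| <= rho -> ~ L (p.1, mu))
  (Psep : forall p, p \in P -> forall q, q \in P -> p.1 = q.1 -> `|p.2 - q.2| <= 3 * rho -> p = q)
  (uArho : forall p, p \in P -> (A p.1 (p.2 - rho) \in unitmx) /\ (A p.1 (p.2 + rho) \in unitmx)).

(** The tubes must be so thin that those at the points of [P] avoid [L], that
    the set [Z0] enters the tube along a line of [Y] only close to a point of
    [P], and that tubes of different lines are disjoint. *)
Lemma tube_radius : \forall r \near (0 : R)^'+,
  [/\ forall p, p \in P -> forall z, `|z.1 - p.1| <= r -> `|z.2 - p.2| <= rho -> ~ L z,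
      forall z, Z0 z -> forall y, y \in Y -> `|z.1 - y| <= r ->
        exists p, [/\ p \in P, p.1 = y & `|z.2 - p.2| < rho] &
      forall y, y \in Y -> forall y', y' \in Y -> `|y - y'| <= 2 * r -> y = y'].
Proof.
have H1 : \forall r \near (0 : R)^'+, forall p, p \in P -> forall z, `|z.1 - p.1| <= r -> `|z.2 - p.2| <= rho -> ~ L z.
  apply: near_all => p pP.
  have cov : \forall r \near (0 : R)^'+, `[p.2 - rho, p.2 + rho] `<=` (fun mu => forall x, `|x - p.1| <= r -> ~ L (x, mu)).
    have /compact_near_coveringP := @segment_compact R (p.2 - rho) (p.2 + rho); apply => mu /=.
    rewrite in_itv /= -ler_distl => mup.
    have /nbhs_normP[e /= e0 eL] : \forall z \near (p.1, mu), ~ L z.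
      by apply: open_nbhs_nbhs; split; [exact: closed_openC|exact: Pseg].
    exists ([set mu' | `|mu - mu'| < e], [set r | r < e]) => /=.
      by split; [exact: (near_dist mu)|exact: nbhs_right_lt].
    move=> [mu' r] /= [mumu' re] x xp; apply: eL => /=.
    by rewrite pair_normE gt_max /= mumu' andbT distrC (le_lt_trans xp).
  apply: filterS cov => r Hr [x mu] /= xp mup.
  by apply: Hr => //=; rewrite in_itv /= -ler_distl.
have H2 : \forall r \near (0 : R)^'+, Z0 `<=` (fun z => forall y, y \in Y -> `|z.1 - y| <= r ->
        exists p, [/\ p \in P, p.1 = y & `|z.2 - p.2| < rho]).
  have /compact_near_coveringP := Zc; apply => z Zz.
  apply: (@near_all _ _ (filter_prod (nbhs z) (0 : R)^'+) _ Y
    (fun y q => `|q.1.1 - y| <= q.2 -> exists p, [/\ p \in P, p.1 = y & `|q.1.2 - p.2| < rho])) => y yY.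
  have [zy|zy] := eqVneq z.1 y.
    have zP : z \in P by apply: ZP => //; rewrite zy.
    apply: filterS (near_left (near_norm2 z rho0)) => -[z' r] /= zz' _.
    by exists z; split=> //; rewrite distrC.
  have d0 : 0 < `|z.1 - y| / 2 by rewrite divr_gt0 // normr_gt0 subr_eq0.
  apply: filterS2 (near_left (near_norm1 z d0)) (near_right z (nbhs_right_lt d0)) => -[z' r] /= zz' rd z'y.
  exfalso; have := ler_normD (z.1 - z'.1) (z'.1 - y); rewrite addrA subrK; lra.
have H3 : \forall r \near (0 : R)^'+, forall y, y \in Y -> forall y', y' \in Y -> `|y - y'| <= 2 * r -> y = y'.
  apply: near_all => y yY; apply: near_all => y' y'Y.
  have [->|ne] := eqVneq y y'; first exact: filterE.
  have d0 : 0 < `|y - y'| / 2 by rewrite divr_gt0 // normr_gt0 subr_eq0.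
  by apply: filterS (nbhs_right_lt d0) => r rd yy'; exfalso; lra.
by apply: filterS3 H1 H2 H3 => r h1 h2 h3; split.
Qed.

(** [balance] for the set [U] made of the points close to [Z0] and outside of all
    tubes of radius [r] along the lines over [Y], and of the parts of these tubes
    of height [2 * rho] centred at the points of [P]. Its boundary meets the
    zeros of [f] only where the line leaves one of the short tubes, at
    (p.1, p.2 - rho) and (p.1, p.2 + rho), and [local_degree] gives the degrees
    there. *)
Lemma degree_balance_rho :
  \sum_(p <- P) (sgz (\det (A p.1 (p.2 - rho))) - sgz (\det (A p.1 (p.2 + rho)))) = 0.
Proof.
have rp : 0 < rho := rho0.
have /filter_ex[r [r0 [PrL Zr Yr]]] : \forall r \near (0 : R)^'+, 0 < r /\
  [/\ forall p, p \in P -> forall z, `|z.1 - p.1| <= r -> `|z.2 - p.2| <= rho -> ~ L z,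
      forall z, Z0 z -> forall y, y \in Y -> `|z.1 - y| <= r ->
        exists p, [/\ p \in P, p.1 = y & `|z.2 - p.2| < rho] &
      forall y, y \in Y -> forall y', y' \in Y -> `|y - y'| <= 2 * r -> y = y'].
  by apply: filterS2 (nbhs_right_gt 0) tube_radius.
have [e e0 eL] := compact_gap Zc Lc ZL.
have [M [_ MZ]] := compact_bounded Zc.
have /filter_ex[b [b1 bM Pb]] : \forall b \near +oo, [/\ 1 < b, M + 1 + e < b & forall p, p \in P -> `|p| + r + rho < b].
  have Hb : \forall b \near +oo, forall p, p \in P -> `|p| + r + rho < b.
    by apply: near_all => p _; apply: nbhs_pinfty_gt; rewrite num_real.
  apply: filterS3 Hb (nbhs_pinfty_gt (num_real 1)) (nbhs_pinfty_gt (num_real (M + 1 + e))) => b h1 h2 h3.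
  by split.
have {}MZ z : Z0 z -> `|z| <= M + 1 by apply: MZ; rewrite ltrDl.
(* O is a neighbourhood of Z0 that avoids L, V the union of the short tubes. *)
pose O (z : Z) := exists2 z0, Z0 z0 & `|z0 - z| < e.
pose V (z : Z) := exists2 p, p \in P & `|z.1 - p.1| <= r /\ p.2 - rho <= z.2 < p.2 + rho.
pose U : set Z := [set z | ((forall y, y \in Y -> r < `|z.1 - y|) /\ O z) \/ V z].
pose bot := [seq ((p.1, p.2 - rho) : Z) | p <- P].
pose top := [seq ((p.1, p.2 + rho) : Z) | p <- P].
pose s (z : Z) := z \in bot.
have b0 : 0 < b by lra.
have Ub z : U z -> `|z| < b.
  case=> [[_ [z0 /MZ z0M z0z]]|[p pP [zp pz]]].
    by have := ler_normB z0 (z0 - z); rewrite opprB addrC subrK; lra.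
  have := Pb _ pP; have := pair_norm1 p; have := pair_norm2 p => n2 n1 pb.
  rewrite pair_normE gt_max; apply/andP; split.
    by have := ler_normD (z.1 - p.1) p.1; rewrite subrK; lra.
  have := ler_norm p.2; have := ler_norm (- p.2); rewrite normrN => a1 a2.
  by rewrite ltr_norml; apply/andP; split; lra.
have inj_bot : injective (fun p : Z => (p.1, p.2 - rho) : Z).
  by move=> [x t] [x' t'] /= [-> /addIr ->].
have inj_top : injective (fun p : Z => (p.1, p.2 + rho) : Z).
  by move=> [x t] [x' t'] /= [-> /addIr ->].
have bot_top z : z \in bot -> z \in top -> False.
  case/mapP=> p pP -> /mapP[q qP [pq1 pq2]].
  have pq : p = q.
    apply: Psep => //; rewrite (_ : p.2 - q.2 = rho + rho); first by rewrite ger0_norm; lra.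
    by lra.
  by move: pq2; rewrite pq; lra.
have uE : uniq (bot ++ top).
  rewrite cat_uniq !map_inj_uniq // uP andbT /=; apply/hasPn => z zt; apply/negP => zb.
  exact: bot_top zb zt.
have Eb z : z \in bot ++ top -> `|z| < b.
  rewrite mem_cat => /orP[] /mapP[p pP ->];
  have := Pb _ pP; have := pair_norm1 p; have := pair_norm2 p;
  rewrite pair_normE gt_max /= => n2 n1 pb;
  have := ler_norm p.2; have := ler_norm (- p.2); rewrite normrN => a1 a2;
  by apply/andP; split; [lra|rewrite ltr_norml; apply/andP; split; lra].
(* Inside of a tube only the short tubes of the same line count. *)
have VE p z : p \in P -> `|z.1 - p.1| <= r -> U z <->
    exists2 q, q \in P & q.1 = p.1 /\ q.2 - rho <= z.2 < q.2 + rho.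
  move=> pP zp; split=> [[[zY _]|[q qP [zq qz]]]|[q qP [q1 qz]]].
  - by have := zY _ (PY pP); rewrite ltNge zp.
  - exists q => //; split=> //; apply: Yr; [exact: PY|exact: PY|].
    by have := ler_normD (q.1 - z.1) (z.1 - p.1); rewrite addrA subrK (distrC q.1 z.1); lra.
  - by right; exists q => //; rewrite q1.
have EU z : z \in bot ++ top -> \forall z' \near z, U z' <-> if s z then z.2 <= z'.2 else z'.2 < z.2.
  rewrite mem_cat => zE; have [zb|zb] := boolP (z \in bot); rewrite /s ?zb.
    case/mapP: zb => p pP ->.
    apply: filterS2 (near_norm1 (p.1, p.2 - rho) r0) (near_norm2 (p.1, p.2 - rho) rho0) => z' /= z'1.
    rewrite ltr_norml => /andP[z'2 z'3]; rewrite (VE p) // 1?distrC ?(ltW z'1)//.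
    split=> [[q qP [q1 /andP[qz zq]]]|pz].
      rewrite -(_ : q = p) //; apply: Psep => //.
      by rewrite ler_norml; apply/andP; split; lra.
    by exists p => //; split=> //; apply/andP; split; lra.
  move: zE; rewrite (negbTE zb) /= => /mapP[p pP ->].
  apply: filterS2 (near_norm1 (p.1, p.2 + rho) r0) (near_norm2 (p.1, p.2 + rho) rho0) => z' /= z'1.
  rewrite ltr_norml => /andP[z'2 z'3]; rewrite (VE p) // 1?distrC ?(ltW z'1)//.
  split=> [[q qP [q1 /andP[qz zq]]]|pz].
    rewrite -(_ : q = p) //; apply: Psep => //.
    by rewrite ler_norml; apply/andP; split; lra.
  by exists p => //; split=> //; apply/andP; split; lra.
(* A zero that is not an end of a short tube is interior or exterior to U: on a
   trivial line this is a matter of its level, near Z0 it is interior, and on L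
   it is exterior. *)
have loc z : f z = 0 -> z \in bot ++ top \/ \forall z' \near z, U z' <-> U z.
  move=> fz; have [zE|zE] := boolP (z \in bot ++ top); [by left|right].
  have [zY|zY] := boolP (z.1 \in Y).
    have UV z' : `|z'.1 - z.1| <= r -> U z' <-> exists2 q, q \in P & q.1 = z.1 /\ q.2 - rho <= z'.2 < q.2 + rho.
      move=> zp; split=> [[[/(_ _ zY) + _]|[q qP [zq qz]]]|[q qP [q1 qz]]].
      - by rewrite ltNge zp.
      - exists q => //; split=> //; apply: Yr => //; first exact: PY.
        by have := ler_normD (q.1 - z'.1) (z'.1 - z.1); rewrite addrA subrK (distrC q.1 z'.1); lra.
      - by right; exists q => //; rewrite q1.
    have Hq : \forall z' \near z, forall q, q \in P -> q.1 = z.1 ->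
        (q.2 - rho <= z'.2 < q.2 + rho) = (q.2 - rho <= z.2 < q.2 + rho).
      apply: near_allZ => q qP; have [q1|q1] := eqVneq q.1 z.1; last by apply: filterE => z' /eqP; rewrite (negbTE q1).
      have n1 : z.2 != q.2 - rho.
        apply: contra zE => /eqP z2; rewrite mem_cat (_ : z \in bot) //; apply/mapP; exists q => //.
        by rewrite q1 -z2; case: (z).
      have n2 : z.2 != q.2 + rho.
        apply: contra zE => /eqP z2; rewrite mem_cat orbC (_ : z \in top) //; apply/mapP; exists q => //.
        by rewrite q1 -z2; case: (z).
      have h1 : \forall z' \near z, (q.2 - rho <= z'.2) = (q.2 - rho <= z.2).
        have [lt|lt|eq] := ltgtP z.2 (q.2 - rho); last by rewrite eq eqxx in n1.
          by apply: filterS (near_lt2 lt) => z' ?; rewrite leNgt; apply/negbTE; rewrite negbK.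
        by apply: filterS (near_gt2 lt) => z' /ltW.
      have h2 : \forall z' \near z, (z'.2 < q.2 + rho) = (z.2 < q.2 + rho).
        have [lt|lt|eq] := ltgtP z.2 (q.2 + rho); last by rewrite eq eqxx in n2.
          by apply: filterS (near_lt2 lt) => z' ?.
        by apply: filterS (near_gt2 lt) => z' ?; rewrite ltNge; apply/negbTE; rewrite negbK ltW.
      by apply: filterS2 h1 h2 => z' -> -> _.
    apply: filterS2 (near_norm1 z r0) Hq => z' z'r Hz'.
    rewrite !UV ?subrr ?normr0 ?(ltW r0) //; last by rewrite distrC ltW.
    by split=> -[q qP [q1 qz]]; exists q => //; split=> //; move: qz; rewrite Hz'.
  have [Zz|Lz|] := zeros fz; last by rewrite (negbTE zY).
    have nU : \forall z' \near z, U z'.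
      have HY : \forall z' \near z, forall y, y \in Y -> r < `|z'.1 - y| \/
          exists2 p, p \in P & p.1 = y /\ p.2 - rho <= z'.2 < p.2 + rho.
        apply: near_allZ => y yY; have [zy|zy] := ltP r `|z.1 - y|.
          by apply: filterS (near_out zy) => z' ?; left.
        have [p [pP py]] := Zr _ Zz _ yY zy; rewrite ltr_norml => /andP[p1 p2].
        have {}p1 : p.2 - rho < z.2 by lra.
        have {}p2 : z.2 < p.2 + rho by lra.
        apply: filterS2 (near_gt2 p1) (near_lt2 p2) => z' q1 q2; right; exists p => //.
        by split=> //; rewrite (ltW q1).
      apply: filterS2 HY (near_dist z e0) => z' HY zz'.
      have [[y yY zy]|nY] := pselect (exists2 y, y \in Y & `|z'.1 - y| <= r).
        right; case: (HY _ yY) => [|[p pP [py pz]]]; first by rewrite ltNge zy.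
        by exists p => //; rewrite py.
      left; split=> [y yY|]; last by exists z.
      by rewrite ltNge; apply/negP => zy; apply: nY; exists y.
    have Uz := nbhs_singleton nU.
    by apply: filterS nU => z' Uz'; split.
  have nU : \forall z' \near z, ~ U z'.
    have HP : \forall z' \near z, forall p, p \in P -> `|z'.1 - p.1| <= r -> p.2 - rho <= z'.2 < p.2 + rho -> False.
      apply: near_allZ => p pP; have [zp|zp] := ltP r `|z.1 - p.1|.
        by apply: filterS (near_out zp) => z' + z'p; rewrite ltNge z'p.
      have [zp2|zp2] := leP `|z.2 - p.2| rho; first by case: (PrL _ pP _ zp zp2).
      have [z2|z2] := leP z.2 p.2.
        rewrite ler0_norm ?subr_le0 // in zp2; have {}zp2 : z.2 < p.2 - rho by lra.
        by apply: filterS (near_lt2 zp2) => z' + _ /andP[]; lra.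
      rewrite gtr0_norm ?subr_gt0 // in zp2; have {}zp2 : p.2 + rho < z.2 by lra.
      by apply: filterS (near_gt2 zp2) => z' + _ /andP[]; lra.
    apply: filterS2 HP (near_dist z e0) => z' HP zz' [[_ [z0 Zz0 z0z']]|[p pP [zp pz]]]; last exact: HP pz.
    apply: (eL _ Zz0 z) Lz; have := ler_normD (z0 - z') (z' - z); rewrite addrA subrK (distrC z' z); lra.
  have Uz := nbhs_singleton nU.
  by apply: filterS nU => z' Uz'; split.
have fcc : cont_conv (fun _ => f) f.
  apply: cont_convP => z; apply: (@cvg_comp _ _ _ fst f); first exact: cvg_fst.
  exact: fc.
(* sg = 1 for the upper and sg = -1 for the lower ends. *)
have LD (sg : R) : (sg == 1) || (sg == -1) -> \forall tau \near (0 : R)^'+, forall p, p \in P -> \forall h \near (0 : R)^'+,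
    grid_degree b h (fun x => f (x, layer b h (p.2 + sg * rho))) p.1 tau = sgz (\det (A p.1 (p.2 + sg * rho))).
  move=> sg1; apply: near_all => p pP; have [g fg] := fA pP.
  have pb2 : `|p.2 + sg * rho| < b.
    have : (p.1, p.2 + sg * rho) \in bot ++ top.
      rewrite mem_cat; case/orP: sg1 => /eqP ->; rewrite ?mul1r ?mulN1r; apply/orP; [right|left]; apply: map_f pP.
    by move=> /Eb; rewrite pair_normE gt_max => /andP[].
  apply: (local_degree fg) => //.
  - by case/orP: sg1 => /eqP ->; rewrite ?mul1r ?mulN1r; have [] := uArho pP.
  - by have := Pb _ pP; have := pair_norm1 p; lra.
  - exact: cvg_layer.
have l1 : ((1 : R) == 1) || ((1 : R) == -1) by rewrite eqxx.
have l2 : ((-1 : R) == 1) || ((-1 : R) == -1) by rewrite eqxx orbT.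
pose deg h tau (e : Z) := grid_degree b h (fun x => f (x, layer b h e.2)) e.1 tau.
near (0 : R)^'+ => tau.
have B1 : \forall h \near (0 : R)^'+, \sum_(e <- bot ++ top) (-1) ^+ (s e : nat) * deg h tau e = 0.
  by near: tau; exact: (balance b0 fcc Ub uE Eb EU loc).
have B2 : forall p, p \in P -> \forall h \near (0 : R)^'+,
    deg h tau (p.1, p.2 + 1 * rho) = sgz (\det (A p.1 (p.2 + 1 * rho))).
  by near: tau; exact: (LD _ l1).
have B3 : forall p, p \in P -> \forall h \near (0 : R)^'+,
    deg h tau (p.1, p.2 + -1 * rho) = sgz (\det (A p.1 (p.2 + -1 * rho))).
  by near: tau; exact: (LD _ l2).
near (0 : R)^'+ => h.
have C1 : \sum_(e <- bot ++ top) (-1) ^+ (s e : nat) * deg h tau e = 0 by near: h.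
have C2 : forall p, p \in P -> deg h tau (p.1, p.2 + 1 * rho) = sgz (\det (A p.1 (p.2 + 1 * rho))).
  by near: h; exact: near_all.
have C3 : forall p, p \in P -> deg h tau (p.1, p.2 + -1 * rho) = sgz (\det (A p.1 (p.2 + -1 * rho))).
  by near: h; exact: near_all.
move: C1; rewrite big_cat /= !big_map -big_split /= => C1.
apply/eqP; rewrite -oppr_eq0 -sumrN -[X in _ == X]C1; apply/eqP.
rewrite [LHS]big_seq [RHS]big_seq; apply: eq_bigr => p pP.
have pb : (p.1, p.2 - rho) \in bot by apply: map_f.
have pt : ((p.1, p.2 + rho) \in bot) = false.
  apply/negP => pb'; apply: (bot_top _ pb'); exact: map_f.
rewrite /s pb pt expr1 expr0 mul1r mulN1r.
have := C2 _ pP; have := C3 _ pP; rewrite !mul1r !mulN1r => -> ->.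
by rewrite opprB addrC.
Unshelve. all: by end_near. Qed.

End FixedRho.

(** Along a trivial line {y} x R, y in [Y], the degree can only change through zeros
    off the line. Those near [P] lie in [Z0], which is compact, separated from
    [L], and meets the lines only in [P], so the changes compensate each other
    within [P]. *)
Lemma degree_balance : \forall rho \near (0 : R)^'+,
  \sum_(p <- P) (sgz (\det (A p.1 (p.2 - rho))) - sgz (\det (A p.1 (p.2 + rho)))) = 0.
Proof.
have H1 : \forall rho \near (0 : R)^'+, forall p, p \in P -> forall mu, `|mu - p.2| <= rho -> ~ L (p.1, mu).
  apply: near_all => p pP.
  have /nbhs_normP[e /= e0 eL] : \forall z \near p, ~ L z.
    by apply: open_nbhs_nbhs; split; [exact: closed_openC|exact: PL].
  apply: filterS (nbhs_right_lt e0) => rho re mu mup; apply: eL => /=.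
  by rewrite pair_normE gt_max /= subrr normr0 e0 distrC (le_lt_trans mup).
have H2 : \forall rho \near (0 : R)^'+, forall p, p \in P -> forall q, q \in P -> p.1 = q.1 -> `|p.2 - q.2| <= 3 * rho -> p = q.
  apply: near_all => p pP; apply: near_all => q qP.
  have [pq|pq] := eqVneq p.2 q.2.
    by apply: filterE => rho pq1 _; case: p q pq pq1 {pP qP} => [x t] [x' t'] /= -> ->.
  have d0 : 0 < `|p.2 - q.2| / 3 by rewrite divr_gt0 // normr_gt0 subr_eq0.
  by apply: filterS (nbhs_right_lt d0) => rho rd _ pqr; exfalso; lra.
have H3 : \forall rho \near (0 : R)^'+, forall p, p \in P -> (A p.1 (p.2 - rho) \in unitmx) /\ (A p.1 (p.2 + rho) \in unitmx).
  exact: near_all.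
have H0 := @nbhs_right_gt R 0.
by apply: filterS3 H0 H1 (filterI H2 H3) => rho h0 h1 [h2 h3]; apply: degree_balance_rho.
Qed.

End DegreeBalance.

(** * Bounded components of closed sets *)

Section Components.
Variables (R : realType) (V : normedModType R).
Implicit Types (K D W A B : set V).

Definition fattening A (e : R) : set V := [set z | exists2 a, A a & `|a - z| < e].

Lemma open_fattening A e : open (fattening A e).
Proof.
rewrite openE => z [a Aa az]; rewrite -subr_gt0 in az.
apply: filterS (near_dist z az) => z' zz'; exists a => //.
by have := ler_normD (a - z) (z - z'); rewrite addrA subrK; lra.
Qed.

Section Quasi.
Variables (K : set V) (z0 : V).
Hypotheses (Kc : compact K) (Kz0 : K z0).

(** The clopen neighbourhoods of [z0] in the compact set [K]. *)
Definition relclopen D := [/\ closed D, closed (K `\` D), D z0 & D `<=` K].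

Let Kcl : closed K. Proof. by apply: compact_closed => //; exact: norm_hausdorff. Qed.

Lemma relclopenI D D' : relclopen D -> relclopen D' -> relclopen (D `&` D').
Proof.
move=> [c1 c2 c3 c4] [d1 d2 d3 d4]; split=> //; first exact: closedI.
  by rewrite setDIr; apply: closedU.
by move=> z [/c4].
Qed.

Lemma relclopenK : relclopen K.
Proof. by split=> //; rewrite setDv; exact: closed0. Qed.

(** Otherwise the sets D minus W form a filter base of closed sets in a compact
    set, and have a common point. *)
Lemma relclopen_in_open W : open W ->
  (forall q, (forall D, relclopen D -> D q) -> W q) -> exists2 D, relclopen D & D `<=` W.
Proof.
move=> oW QW; apply: contrapT => noD.
pose F := filter_from relclopen (fun D => D `\` W).
have FF : ProperFilter F.
  apply: filter_from_proper; last first.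
    move=> D rD; apply/set0P/eqP => DW; apply: noD; exists D => //.
    by rewrite -setD_eq0.
  apply: filter_from_filter; first by exists K; exact: relclopenK.
  move=> D D' rD rD'; exists (D `&` D'); first exact: relclopenI.
  by move=> z [[Dz D'z] Wz].
have FK : F K by exists K; [exact: relclopenK|move=> z []].
have [q [Kq Fq]] := Kc FF FK.
rewrite clusterE in Fq.
have DWq D : relclopen D -> (D `\` W) q.
  move=> rD; have : closed (D `\` W).
    by case: rD => Dc _ _ _; rewrite setDE; apply: closedI => //; exact: open_closedC.
  by move=> /closure_id ->; apply: Fq; exists D.
have [_ nWq] := DWq _ relclopenK.
by apply: nWq; apply: QW => D /DWq[].
Qed.

(** The intersection of the clopen neighbourhoods cannot be divided into two
    closed parts: one of the neighbourhoods would be contained in disjoint open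
    neighbourhoods of the parts, and its trace on the first of them would again
    be clopen. *)
Lemma quasicomponent_split A B : closed A -> closed B -> A z0 ->
  (forall z, A z -> ~ B z) ->
  (forall q, (forall D, relclopen D -> D q) -> A q \/ B q) ->
  A `<=` K -> forall q, (forall D, relclopen D -> D q) -> ~ B q.
Proof.
move=> Ac Bc Az0 AB QAB AK q Qq Bq.
have AC : compact A by apply: subclosed_compact AK.
have [e e0 gap] := compact_gap AC Bc AB.
have [D rD DU] : exists2 D, relclopen D & D `<=` fattening A e `|` fattening B e.
  apply: relclopen_in_open; first by apply: openU; exact: open_fattening.
  by move=> z /QAB[Az|Bz]; [left|right]; exists z; rewrite // subrr normr0.
have disj z : fattening A e z -> fattening B e z -> False.
  move=> [a Aa az] [b' Bb bz]; apply: (gap _ Aa b') Bb.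
  by have := ler_normD (a - z) (z - b'); rewrite addrA subrK (distrC z b'); lra.
have rD' : relclopen (D `&` fattening A e).
  have [c1 c2 c3 c4] := rD; split.
  - rewrite (_ : _ `&` _ = D `\` fattening B e).
      by rewrite setDE; apply: closedI => //; apply: open_closedC; exact: open_fattening.
    apply/seteqP; split=> z [Dz]; first by move=> Az; split=> // /(disj _ Az).
    by move=> nB; split=> //; case: (DU _ Dz).
  - rewrite setDIr; apply: closedU => //.
    by rewrite setDE; apply: closedI => //; apply: open_closedC; exact: open_fattening.
  - by split=> //; exists z0; rewrite // subrr normr0.
  - by move=> z [/c4].
have [_ Aq] := Qq _ rD'; apply: (disj q Aq).
by exists q; rewrite // subrr normr0.
Qed.

(** Either half of a separation of this intersection is excluded by
    [quasicomponent_split]. *)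
Lemma quasicomponent_component : [set q | forall D, relclopen D -> D q] `<=` connected_component K z0.
Proof.
set Q := [set q | _].
have Qz0 : Q z0 by move=> D [].
have QK : Q `<=` K by move=> q; apply; exact: relclopenK.
have Qc : closed Q.
  rewrite (_ : Q = \bigcap_(D in relclopen) D); last by apply/seteqP; split=> q Hq D; apply: Hq.
  by apply: closed_bigI => D [].
apply: connected_component_max => // B [q0 Bq0] [C1 oC1 BC1] [C2 cC2 BC2].
have B_cl : closed B by rewrite BC2; exact: closedI.
have QB_cl : closed (Q `\` B).
  rewrite BC1 setDIr setDv set0U setDE; apply: closedI => //; exact: open_closedC.
have BQ : B `<=` Q by rewrite BC1 => q [].
apply/seteqP; split=> // q Qq; apply: contrapT => nBq.
have [Bz0|nBz0] := pselect (B z0).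
  apply: (@quasicomponent_split B (Q `\` B) _ _ _ _ _ _ q) => //.
  - by move=> z Bz [].
  - by move=> z Qz; have [|] := pselect (B z); [left|right].
  - by move=> z /BQ/QK.
apply: (@quasicomponent_split (Q `\` B) B _ _ _ _ _ _ q0) => //.
- by move=> z [].
- by move=> z Qz; have [|] := pselect (B z); [right|left].
- by move=> z [/QK].
- exact: BQ.
Qed.

End Quasi.

(** A component need not be isolated from the rest of the set, but it has
    relatively clopen neighbourhoods inside any open set that contains it:
    [relclopen_in_open] gives one in the compact set cut out by a closed ball,
    and as it lies inside the open ball it is clopen in the whole set. *)
Lemma bounded_component_isolated K z0 W :
  (forall c, compact [set z : V | `|z| <= c]) ->
  closed K -> K z0 -> open W -> connected_component K z0 `<=` W ->
  bounded_set (connected_component K z0) ->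
  exists D, [/\ compact D, closed (K `\` D), D `<=` K, D `<=` W &
     connected_component K z0 `<=` D].
Proof.
move=> Vc Kc Kz0 oW CW [M [_ CM]].
have {}CM z : connected_component K z0 z -> `|z| < M + 2.
  have M1 : M < M + 1 by rewrite ltrDl.
  by move=> Cz; have /= := CM _ M1 z Cz; lra.
pose K' := K `&` [set z | `|z| <= M + 2].
have K'c : compact K' by rewrite /K' setIC; apply: compact_closedI.
have CK' : connected_component K z0 `<=` K'.
  by move=> z Cz; split; [exact: connected_component_sub Cz|exact: ltW (CM _ Cz)].
have K'z0 : K' z0 by apply: CK'; exact: connected_component_refl.
have sub : connected_component K' z0 `<=` connected_component K z0.
  apply: connected_component_max; first exact: connected_component_refl.
    by move=> z /connected_component_sub[].
  exact: component_connected.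
have oB : open [set z : V | `|z| < M + 2].
  apply: (@open_comp _ _ (fun z : V => `|z|) [set t | t < M + 2]); last exact: open_lt.
  by move=> z _; exact: norm_continuous.
have [D [Dc K'D Dz0 DK'] DW] : exists2 D, relclopen K' z0 D & D `<=` W `&` [set z | `|z| < M + 2].
  apply: relclopen_in_open => //; first exact: openI.
  move=> q /(quasicomponent_component K'c K'z0) /sub Cq.
  by split; [exact: CW|exact: CM].
exists D; split.
- exact: subclosed_compact DK'.
- rewrite (_ : K `\` D = (K' `\` D) `|` (K `&` [set z | M + 2 <= `|z|])).
    apply: closedU => //; apply: closedI => //.
    apply: (@closed_comp _ _ (fun z : V => `|z|) [set t | M + 2 <= t]); last exact: closed_ge.
    by move=> z _; exact: norm_continuous.
  apply/seteqP; split=> z.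
    move=> [Kz nDz]; have [zM|/ltW zM] := leP `|z| (M + 2); first by left.
    by right.
  case=> [[[Kz _] nDz]|[Kz zM]]; split=> // /DW[_ /=]; by rewrite ltNge zM.
- by move=> z /DK'[].
- by move=> z /DW[].
move=> z Cz; have Cconn := @component_connected _ K z0.
have : connected_component K z0 `&` D = connected_component K z0.
  apply: Cconn.
  - by exists z0; split=> //; exact: connected_component_refl.
  - exists (~` (K' `\` D)); first exact: closed_openC.
    apply/seteqP; split=> x [Cx Dx]; split=> //; first by case.
    by apply: contrapT => nDx; apply: Dx; split=> //; exact: CK'.
  - by exists D.
by move=> /seteqP[_ /(_ _ Cz) []].
Qed.

End Components.

(** * Derivatives and determinants along a trivial line *)

Section Jacobian.
Variables (R : realType) (N : nat).
Notation X := 'rV[R]_N.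

(** The divided difference converges uniformly on the unit sphere, which is
    differentiability. *)
Lemma jacobian_blowup (f : X * R -> X) y g A m : blowup f y g A ->
  jacobian (fun u => f (u, m)) y = A m.
Proof.
move=> fg; pose F u := f (u, m).
have Fy : F y = 0 by have := blowupE fg 0 0 m; rewrite !scale0r addr0.
have dF : 'd F y = mulmxr (A m) :> (X -> X).
  apply: diff_unique.
    by move=> v; apply: (@cvg_mulmx _ _ (nbhs v) _ _ _ id v (A m)); exact: cvg_id.
  apply/eqaddoP => e e0.
  have cov : \forall s \near (0 : R), [set v : X | `|v| = 1] `<=` (fun v => `|v *m A m - g v s m| < e).
    have /compact_near_coveringP := @compact_sphere R N.
    move=> H; apply: (H _ _ _ (nbhs_filter (0 : R))) => v _.
    have cv : (fun q : X * R => g q.1 q.2 m) @ filter_prod (nbhs v) (nbhs (0 : R)) --> g v 0 m.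
      apply: (@cvg_comp _ _ _ (fun q : X * R => (q.1, (q.2, m))) (fun p => g p.1 p.2.1 p.2.2)).
        have c1 : (fun q : X * R => q.1) @ filter_prod (nbhs v) (nbhs (0 : R)) --> v by exact: cvg_fst.
        have c2 : (fun q : X * R => q.2) @ filter_prod (nbhs v) (nbhs (0 : R)) --> (0 : R) by exact: cvg_snd.
        have c3 : (fun q : X * R => m) @ filter_prod (nbhs v) (nbhs (0 : R)) --> m by exact: cvg_cst.
        exact: (cvg_pair c1 (cvg_pair c2 c3)).
      exact: (@blowup_cont _ _ _ _ _ _ fg (v, (0, m))).
    have cA : (fun q : X * R => q.1 *m A m) @ filter_prod (nbhs v) (nbhs (0 : R)) --> v *m A m.
      by apply: cvg_mulmx; exact: cvg_fst.
    have cB : (fun q : X * R => q.1 *m A m - g q.1 q.2 m) @ filter_prod (nbhs v) (nbhs (0 : R)) --> (0 : X).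
      by rewrite -[0 : X](subrr (v *m A m)) -[in X in _ - X](blowup0 fg); exact: cvgB.
    have /cvgrPdist_lt /(_ _ e0) := cB.
    by apply: filterS => q /=; rewrite sub0r normrN.
  have /nbhs_normP[d /= d0 dcov] := cov.
  have := @near_dist R _ (0 : X) d d0; apply: filterS => v; rewrite sub0r normrN => vd.
  rewrite !fctE /= Fy add0r.
  have [->|v0] := eqVneq v 0.
    by rewrite mul0mx subr0 add0r Fy normr0 mulr0.
  have n0 : 0 < `|v| by rewrite normr_gt0.
  pose u := `|v|^-1 *: v.
  have u1 : `|u| = 1 by rewrite normrZ normfV normr_id mulVf // gt_eqF.
  have vE : v = `|v| *: u by rewrite scalerA divff ?gt_eqF // scale1r.
  rewrite (addrC v) {1 2}vE /F (blowupE fg) -scalemxAl -scalerBr normrZ normr_id mulrC.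
  rewrite ler_pM2r // distrC ltW //; apply: dcov => //=.
  by rewrite sub0r normrN normr_id.
apply/matrixP => i j; rewrite /jacobian mxE -/F dF /= -rowE mxE //.
Qed.

End Jacobian.

Section SignChange.
Variable R : realType.

Lemma det_poly_path N (M B : 'M[R]_N) : exists p : {poly R}, forall t, p.[t] = \det (M + t *: B).
Proof.
exists (\det (map_mx polyC M + 'X *: map_mx polyC B)) => t.
rewrite -horner_evalE -det_map_mx; congr (\det _); apply/matrixP => i j.
rewrite !mxE -[LHS]/((M i j)%:P + 'X * (B i j)%:P).[t]; by rewrite hornerD hornerM hornerX !hornerC.
Qed.

Lemma sgz_cst_near (p : {poly R}) a : p.[a] != 0 -> \forall t \near a, sgz p.[t] = sgz p.[a].
Proof.
move=> pa; have p0 : 0 < `|p.[a]| by rewrite normr_gt0.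
have /cvgrPdist_lt /(_ _ p0) := @continuous_horner R p a.
apply: filterS => t; have [pos|neg|z] := ltgtP p.[a] 0; last by rewrite z eqxx in pa.
  by rewrite (ltr0_norm pos) ltr_norml => /andP[h1 h2]; rewrite !ltr0_sgz //; lra.
by rewrite (gtr0_norm neg) ltr_norml => /andP[h1 h2]; rewrite !gtr0_sgz //; lra.
Qed.

(** Factor out the root a with its multiplicity. *)
Lemma sgz_poly_right (p : {poly R}) (a : R) : p != 0 ->
  exists2 s : int, s != 0 & \forall r \near (0 : R)^'+, sgz p.[a + r] = s.
Proof.
move=> p0; have [k [q]] := multiplicity_XsubC p a; rewrite p0 /= => qa ->.
exists (sgz q.[a]); first by rewrite sgz_eq0.
have /nbhs_normP[d /= d0 dq] := sgz_cst_near qa.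
apply: filterS2 (nbhs_right_gt 0) (nbhs_right_lt d0) => r r0 rd.
rewrite hornerM horner_exp hornerXsubC sgzM addrC addrK sgzX (gtr0_sgz r0) expr1n mulr1.
by apply: dq => /=; rewrite opprD addrA addrAC subrr sub0r normrN gtr0_norm.
Qed.

Lemma sgz_poly_left (p : {poly R}) (a : R) : p != 0 ->
  exists2 s : int, s != 0 & \forall r \near (0 : R)^'+, sgz p.[a - r] = s.
Proof.
move=> p0; have q0 : p \Po - 'X != 0.
  apply: contra p0 => /eqP q0; have := congr1 (comp_poly (- 'X)) q0.
  by rewrite comp_poly0 -comp_polyA raddfN /= comp_polyX opprK comp_polyXr => ->.
have [s s0 qs] := sgz_poly_right (- a) q0; exists s => //; apply: filterS qs => r <-.
by rewrite horner_comp hornerN hornerX opprD opprK.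
Qed.

Lemma poly_roots_finite (p : {poly R}) : p != 0 -> exists s : seq R, forall x, p.[x] = 0 -> x \in s.
Proof.
move=> p0; pose Q m := `[< exists2 s : seq R, uniq s & all (root p) s /\ size s = m >].
have Q0 : exists m, Q m by exists 0%N; apply/asboolP; exists [::].
have Qb m : Q m -> (m <= size p)%N.
  by move=> /asboolP[s us [rs <-]]; apply/ltnW/(max_poly_roots p0).
case: (ex_maxnP Q0 Qb) => m /asboolP[s us [rs sm]] mmax; exists s => x px.
apply: contraT => xs; have : Q m.+1.
  by apply/asboolP; exists (x :: s); rewrite /= ?xs ?us // rootE px eqxx rs sm.
by move/mmax; rewrite ltnn.
Qed.

(** The determinant of 1 + u v is 1 + v u for a column u and a row v, by
    reducing the bordered matrix in the two ways. *)
Lemma det_rank1 N (y : 'cV[R]_N) (phi : 'rV[R]_N) t : (phi *m y) 0 0 = 1 ->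
  \det (1%:M + (t - 1) *: (y *m phi)) = t.
Proof.
move=> py.
have e1 : block_mx 1%:M (- ((t - 1) *: y)) 0 1%:M *m block_mx (1%:M + (t - 1) *: (y *m phi)) 0 phi (1%:M : 'M[R]_1)
   = block_mx 1%:M (- ((t - 1) *: y)) phi 1%:M.
  rewrite mulmx_block !mul1mx !mul0mx !mulmx1 !add0r mulNmx -scalemxAl addrK.
  by [].
have e2 : block_mx (1%:M : 'M[R]_N) 0 phi (1%:M : 'M[R]_1) *m block_mx 1%:M (- ((t - 1) *: y)) 0 (t%:M : 'M[R]_1)
   = block_mx 1%:M (- ((t - 1) *: y)) phi 1%:M.
  rewrite mulmx_block !mul1mx ?mul0mx ?mulmx0 ?mulmx1 ?addr0 ?add0r ?mul1mx; congr block_mx.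
  apply/matrixP => i j; rewrite (ord1 i) (ord1 j) mulmxN -scalemxAr.
  move: (phi *m y) py => q py; rewrite !mxE py mulr1n; by rewrite eqxx mulr1n; lra.
have := congr1 determinant (etrans e1 (esym e2)).
rewrite !det_mulmx !det_ublock !det_lblock !det1 !mul1r !mulr1 det_scalar1 => ->.
by [].
Qed.

Lemma unitmx_left_kernel N (M : 'M[R]_N) : (forall v : 'rV_N, v *m M = 0 -> v = 0) -> M \in unitmx.
Proof.
move=> kerM; rewrite -row_free_unit -kermx_eq0; apply/eqP/row_matrixP => i.
by rewrite row0; apply: kerM; rewrite -row_mul mulmx_ker row0.
Qed.

(** A simple crossing of an eigenvalue. With phi y = 1 and E = B y phi one has
    M + t B = (M + E + t (B - E)) (1 + (t - 1) y phi), because M y = 0 and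
    E y = B y. The second factor has determinant t, and the first is invertible
    at t = 0 since the pairing w B y does not vanish. *)
Lemma det_sign_change N (M B : 'M[R]_N) (y : 'cV[R]_N) (w : 'rV[R]_N) :
  M *m y = 0 -> (forall v, v *m M = 0 -> exists c, v = c *: w) -> (w *m B *m y) 0 0 != 0 ->
  exists2 s : int, s != 0 & \forall t \near (0 : R), sgz (\det (M + t *: B)) = s * sgz t.
Proof.
move=> My kerM wBy.
have y0 : y != 0 by apply: contra wBy => /eqP ->; rewrite mulmx0 mxE.
have [phi py] : exists phi : 'rV[R]_N, (phi *m y) 0 0 = 1.
  have [i yi] : exists i, y i 0 != 0.
    apply/existsP; apply: contraR y0 => /existsPn H; apply/eqP/colP => i.
    by rewrite mxE; apply/eqP; have := H i; rewrite negbK.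
  by exists ((y i 0)^-1 *: delta_mx 0 i); rewrite -scalemxAl -rowE !mxE mulVf.
have py' : phi *m y = 1%:M by apply/matrixP => i j; rewrite (ord1 i) (ord1 j) py mxE.
pose E := B *m y *m phi.
have fact t : M + t *: B = (M + E + t *: (B - E)) *m (1%:M + (t - 1) *: (y *m phi)).
  have Ey : E *m y = B *m y by rewrite /E -mulmxA py' mulmx1.
  have NE : (M + E + t *: (B - E)) *m (y *m phi) = E.
    have Ny : (M + E + t *: (B - E)) *m y = B *m y.
      by rewrite !mulmxDl My add0r Ey -scalemxAl mulmxBl Ey subrr scaler0 addr0.
    by rewrite mulmxA Ny.
  rewrite mulmxDr mulmx1 -scalemxAr NE; apply/matrixP => i j; rewrite !mxE; ring.
have [p pE] := det_poly_path (M + E) (B - E).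
have p0 : p.[0] != 0.
  rewrite pE scale0r addr0 -unitfE -unitmxE; apply: unitmx_left_kernel => v vME.
  have vBy : v *m B *m y = 0.
    have : v *m (M + E) *m y = 0 by rewrite vME mul0mx.
    by rewrite mulmxDr mulmxDl -mulmxA My mulmx0 add0r /E !mulmxA -(mulmxA (v *m B *m y)) py' mulmx1.
  have vM : v *m M = 0 by move: vME; rewrite mulmxDr /E !mulmxA vBy mul0mx addr0.
  have [c vc] := kerM _ vM; move: vBy; rewrite vc -!scalemxAl => /matrixP/(_ 0 0)/eqP.
  rewrite !mxE mulf_eq0 => /orP[/eqP ->|]; first by rewrite scale0r.
  by move: wBy; rewrite !mxE => /negbTE ->.
exists (sgz p.[0]); first by rewrite sgz_eq0.
apply: filterS (sgz_cst_near p0) => t pt.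
by rewrite fact det_mulmx (det_rank1 _ py) -pE sgzM pt.
Qed.

End SignChange.

Local Open Scope complex_scope.

(** * The lattice equation and its divided differences *)

Section ComplexContinuity.
Variables (R : realType) (T : topologicalType).
Implicit Types F G : T -> R[i].

(** Continuity is stated on the real and imaginary parts, the form in which
    [of_sites] assembles a state. *)
Definition ccontinuous F :=
  continuous (fun x => complex.Re (F x)) /\ continuous (fun x => complex.Im (F x)).

Lemma ccontinuous_cst z : ccontinuous (fun=> z).
Proof. by split=> x; exact: cvg_cst. Qed.

Lemma ccontinuous_real (f : T -> R) : continuous f -> ccontinuous (fun x => (f x)%:C).
Proof. by move=> fc; split=> x /=; [exact: fc|exact: cvg_cst]. Qed.

Lemma ccontinuousD F G : ccontinuous F -> ccontinuous G -> ccontinuous (fun x => F x + G x).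
Proof.
move=> [f1 f2] [g1 g2]; split=> x.
  rewrite (_ : (fun _ => _) = (fun x => complex.Re (F x) + complex.Re (G x))); first exact: cvgD (f1 x) (g1 x).
  by apply: boolp.funext => z; rewrite raddfD.
rewrite (_ : (fun _ => _) = (fun x => complex.Im (F x) + complex.Im (G x))); first exact: cvgD (f2 x) (g2 x).
by apply: boolp.funext => z; rewrite raddfD.
Qed.

Lemma ccontinuousN F : ccontinuous F -> ccontinuous (fun x => - F x).
Proof.
move=> [f1 f2]; split=> x.
  rewrite (_ : (fun _ => _) = (fun x => - complex.Re (F x))); first exact: cvgN (f1 x).
  by apply: boolp.funext => z; rewrite raddfN.
rewrite (_ : (fun _ => _) = (fun x => - complex.Im (F x))); first exact: cvgN (f2 x).
by apply: boolp.funext => z; rewrite raddfN.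
Qed.

Lemma ccontinuous_conj F : ccontinuous F -> ccontinuous (fun x => (F x)^*%C).
Proof.
move=> [f1 f2]; split=> x.
  rewrite (_ : (fun _ => _) = (fun x => complex.Re (F x))); first exact: f1.
  by apply: boolp.funext => z; case: (F z).
rewrite (_ : (fun _ => _) = (fun x => - complex.Im (F x))); first exact: cvgN (f2 x).
by apply: boolp.funext => z; case: (F z).
Qed.

Lemma ccontinuousM F G : ccontinuous F -> ccontinuous G -> ccontinuous (fun x => F x * G x).
Proof.
move=> [f1 f2] [g1 g2]; split=> x.
  rewrite (_ : (fun _ => _) = (fun x => complex.Re (F x) * complex.Re (G x) - complex.Im (F x) * complex.Im (G x))).
    by apply: cvgB; apply: cvgM; [exact: f1|exact: g1|exact: f2|exact: g2].
  by apply: boolp.funext => z; case: (F z) => a b; case: (G z).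
rewrite (_ : (fun _ => _) = (fun x => complex.Re (F x) * complex.Im (G x) + complex.Im (F x) * complex.Re (G x))).
  by apply: cvgD; apply: cvgM; [exact: f1|exact: g2|exact: f2|exact: g1].
by apply: boolp.funext => z; case: (F z) => a b; case: (G z).
Qed.

Lemma continuous_of_sites n (F : T -> 'I_n -> R[i]) :
  (forall j, ccontinuous (fun x => F x j)) -> continuous (fun x => of_sites (F x)).
Proof.
move=> Fc x; apply: cvg_rV => i; case: (split_ordP i) => j ->.
  rewrite row_mxEl mxE; under eq_cvg do rewrite row_mxEl mxE.
  exact: (Fc j).1.
rewrite row_mxEr mxE; under eq_cvg do rewrite row_mxEr mxE.
exact: (Fc j).2.
Qed.

Lemma ccontinuous_site n (f : T -> 'rV[R]_(n + n)) j : continuous f -> ccontinuous (fun x => site (f x) j).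
Proof. by move=> fc; split=> x /=; apply: cvg_coord; exact: fc. Qed.

End ComplexContinuity.

Local Arguments site : simpl never.
Local Arguments conjc : simpl never.

Section Lattice.
Variables (R : realType) (n : nat).
Notation X := 'rV[R]_(n + n).
Implicit Types (x y v w : X) (mu s : R) (j : 'I_n).

Lemma conj_real (a : R) : (a%:C)^*%C = a%:C. Proof. exact: conjc_real. Qed.
Lemma conjD (a b : R[i]) : (a + b)^*%C = a^*%C + b^*%C. Proof. exact: rmorphD. Qed.
Lemma conjM (a b : R[i]) : (a * b)^*%C = a^*%C * b^*%C. Proof. exact: rmorphM. Qed.
Lemma conjN (a : R[i]) : (- a)^*%C = - a^*%C. Proof. exact: rmorphN. Qed.
Lemma conjX (a : R[i]) m : (a ^+ m)^*%C = a^*%C ^+ m. Proof. exact: rmorphXn. Qed.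

Lemma siteZ (a : R) x j : site (a *: x) j = a%:C * site x j.
Proof. by rewrite -[a *: x]addr0 siteD /site !mxE addr0. Qed.

Lemma siteDD x y j : site (x + y) j = site x j + site y j.
Proof. by rewrite -[x]scale1r siteD scale1r mul1r. Qed.

Lemma siteN x j : site (- x) j = - site x j.
Proof. by rewrite -scaleN1r siteZ rmorphN1 mulN1r. Qed.

Lemma site0 j : site (0 : X) j = 0.
Proof. by rewrite /site !mxE. Qed.

(** The divided difference of F at [y] in the direction [v]; F is a cubic
    polynomial in the real coordinates, hence the formula. For s = 0 it is the
    derivative. *)
Definition secant y v s mu : X := of_sites (fun j =>
  (omega n mu)%:C * site v j + (site v (ordS j) - 2 * site v j + site v (ord_pred j))
  + (mu ^+ 2)%:C * (2 * (site y j * (site y j)^*%C) * site v j + site y j ^+ 2 * (site v j)^*%C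
     + s%:C * (2 * (site v j * (site v j)^*%C) * site y j + site v j ^+ 2 * (site y j)^*%C)
     + (s ^+ 2)%:C * (site v j * (site v j)^*%C * site v j))).

Lemma dnlsF_secant y v s mu : dnlsF (y + s *: v) mu = dnlsF y mu + s *: secant y v s mu.
Proof.
apply: siteP => j; rewrite siteDD siteZ !of_sitesK !siteDD !siteZ !sqr_normc !(conjD, conjM, conj_real).
rewrite !(rmorphXn, rmorphM) /=; ring.
Qed.

Lemma secant_continuous y : continuous (fun p : X * (R * R) => secant y p.1 p.2.1 p.2.2).
Proof.
have c1 : continuous (fun p : X * (R * R) => p.1) by move=> p; exact: cvg_fst.
have c2 : continuous (fun p : X * (R * R) => p.2.1).
  by move=> p; apply: (@cvg_comp _ _ _ snd fst); [exact: cvg_snd|exact: cvg_fst].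
have c3 : continuous (fun p : X * (R * R) => p.2.2).
  by move=> p; apply: (@cvg_comp _ _ _ snd snd); [exact: cvg_snd|exact: cvg_snd].
apply: continuous_of_sites => j.
have cs i : ccontinuous (fun p : X * (R * R) => site p.1 i) by exact: ccontinuous_site.
have cX (f : X * (R * R) -> R) : continuous f -> continuous (fun p => f p ^+ 2).
  by move=> fc p; exact: (cvgM (fc p) (fc p)).
have cX' (F : X * (R * R) -> R[i]) : ccontinuous F -> ccontinuous (fun p => F p ^+ 2).
  by move=> fc; apply: ccontinuousM.
have co : continuous (fun p : X * (R * R) => omega n p.2.2).
  by move=> p; apply: cvgB; [exact: cvg_cst|exact: cX].
by repeat match goal with
  | |- ccontinuous (fun _ => ?c) => apply: ccontinuous_cst
  | |- ccontinuous (fun _ => _ + _) => apply: ccontinuousD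
  | |- ccontinuous (fun _ => - _) => apply: ccontinuousN
  | |- ccontinuous (fun _ => _ * _) => apply: ccontinuousM
  | |- ccontinuous (fun _ => _ ^+ 2) => apply: cX'
  | |- ccontinuous (fun _ => (_ ^+ 2)%:C) => apply/ccontinuous_real/cX
  | |- ccontinuous (fun _ => _%:C) => apply: ccontinuous_real
  | |- ccontinuous (fun _ => _^*%C) => apply: ccontinuous_conj
  | |- _ => first [exact: cs | exact: c2 | exact: c3 | exact: co]
  end.
Qed.

Lemma dnlsF_continuous : continuous (fun z : X * R => dnlsF z.1 z.2).
Proof.
have E z : dnlsF z.1 z.2 = secant 0 z.1 1 z.2.
  have := dnlsF_secant 0 z.1 1 z.2; rewrite !scale1r add0r => ->.
  suff -> : dnlsF (0 : X) z.2 = 0 by rewrite add0r.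
  by apply: siteP => j; rewrite of_sitesK !site0; ring.
rewrite (_ : (fun z : X * R => _) = (fun z => secant 0 z.1 1 z.2)); last exact: boolp.funext.
move=> z.
apply: (@cvg_comp _ _ _ (fun z : X * R => (z.1, (1, z.2))) (fun p : X * (R * R) => secant 0 p.1 p.2.1 p.2.2)).
  have c1 : (fun z : X * R => z.1) @ z --> z.1 by exact: cvg_fst.
  have c2 : (fun z : X * R => z.2) @ z --> z.2 by exact: cvg_snd.
  have c3 : (fun z : X * R => (1 : R)) @ z --> (1 : R) by exact: cvg_cst.
  exact: (cvg_pair c1 (cvg_pair c3 c2)).
exact: (@secant_continuous 0 (z.1, (1, z.2))).
Qed.

(** The derivative of F splits as [lin0] + mu ^ 2 [lin1 y]: the part of omega that
    depends on mu is in [lin1]. *)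
Definition lin0 v : X := of_sites (fun j => (4 * sin (zeta R n / 2) ^+ 2)%:C * site v j
   + (site v (ordS j) - 2 * site v j + site v (ord_pred j))).
Definition lin1 y v : X := of_sites (fun j => - site v j + 2 * (site y j * (site y j)^*%C) * site v j
   + site y j ^+ 2 * (site v j)^*%C).

Lemma lin0_linear : linear lin0.
Proof. by move=> a x y; apply: siteP => j; rewrite siteD !of_sitesK !siteD; ring. Qed.

Lemma lin1_linear y : linear (lin1 y).
Proof.
move=> a x z; apply: siteP => j; rewrite siteD !of_sitesK !siteD !(conjD, conjM, conj_real); ring.
Qed.

Definition linmx y mu : 'M[R]_(n + n) := lin1_mx lin0 + mu ^+ 2 *: lin1_mx (lin1 y).

Lemma mul_lin1mx y v : v *m lin1_mx (lin1 y) = lin1 y v.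
Proof.
pose r := HB.pack_for {linear X -> X} (lin1 y) (GRing.isLinear.Build _ _ _ _ _ (@lin1_linear y)).
exact: (mul_rV_lin1 r).
Qed.

Lemma mul_linmx y v mu : v *m linmx y mu = secant y v 0 mu.
Proof.
pose r := HB.pack_for {linear X -> X} lin0 (GRing.isLinear.Build _ _ _ _ _ lin0_linear).
rewrite mulmxDr -scalemxAr mul_lin1mx (mul_rV_lin1 r).
apply: siteP => j; rewrite siteDD siteZ !of_sitesK /omega rmorphB /= rmorph0 expr0n /= rmorph0; ring.
Qed.

Lemma mul_trE x y : (x *m y^T) 0 0 = \sum_j complex.Re (site x j * (site y j)^*%C).
Proof.
rewrite mxE big_split_ord /= -big_split /=; apply: eq_bigr => j _.
by rewrite !mxE; ring.
Qed.

(** The lattice equation is the gradient system of an energy, so the derivative is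
    symmetric for the real scalar product. *)
Lemma linmx_sym y mu : (linmx y mu)^T = linmx y mu.
Proof.
have sym x z : (secant y x 0 mu *m z^T) 0 0 = (x *m (secant y z 0 mu)^T) 0 0.
  have shift : \sum_j complex.Re (site x (ordS j) * (site z j)^*%C) = \sum_j complex.Re (site x j * (site z (ord_pred j))^*%C).
    rewrite [RHS](reindex (@ordS n)); last by exists (@ord_pred n) => j _; rewrite ?ordSK ?ord_predK.
    by apply: eq_bigr => j _; rewrite ordSK.
  have shift' : \sum_j complex.Re (site x (ord_pred j) * (site z j)^*%C) = \sum_j complex.Re (site x j * (site z (ordS j))^*%C).
    rewrite [RHS](reindex (@ord_pred n)); last by exists (@ordS n) => j _; rewrite ?ordSK ?ord_predK.
    by apply: eq_bigr => j _; rewrite ord_predK.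
  rewrite !mul_trE; apply/eqP; rewrite -subr_eq0; apply/eqP.
  transitivity ((\sum_j complex.Re (site x (ordS j) * (site z j)^*%C) - \sum_j complex.Re (site x j * (site z (ord_pred j))^*%C))
    + (\sum_j complex.Re (site x (ord_pred j) * (site z j)^*%C) - \sum_j complex.Re (site x j * (site z (ordS j))^*%C))); last first.
    by rewrite shift shift' !subrr addr0.
  rewrite -!sumrB -[RHS]big_split; apply: eq_bigr => j _.
  rewrite !of_sitesK; case: (site x j) (site y j) (site z j) (site x (ordS j)) (site x (ord_pred j))
    (site z (ordS j)) (site z (ord_pred j)) => [a a'] [b b'] [c c'] [d d'] [f f'] [g g'] [h h'] /=.
  ring.
apply/matrixP => i j; have := sym (delta_mx 0 j) (delta_mx 0 i).
rewrite -!mul_linmx; move: (linmx y mu) => M.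
have entry (A : 'M[R]_(n + n)) k l : ((delta_mx 0 k : 'rV[R]_(n + n)) *m A *m (delta_mx 0 l : 'rV[R]_(n + n))^T) 0 0 = A k l.
  by rewrite -rowE trmx_delta -colE !mxE.
by rewrite trmx_mul mulmxA !entry !mxE.
Qed.

End Lattice.

(** * Fourier analysis of the linearization at the rotating wave *)

Section Trig.
Variable R : realType.
Implicit Types (s t : R).

Lemma cisD s t : cis (s + t) = cis s * cis t.
Proof. by apply/eqP; rewrite /cis cosD sinD eq_complex /= eqxx /= addrC eqxx. Qed.

Lemma cis0 : cis (0 : R) = 1.
Proof. by rewrite /cis cos0 sin0. Qed.

Lemma cisN t : cis (- t) = (cis t)^*%C.
Proof. by rewrite /cis cosN sinN. Qed.

Lemma cis_mulJ t : cis t * (cis t)^*%C = 1.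
Proof. by rewrite -cisN -cisD subrr cis0. Qed.

Lemma cisX t m : cis (m%:R * t) = cis t ^+ m.
Proof. by elim: m => [|m IH]; rewrite ?mul0r ?cis0 // -natr1 mulrDl mul1r cisD IH exprSr. Qed.

Lemma cis_sumJ t : cis t + (cis t)^*%C = (2 * cos t)%:C.
Proof. by apply/eqP; rewrite eq_complex /= subrr eqxx andbT; apply/eqP; ring. Qed.

Lemma cos_half t : cos t = 1 - 2 * sin (t / 2) ^+ 2.
Proof.
rewrite [in LHS](splitr t) cosD -!expr2 cos2sin2; ring.
Qed.

Lemma cis2pi : cis (2 * pi : R) = 1.
Proof. by rewrite /cis -mulr_natl mulr1 ?mulr_natl -?[2 * pi]mulr_natl cos2pi sin2pi. Qed.

End Trig.

Section Fourier.
Variables (R : realType) (n : nat).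
Hypothesis hn : (6 <= n)%N.
Notation X := 'rV[R]_(n + n).
Notation ze := (zeta R n).
Implicit Types (x y v w : X) (mu s : R) (j : 'I_n).

Let n0 : (0 < n)%N. Proof. exact: leq_trans hn. Qed.
Let nR : (0 : R) < n%:R. Proof. by rewrite ltr0n. Qed.

Lemma zeta_n : n%:R * ze = 2 * pi.
Proof. by rewrite /zeta mulrC divfK // gt_eqF. Qed.

Lemma zeta_gt0 : 0 < ze.
Proof. by rewrite divr_gt0 // mulr_gt0 // pi_gt0. Qed.

Lemma cos_zeta_gt0 : 0 < cos ze.
Proof.
have pi0 := pi_gt0 R; have z0 := zeta_gt0.
apply: cos_gt0_pihalf; apply/andP; split; first by lra.
have : 6 * ze <= 2 * pi by rewrite -zeta_n ler_pM2r // (ler_nat R 6).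
lra.
Qed.

Lemma cos2zeta : cos (2 * ze) = 2 * cos ze ^+ 2 - 1.
Proof. by rewrite (_ : 2 * ze = ze + ze) ?cosD; [have := cos2Dsin2 ze; lra|ring]. Qed.

Definition phase j : R[i] := cis (j%:R * ze).
Notation e := (cis ze).
Notation eb := ((cis ze)^*%C).

Lemma phase_X j : phase j = e ^+ j. Proof. exact: cisX. Qed.

Lemma e_n : e ^+ n = 1.
Proof. by rewrite -cisX zeta_n cis2pi. Qed.

Lemma phase_J j : phase j * (phase j)^*%C = 1. Proof. exact: cis_mulJ. Qed.

Lemma phase_n j : phase j ^+ n = 1.
Proof. by rewrite phase_X -exprM mulnC exprM e_n expr1n. Qed.

Lemma phaseJ_n j : (phase j)^*%C ^+ n = 1.
Proof. by rewrite -conjX phase_n conjc1. Qed.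

Lemma phase_S j : phase (ordS j) = phase j * e.
Proof. by rewrite !phase_X /= expr_mod ?e_n // exprSr. Qed.

Lemma phase_P j : phase (ord_pred j) = phase j * eb.
Proof. by rewrite -{2}(ord_predK j) phase_S -mulrA cis_mulJ mulr1. Qed.

Lemma phase_neg j : phase (ord_neg j) = (phase j)^*%C.
Proof.
rewrite phase_X /= expr_mod ?e_n //.
have E : e ^+ (n - j) * e ^+ j = 1 by rewrite -exprD subnK ?e_n // ltnW.
by rewrite -[LHS]mulr1 -(phase_J j) phase_X mulrA E mul1r.
Qed.

Lemma phase_iter m j : phase (iter m (@ordS n) j) = phase j * e ^+ m.
Proof. by elim: m => [|m IH]; rewrite ?mulr1 // iterS phase_S IH exprSr mulrA. Qed.

Lemma site_abar j : site (abar R n) j = phase j. Proof. exact: of_sitesK. Qed.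

Definition dft v (m : nat) : R[i] := \sum_j site v j * (phase j)^*%C ^+ m.

Lemma reflE v : refl v = v -> forall j, (site v (ord_neg j))^*%C = site v j.
Proof. by move=> rv j; rewrite -[in RHS]rv of_sitesK. Qed.

(** The reflection conjugates the state and reverses the sites, so its fixed points
    have real coefficients. *)
Lemma dft_real v m : refl v = v -> (dft v m)^*%C = dft v m.
Proof.
move=> /reflE rv; rewrite /dft rmorph_sum /=.
rewrite (reindex_inj (inv_inj (@ord_negK n))) /=; apply: eq_bigr => j _.
by rewrite conjM conjX conjcK rv phase_neg.
Qed.

Lemma dft0 m : dft 0 m = 0.
Proof. by rewrite /dft big1 // => j _; rewrite site0 mul0r. Qed.

Lemma dftB v w (c : R) m : dft (v - c *: w) m = dft v m - c%:C * dft w m.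
Proof.
rewrite /dft mulr_sumr -sumrB; apply: eq_bigr => j _.
by rewrite siteDD siteN siteZ mulrBl mulrA.
Qed.

(** The eigenvalue of the discrete Laplacian at frequency [m], relative to that of
    the rotating wave, whose frequency is 1. *)
Definition kap (m : nat) : R := 2 * cos (m%:R * ze) - 2 * cos ze.

Lemma kapE m : (kap m)%:C = e ^+ m + eb ^+ m - e - eb.
Proof.
by rewrite /kap rmorphB /= -!cis_sumJ cisX conjX opprD addrA.
Qed.

Lemma omegaE mu : (omega n mu)%:C = 2 - e - eb - (mu ^+ 2)%:C.
Proof.
rewrite /omega (_ : 4 * _ = 2 - 2 * cos ze); last by rewrite (cos_half ze); ring.
by rewrite !rmorphB /= -cis_sumJ opprD addrA rmorph_nat.
Qed.

(** The term y ^ 2 conj(v) of the derivative couples the frequencies m and 2 - m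
    (mod n); for states with real coefficients it carries coefficients to
    coefficients, so the linearization decomposes into blocks of size 2. *)
Lemma dft_secant v mu m m' : refl v = v -> (m + m' = n.+2)%N ->
  dft (secant (abar R n) v 0 mu) m = (kap m + mu ^+ 2)%:C * dft v m + (mu ^+ 2)%:C * dft v m'.
Proof.
move=> rv mm'.
have bc : e ^+ m * eb ^+ m = 1 by rewrite -exprMn cis_mulJ expr1n.
have sS : \sum_j site v (ordS j) * (phase j)^*%C ^+ m = e ^+ m * dft v m.
  rewrite /dft mulr_sumr [RHS](reindex (@ordS n)) /=; last first.
    by exists (@ord_pred n) => j _; rewrite ?ordSK ?ord_predK.
  apply: eq_bigr => j _; rewrite phase_S conjM exprMn.
  by rewrite -[LHS]mulr1 -bc; move: (e ^+ m) (eb ^+ m) (_ ^+ m) (site _ _) => a b c d; ring.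
have sP : \sum_j site v (ord_pred j) * (phase j)^*%C ^+ m = eb ^+ m * dft v m.
  rewrite /dft mulr_sumr [RHS](reindex (@ord_pred n)) /=; last first.
    by exists (@ordS n) => j _; rewrite ?ordSK ?ord_predK.
  apply: eq_bigr => j _; rewrite phase_P conjM conjcK exprMn.
  by rewrite -[LHS]mulr1 -bc; move: (e ^+ m) (eb ^+ m) (_ ^+ m) (site _ _) => a b c d; ring.
have sC : \sum_j phase j ^+ 2 * (site v j)^*%C * (phase j)^*%C ^+ m = dft v m'.
  rewrite -(dft_real m' rv) /dft rmorph_sum /=; apply: eq_bigr => j _.
  rewrite conjM conjX conjcK mulrAC mulrC; congr (_ * _).
  have h : phase j ^+ 2 = phase j ^+ m * phase j ^+ m'.
    by rewrite -[RHS]exprD mm' -[n.+2]addn2 [RHS]exprD phase_n mul1r.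
  by rewrite h mulrAC -exprMn phase_J expr1n mul1r.
rewrite {1}/dft.
transitivity ((omega n mu)%:C * dft v m + (\sum_j site v (ordS j) * (phase j)^*%C ^+ m - 2 * dft v m
   + \sum_j site v (ord_pred j) * (phase j)^*%C ^+ m) + (mu ^+ 2)%:C * (2 * dft v m
   + \sum_j phase j ^+ 2 * (site v j)^*%C * (phase j)^*%C ^+ m)).
  rewrite /dft !mulr_sumr -sumrB -!big_split /= mulr_sumr -!big_split /=; apply: eq_bigr => j _.
  rewrite of_sitesK site_abar phase_J expr0n /= rmorph0; ring.
rewrite sS sP sC omegaE rmorphD /= kapE; ring.
Qed.

Lemma sum_pow_root (x : R[i]) : x ^+ n = 1 -> x != 1 -> \sum_(p < n) x ^+ p = 0.
Proof.
move=> xn x1; have := subrX1 x n; rewrite xn subrr => /esym/eqP.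
by rewrite mulf_eq0 subr_eq0 (negbTE x1) => /eqP.
Qed.

Lemma cos_neq1 p : (0 < p < n)%N -> cos (p%:R * ze) != 1.
Proof.
move=> /andP[p0 pn]; have z0 := zeta_gt0.
have s0 : 0 < sin (p%:R * ze / 2).
  apply: sin_gt0_pi; apply/andP; split; first by rewrite divr_gt0 // mulr_gt0 // ltr0n.
  rewrite ltr_pdivrMr // (mulrC pi) -zeta_n ltr_pM2r // ltr_nat //.
by rewrite cos_half lt_eqF // gtrBl mulr_gt0 // exprn_gt0.
Qed.

Lemma cis_pow_neq1 (p : nat) : (0 < p < n)%N -> e ^+ p != 1.
Proof.
by move=> /cos_neq1 + ; apply: contra; rewrite -cisX => /eqP/(congr1 (@complex.Re R)) /= ->.
Qed.

(** The phases of two sites differ by the power e ^ (b - a), which is not 1. *)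
Lemma phase_inj j l : phase l * (phase j)^*%C = 1 -> l = j.
Proof.
have key (a b : 'I_n) : (a < b)%N -> phase b * (phase a)^*%C = 1 -> False.
  move=> ab E; have := @cis_pow_neq1 (b - a); rewrite subn_gt0 ab (leq_ltn_trans (leq_subr _ _)) // => /(_ isT)/eqP; apply.
  by rewrite -E !phase_X -{2}(subnK (ltnW ab)) exprD -mulrA -[X in _ * X](mulrC) -!phase_X mulrC mulrC [_^*%C * _]mulrC phase_J mulr1.
move=> E; have [lj|jl|//] := ltngtP l j; last 2 first.
- by case: (key _ _ jl E).
- by move=> /val_inj.
case: (key _ _ lj); rewrite -[X in X * _]conjcK -conjM mulrC E conjc1 //.
Qed.

(** Fourier inversion. *)
Lemma dft_inj v : (forall p, (p < n)%N -> dft v p.+1 = 0) -> v = 0.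
Proof.
move=> V0; apply: siteP => l; rewrite site0.
have : \sum_(p < n) dft v p.+1 * phase l ^+ p.+1 = 0.
  by rewrite big1 // => p _; rewrite V0 // mul0r.
under eq_bigr => p _ do rewrite /dft mulr_suml.
rewrite exchange_big /= (bigD1 l) //= [X in _ + X]big1 ?addr0; last first.
  move=> j jl; transitivity (site v j * (phase l * (phase j)^*%C) * \sum_(p < n) (phase l * (phase j)^*%C) ^+ p).
    by rewrite mulr_sumr; apply: eq_bigr => p _; rewrite -[RHS]mulrA -exprS [in RHS]exprMn -[LHS]mulrA [_^*%C ^+ _ * _]mulrC.
  rewrite sum_pow_root ?mulr0 //; first by rewrite exprMn phase_n phaseJ_n mulr1.
  by apply: contra jl => /eqP/phase_inj ->.
under eq_bigr => p _ do rewrite -mulrA [_^*%C ^+ _ * _]mulrC -exprMn phase_J expr1n mulr1.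
rewrite sumr_const card_ord -mulr_natr => /eqP; rewrite mulf_eq0 pnatr_eq0 -[n == 0%N]negbK -lt0n n0 orbF.
by move=> /eqP.
Qed.

Lemma cos_shift (p : nat) : (p <= n)%N -> cos ((n - p).+1%:R * ze) = cos (p%:R * ze - ze).
Proof.
move=> pn; rewrite -natr1 natrB // mulrDl mulrBl zeta_n mul1r.
rewrite -[LHS]cosN (_ : - _ = (p%:R * ze - ze) - pi *+ 2); last by rewrite -mulr_natl; ring.
by rewrite -[in RHS](subrK (pi *+ 2) (p%:R * ze - ze)) cosD2pi.
Qed.

(** The determinant of the block of the frequencies p + 1 and n - p + 1 = 1 - p. *)
Lemma kap_det (p : nat) (la : R) : (p <= n)%N ->
  (kap p.+1 + la) * (kap (n - p).+1 + la) - la ^+ 2 =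
  4 * (1 - cos (p%:R * ze)) * (cos (2 * ze) - cos (p%:R * ze) - la * cos ze).
Proof.
move=> pn; rewrite /kap cos_shift // (_ : p.+1%:R * ze = p%:R * ze + ze) ?cosB ?cosD; last by rewrite -natr1 mulrDl mul1r.
rewrite cos2zeta.
have h1 := cos2Dsin2 (p%:R * ze); have h2 := cos2Dsin2 ze.
move: (cos (p%:R * ze)) (sin (p%:R * ze)) (cos ze) (sin ze) h1 h2 => C S c s h1 h2.
have S2 : S ^+ 2 = 1 - C ^+ 2 by lra.
have s2 : s ^+ 2 = 1 - c ^+ 2 by lra.
transitivity (4 * (c ^+ 2 * (1 - C) ^+ 2 - S ^+ 2 * s ^+ 2) - 4 * la * c * (1 - C)); first by ring.
by rewrite S2 s2; ring.
Qed.

(** A block with nonzero determinant has no kernel. The block of frequency 1 alone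
    is degenerate: its two equations coincide, and give 2 mu ^ 2 c = 0. *)
Lemma kernel_trivial v mu : refl v = v -> secant (abar R n) v 0 mu = 0 -> mu != 0 ->
  (forall p, (0 < p < n)%N -> dft v p.+1 = 0 \/ cos (2 * ze) - cos (p%:R * ze) - mu ^+ 2 * cos ze != 0) ->
  v = 0.
Proof.
move=> rv Lv mu0 H; have mu20 : mu ^+ 2 != 0 by rewrite expf_neq0.
apply: dft_inj => p pn; have [p0|p0] := posnP p.
  have := dft_secant mu rv (_ : 1 + n.+1 = n.+2)%N => /(_ erefl).
  rewrite Lv dft0 p0 (_ : dft v n.+1 = dft v 1); last first.
    by apply: eq_bigr => j _; rewrite exprS phaseJ_n mulr1 expr1.
  rewrite /kap mul1r subrr add0r -mulrDl => /esym/eqP; rewrite mulf_eq0 => /orP[|/eqP//].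
  rewrite -rmorphD /= (_ : 0 = 0%:C) // => /eqP/complexI/eqP.
  by rewrite -mulr2n mulrn_eq0 /= (negbTE mu20).
case: (H p _) => [|//|nz]; first by rewrite p0.
have e1 := dft_secant mu rv (_ : p.+1 + (n - p).+1 = n.+2)%N.
have e2 := dft_secant mu rv (_ : (n - p).+1 + p.+1 = n.+2)%N.
have {}e1 := e1 (ltac:(lia)); have {}e2 := e2 (ltac:(lia)).
rewrite Lv dft0 in e1; rewrite Lv dft0 in e2.
have det := kap_det (mu ^+ 2) (ltnW pn).
have dn0 : (kap p.+1 + mu ^+ 2) * (kap (n - p).+1 + mu ^+ 2) - (mu ^+ 2) ^+ 2 != 0.
  rewrite det !mulf_neq0 // subr_eq0 eq_sym cos_neq1 // p0 //.
have : ((kap p.+1 + mu ^+ 2) * (kap (n - p).+1 + mu ^+ 2) - (mu ^+ 2) ^+ 2)%:C * dft v p.+1 = 0.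
  move: (mu ^+ 2) e1 e2 {det dn0 mu20 H nz} => L e1 e2; rewrite expr2 rmorphB !rmorphM /=.
  transitivity ((kap (n - p).+1 + L)%:C * ((kap p.+1 + L)%:C * dft v p.+1 + L%:C * dft v (n - p).+1)
    - L%:C * ((kap (n - p).+1 + L)%:C * dft v (n - p).+1 + L%:C * dft v p.+1)); first by ring.
  by rewrite -e1 -e2 !mulr0 subrr.
move/eqP; rewrite mulf_eq0 => /orP[|/eqP//].
by rewrite (_ : 0 = 0%:C) // => /eqP/complexI/eqP; rewrite (negbTE dn0).
Qed.

End Fourier.

(** * Symmetric waves of the orbit, and the critical mode *)

Section Critical.
Variables (R : realType) (n : nat).
Hypothesis hn : (6 <= n)%N.
Notation X := 'rV[R]_(n + n).
Notation ze := (zeta R n).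
Notation abar := (abar R n).
Notation phase := (@phase R n).
Implicit Types (x y v w : X) (mu s : R) (j : 'I_n).

Let n0 : (0 < n)%N. Proof. exact: leq_trans hn. Qed.
Let nR : (0 : R) < n%:R. Proof. by rewrite ltr0n. Qed.
Let c0 : 0 < cos ze. Proof. exact: cos_zeta_gt0. Qed.
Let site0i : 'I_n := Ordinal n0.

Lemma phase_site0 : phase site0i = 1.
Proof. by rewrite phase_X expr0. Qed.

Lemma site_secant0 y v mu j : site (secant y v 0 mu) j =
  (omega n mu)%:C * site v j + (site v (ordS j) - 2 * site v j + site v (ord_pred j))
  + (mu ^+ 2)%:C * (2 * (site y j * (site y j)^*%C) * site v j + site y j ^+ 2 * (site v j)^*%C).
Proof. by rewrite of_sitesK expr0n /= rmorph0; ring. Qed.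

(** The states c a-bar and c conj(a-bar) with a real sign c; by [orbit_wave] these
    are the elements of the orbit that are symmetric under the reflection. *)
Definition wave_like y := exists eps : R, eps ^+ 2 = 1 /\
  ((forall j, site y j = eps%:C * phase j) \/ (forall j, site y j = eps%:C * (phase j)^*%C)).

Lemma dihedral_phase (s : 'S_n) : s \in dihedral n -> exists c : R[i],
  (forall j, phase (s j) = c * phase j) \/ (forall j, phase (s j) = c * (phase j)^*%C).
Proof.
move=> /gen_prodgP[m [g gA ->]].
elim/big_ind: _ => [|s1 s2 [c Hs] [c' Ht]|i _].
- by exists 1; left => j; rewrite perm1 mul1r.
- case: Hs Ht => Hs [] Ht.
  + by exists (c' * c); left => j; rewrite permM Ht Hs mulrA.
  + by exists (c' * c^*%C); right => j; rewrite permM Ht Hs conjM mulrA.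
  + by exists (c' * c); right => j; rewrite permM Ht Hs mulrA.
  + by exists (c' * c^*%C); left => j; rewrite permM Ht Hs conjM conjcK mulrA.
have := gA i; rewrite !inE => /orP[]/eqP ->.
  by exists (cis ze); left => j; rewrite permE phase_S // mulrC.
by exists 1; right => j; rewrite permE phase_neg // mul1r.
Qed.

(** Shifts multiply the wave by a phase and reflections conjugate it, so an element
    of the orbit is u times the wave or its conjugate, |u| = 1. The reflection
    symmetry at the site of phase 1 makes u real. *)
Lemma orbit_wave y : Gamma_orbit abar y -> refl y = y -> wave_like y.
Proof.
case=> s /dihedral_phase[c Hs] [h hO ->{y}] rv; have := reflE rv => {rv} rv.
have EF i : site (of_sites (fun j => h (site abar (s j)))) i = h (site abar (s i)).
  exact: of_sitesK.
have [u hu] : exists u : R[i], (forall j, h (site abar (s j)) = u * phase j) \/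
    (forall j, h (site abar (s j)) = u * (phase j)^*%C).
  case: hO => u _ [] ->; case: Hs => Hs.
  - by exists (u * c); left => j; rewrite site_abar Hs mulrA.
  - by exists (u * c); right => j; rewrite site_abar Hs mulrA.
  - by exists (u * c^*%C); right => j; rewrite site_abar Hs conjM mulrA.
  - by exists (u * c^*%C); left => j; rewrite site_abar Hs conjM conjcK mulrA.
have uu : u * u^*%C = 1.
  case: hO hu => u' u'1 hE hu.
  have norm : h (site abar (s site0i)) * (h (site abar (s site0i)))^*%C = 1.
    have u'u' : u' * u'^*%C = 1 by rewrite -sqr_normc u'1 expr1n.
    by case: hE => ->; rewrite site_abar conjM ?conjcK mulrACA u'u' mul1r ?phase_J // mulrC phase_J.
  by case: hu norm => ->; rewrite conjM ?conjcK mulrACA ?phase_J ?mulr1 // (mulrC (_^*%C)) phase_J mulr1.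
have u0 : u^*%C = u.
  have := rv site0i; rewrite !EF.
  by case: hu => hu; rewrite !hu conjM ?conjcK phase_neg // ?conjcK phase_site0 ?conjc1 !mulr1.
have [a ua] : exists a : R, u = a%:C.
  exists (complex.Re u); case: u u0 {uu hu} => a b /= [] /eqP.
  by rewrite eq_sym -addr_eq0 -mulr2n mulrn_eq0 /= => /eqP ->.
exists a; split.
  by move: uu; rewrite u0 ua -rmorphM => /complexI; rewrite expr2.
by case: hu => Hu; [left|right] => j; rewrite EF Hu ua.
Qed.

Lemma wave_norm y j : wave_like y -> site y j * (site y j)^*%C = 1.
Proof.
case=> eps [e2 [] ->]; rewrite conjM conj_real ?conjcK mulrACA -rmorphM -expr2 e2 ?phase_J ?mulr1 //.
by rewrite [_^*%C * _]mulrC phase_J mulr1.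
Qed.

Lemma wave_zero y mu : wave_like y -> dnlsF y mu = 0.
Proof.
move=> wy; apply: siteP => j; rewrite of_sitesK site0 sqr_normc (wave_norm j wy) omegaE //.
by case: wy => eps [_ [] H]; rewrite !H phase_S ?phase_P // ?conjM ?conjcK; ring.
Qed.

Definition cconj v : X := of_sites (fun j => (site v j)^*%C).

Lemma secant_sq y z v mu : (forall j, site y j * (site y j)^*%C = site z j * (site z j)^*%C) ->
  (forall j, site y j ^+ 2 = site z j ^+ 2) -> secant y v 0 mu = secant z v 0 mu.
Proof.
move=> h1 h2; by apply: siteP => j; rewrite !site_secant0 h1 h2.
Qed.

(** The derivative depends on the wave only through |y| and y ^ 2, so the sign
    does not matter, and conjugation carries the derivative at the conjugate
    wave to the one at the wave. *)
Lemma wave_kernel y v mu : wave_like y -> refl v = v -> secant y v 0 mu = 0 ->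
  exists v', [/\ refl v' = v', secant abar v' 0 mu = 0 & v' = 0 -> v = 0].
Proof.
move=> wy rv Lv; have ny j := wave_norm j wy.
have na j : site abar j * (site abar j)^*%C = 1 by rewrite site_abar phase_J.
case: wy => eps [e2 [] H].
  exists v; split=> //; rewrite -Lv; apply: secant_sq => j; first by rewrite ny na.
  by rewrite H site_abar exprMn -rmorphXn e2 mul1r.
exists (cconj v); split.
- apply: siteP => j; rewrite !of_sitesK conjcK; have := reflE rv j => <-.
  by rewrite conjcK.
- apply: siteP => j; rewrite site0; have := congr1 (fun x => (site x j)^*%C) Lv.
  rewrite site0 conjc0 !site_secant0 /cconj !(of_sitesK (fun j => (site v j)^*%C)) => <-.
  rewrite ny na site_abar H exprMn -rmorphXn e2 mul1r.
  by rewrite !(conjD, conjM, conjN, conj_real, conjcK, conjX) ?conjc_nat ?conjc1; ring.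
move=> v0; apply: siteP => j; rewrite -[site v j]conjcK site0.
by have := congr1 (fun x => site x j) v0; rewrite of_sitesK site0 => ->; rewrite conjc0.
Qed.

(** One amplitude at which the linearization is invertible on all symmetric states
    is enough to know that its determinant is not the zero polynomial. At
    mu ^ 2 = 3 the block determinants have a definite sign, because
    2 c ^ 2 - 1 - 3 c < -1 for c = cos zeta, which lies in (0, 1]. *)
Lemma kernel_sqrt3 v : refl v = v -> secant abar v 0 (Num.sqrt 3) = 0 -> v = 0.
Proof.
move=> rv Lv; apply: (kernel_trivial hn rv Lv); first by rewrite gt_eqF // sqrtr_gt0.
move=> p pn; right; rewrite sqr_sqrtr // cos2zeta.
have := cos_geN1 (p%:R * ze); have := cos_le1 ze; move: c0; move: (cos ze) (cos _) => c C c0' c1 C1.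
by rewrite lt_eqF //; nra.
Qed.

Section Mode.
Variable k : nat.
Hypotheses (hk3 : (3 <= k)%N) (hkn : (k <= n./2)%N).
Notation delta := (@deltak R n k).
Notation mu := (Num.sqrt delta).
Notation d := (gcdn k n).

Let k2n : (k * 2 <= n)%N. Proof. by rewrite -(odd_double_half n) muln2 (leq_trans _ (leq_addl _ _)) // leq_double. Qed.
Let kn : (0 < k < n)%N. Proof. by apply/andP; split; move: hk3 k2n; lia. Qed.

Lemma cos_k_lt : cos (k%:R * ze) < cos (2 * ze).
Proof.
have z0 := @zeta_gt0 R n hn; have zn := @zeta_n R n hn.
have kz : k%:R * ze <= pi.
  rewrite -(ler_pM2l (_ : 0 < 2)) // -zn mulrA ler_pM2r // -natrM ler_nat mulnC //.
have k2 : 2 * ze < k%:R * ze by rewrite ltr_pM2r // ltr_nat.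
rewrite ltr_cos // in_itv /=; apply/andP; split; lra.
Qed.

(** In terms of the block determinant: delta_k is the value of mu ^ 2 at which the
    block of k is singular. *)
Lemma deltaE : delta = (cos (2 * ze) - cos (k%:R * ze)) / cos ze.
Proof.
have C1 : 1 - cos (k%:R * ze) != 0 by rewrite subr_eq0 eq_sym cos_neq1.
have aE : alphak R n k = 2 * cos ze * (1 - cos (k%:R * ze)).
  by rewrite /alphak (cos_half (k%:R * ze)); ring.
rewrite /deltak aE cos2zeta /gammak.
have h1 := cos2Dsin2 (k%:R * ze); have h2 := cos2Dsin2 ze.
move: (cos (k%:R * ze)) (sin (k%:R * ze)) (cos ze) (sin ze) h1 h2 c0 C1 => C S c s h1 h2 cp C1.
have S2 : S ^+ 2 = 1 - C ^+ 2 by lra.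
have s2 : s ^+ 2 = 1 - c ^+ 2 by lra.
rewrite !exprMn S2 s2; field; rewrite C1 gt_eqF //.
Qed.

Lemma delta_gt0 : 0 < delta.
Proof. by rewrite deltaE divr_gt0 // subr_gt0 cos_k_lt. Qed.

Lemma mu2 : mu ^+ 2 = delta. Proof. by rewrite sqr_sqrtr // ltW // delta_gt0. Qed.
Lemma mu_gt0 : 0 < mu. Proof. by rewrite sqrtr_gt0 delta_gt0. Qed.

Lemma kap_k_neq0 : kap R n k.+1 != 0.
Proof.
have := @kap_det R n hn k 0 (ltnW (andP kn).2).
rewrite !addr0 expr0n subr0 mul0r subr0 => E; apply: contraTneq (cos_k_lt) => kap0.
move: E; rewrite kap0 mul0r => /esym/eqP; rewrite mulf_eq0 subr_eq0 => /orP[|/eqP ->]; last by rewrite ltxx.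
by rewrite mulf_eq0 pnatr_eq0 /= subr_eq0 eq_sym (negbTE (@cos_neq1 R n hn k kn)).
Qed.

(** Only the blocks of k and n - k, which are the same, are singular at
    delta_k. *)
Lemma cos_k_inj p : (0 < p < n)%N -> cos (p%:R * ze) = cos (k%:R * ze) -> p = k \/ p = (n - k)%N.
Proof.
have z0 := @zeta_gt0 R n hn; have zn := @zeta_n R n hn.
have half q : (q * 2 <= n)%N -> q%:R * ze \in `[0, pi].
  move=> qn; rewrite in_itv /= mulr_ge0 ?ler0n ?(ltW z0) //=.
  by rewrite -(ler_pM2l (_ : 0 < 2)) // -zn mulrA ler_pM2r // -natrM ler_nat mulnC.
have inj q : (q * 2 <= n)%N -> cos (q%:R * ze) = cos (k%:R * ze) -> q = k.
  move=> qn /(cos_inj (half _ qn) (half _ k2n)) /(mulIf (lt0r_neq0 z0)) /eqP.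
  by rewrite eqr_nat => /eqP.
move=> /andP[p0 pn] E; have [p2|p2] := leqP (p * 2) n; first by left; apply: inj.
right; rewrite -(inj (n - p)%N) ?subKn 1?ltnW //; first by move: p2; lia.
rewrite -E natrB ?(ltnW pn) // mulrBl zn -[LHS]cosN opprB.
by rewrite -(cosD2pi (_ - _)) -(mulr_natl pi 2) subrK.
Qed.

(** The kernel vector (- delta, kap + delta) of the singular block, written at the
    sites. *)
Definition mode : X := of_sites (fun j =>
  phase j * ((- delta)%:C * phase j ^+ k + (kap R n k.+1 + delta)%:C * (phase j)^*%C ^+ k)).

Lemma refl_mode : refl mode = mode.
Proof.
apply: siteP => j; rewrite !of_sitesK phase_neg //.
by rewrite !(conjM, conjD, conjX, conj_real, conjcK).
Qed.

Lemma secant_mode : secant abar mode 0 mu = 0.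
Proof.
apply: siteP => j; rewrite site0 site_secant0 site_abar phase_J omegaE // mu2 !of_sitesK.
rewrite phase_S // phase_P // !(conjM, conjD, conjX, conj_real, conjcK).
have det : (kap R n k.+1 + delta) * (kap R n (n - k).+1 + delta) - delta ^+ 2 = 0.
  rewrite kap_det ?(ltnW (andP kn).2) // deltaE divfK ?gt_eqF //; ring.
have {}det : ((kap R n k.+1)%:C + delta%:C) * ((kap R n (n - k).+1)%:C + delta%:C) = delta%:C ^+ 2.
  by rewrite -!rmorphD -rmorphM -rmorphXn /=; congr (_%:C); move: det; lra.
have kmE : (kap R n (n - k).+1)%:C = cis ze * (cis ze)^*%C ^+ k + (cis ze)^*%C * cis ze ^+ k - cis ze - (cis ze)^*%C.
  have h : cis ze ^+ (n - k) = (cis ze)^*%C ^+ k.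
    rewrite -[LHS]mulr1 -(expr1n _ k) -(cis_mulJ ze) exprMn mulrA -exprD subnK ?(ltnW (andP kn).2) //.
    by rewrite e_n // mul1r.
  rewrite kapE // !exprS h; congr (_ + _ * _ - _ - _).
  by rewrite -conjX h conjX conjcK.
have kpE : (kap R n k.+1)%:C = cis ze * cis ze ^+ k + (cis ze)^*%C * (cis ze)^*%C ^+ k - cis ze - (cis ze)^*%C.
  by rewrite kapE; move: (cis ze) ((cis ze)^*%C) => e eb; rewrite !exprS.
rewrite !exprMn rmorphN rmorphD /=.
have a2 : phase j ^+ 2 * (phase j)^*%C = phase j by rewrite expr2 -mulrA phase_J mulr1.
move: det kmE kpE a2.
move: (phase j ^+ k) ((phase j)^*%C ^+ k) (cis ze ^+ k) ((cis ze)^*%C ^+ k) => P Q ek ebk.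
move: (phase j) ((phase j)^*%C) (cis ze) ((cis ze)^*%C) => a ab e eb.
move: (kap R n k.+1)%:C (kap R n (n - k).+1)%:C delta%:C => K K' D det kmE kpE a2.
transitivity (a * P * (- D * ((e * ek + eb * ebk - e - eb) + D))
  + a * Q * ((K + D) * ((e * ebk + eb * ek - e - eb) + D))
  + D * (a ^+ 2 * ab) * (- D * Q + (K + D) * P)); first by ring.
by rewrite -kmE -kpE det a2; ring.
Qed.

Lemma mode_neq0 : mode != 0.
Proof.
apply: contra kap_k_neq0 => /eqP/(congr1 (fun x => site x site0i)).
rewrite of_sitesK site0 phase_site0 conjc1 !expr1n !mulr1 mul1r -rmorphD /= (_ : 0 = 0%:C) //.
by move/complexI/eqP; rewrite addrCA addNr addr0.
Qed.

Lemma det_off p : (0 < p < n)%N -> p != k -> p != (n - k)%N ->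
  cos (2 * ze) - cos (p%:R * ze) - mu ^+ 2 * cos ze != 0.
Proof.
move=> pn pk pnk; rewrite mu2 deltaE (divfK (lt0r_neq0 c0)).
apply/eqP => E; have {}E : cos (p%:R * ze) = cos (k%:R * ze) by move: E; lra.
by case: (cos_k_inj pn E) => /eqP; [rewrite (negbTE pk)|rewrite (negbTE pnk)].
Qed.

(** All blocks except that of k are invertible, and the coefficient at k + 1 of a
    kernel vector determines the one at n - k + 1 because delta_k is not 0. *)
Lemma kernel_dft v : refl v = v -> secant abar v 0 mu = 0 -> dft v k.+1 = 0 -> v = 0.
Proof.
move=> rv Lv vk; apply: (kernel_trivial hn rv Lv); first by rewrite gt_eqF // mu_gt0.
move=> p pn; have [->|pk] := eqVneq p k; first by left.
have [->|pnk] := eqVneq p (n - k)%N; last by right; apply: det_off.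
left; have := dft_secant hn mu rv (_ : k.+1 + (n - k).+1 = n.+2)%N.
have kkn : (k.+1 + (n - k).+1 = n.+2)%N by move: kn; lia.
move=> /(_ kkn); rewrite Lv dft0 vk mulr0 add0r => /esym/eqP.
rewrite mulf_eq0 => /orP[|/eqP//]; rewrite (_ : 0 = 0%:C) // => /eqP/complexI/eqP.
by rewrite mu2 gt_eqF // delta_gt0.
Qed.

(** The coefficient at k + 1 is real, so a multiple of the mode removes it. *)
Lemma kernel_span v : refl v = v -> secant abar v 0 mu = 0 -> exists c, v = c *: mode.
Proof.
move=> rv Lv.
have wk : dft mode k.+1 != 0.
  by apply: contra mode_neq0 => /eqP/(kernel_dft refl_mode secant_mode) ->.
have real_dft (u : X) : refl u = u -> exists a : R, dft u k.+1 = a%:C.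
  move=> ru; have := dft_real hn k.+1 ru; case: (dft u k.+1) => a b [] /eqP.
  by rewrite eq_sym -addr_eq0 -mulr2n mulrn_eq0 /= => /eqP ->; exists a.
have [a va] := real_dft _ rv; have [b wb] := real_dft _ refl_mode.
have b0 : b != 0 by apply: contra wk => /eqP b0; rewrite wb b0.
exists (a / b); apply/eqP; rewrite -subr_eq0; apply/eqP; apply: kernel_dft.
- rewrite -scaleNr addrC; apply: siteP => j; rewrite of_sitesK !siteD conjD conjM conj_real.
  by rewrite (reflE rv) (reflE refl_mode).
- by rewrite -mul_linmx mulmxBl -scalemxAl !mul_linmx Lv secant_mode scaler0 subr0.
by rewrite dftB va wb -rmorphM /= divfK // subrr.
Qed.

(** The derivative in mu ^ 2 of the quadratic form of the linearization is
    2 Re(v conj(a)) ^ 2 summed over the sites, since |a| = 1: it is a sum of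
    squares, and at the site of phase 1 the term is not 0. *)
Lemma mode_pairing : (mode *m lin1_mx (lin1 abar) *m mode^T) 0 0 != 0.
Proof.
rewrite mul_lin1mx mul_trE.
have E j : complex.Re (site (lin1 abar mode) j * (site mode j)^*%C) =
    2 * complex.Re (site mode j * (phase j)^*%C) ^+ 2.
  rewrite (_ : site (lin1 abar mode) j = - site mode j + 2 * (phase j * (phase j)^*%C) * site mode j
     + phase j ^+ 2 * (site mode j)^*%C); last by rewrite -site_abar of_sitesK.
  have nj : complex.Re (phase j) ^+ 2 + complex.Im (phase j) ^+ 2 = 1 by rewrite cos2Dsin2.
  rewrite phase_J mulr1; case: (site mode j) (phase j) nj => [a b] [c s] /= nj.
  have s2 : s ^+ 2 = 1 - c ^+ 2 by lra.
  transitivity (a ^+ 2 + b ^+ 2 + (c ^+ 2 - s ^+ 2) * (a ^+ 2 - b ^+ 2) + 4 * c * s * a * b); first by ring.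
  transitivity (2 * (a ^+ 2 * c ^+ 2 + 2 * a * b * c * s + b ^+ 2 * s ^+ 2)); last by ring.
  by rewrite s2; ring.
rewrite (eq_bigr _ (fun j _ => E j)) (bigD1 site0i) // gt_eqF //.
apply: ltr_pwDl; last by apply: sumr_ge0 => j _; rewrite mulr_ge0 // sqr_ge0.
have -> : site mode site0i * (phase site0i)^*%C = (kap R n k.+1)%:C.
  rewrite of_sitesK phase_site0 conjc1 !expr1n !mulr1 mul1r -rmorphD /=.
  by congr (_%:C); rewrite addrCA addNr addr0.
by rewrite pmulr_rgt0 // exprn_even_gt0 //= kap_k_neq0.
Qed.

Lemma cis_iter p : (p %| n)%N -> cis (2 * pi / p%:R : R) = cis ze ^+ (n %/ p).
Proof.
move=> pn; have p0 : (p%:R : R) != 0 by rewrite pnatr_eq0 -lt0n (dvdn_gt0 n0).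
rewrite -cisX; congr cis; apply: (mulIf p0); rewrite divfK // mulrAC -natrM divnK //.
by rewrite zeta_n.
Qed.

Lemma rot_mode p : (p %| n)%N -> (p %| k)%N -> rot p mode = mode.
Proof.
move=> pn pk; apply: siteP => j; rewrite !of_sitesK phase_iter // cisN cis_iter //.
have h1 : (cis ze ^+ (n %/ p)) ^+ k = 1.
  by rewrite -exprM -(divnK pk) mulnCA divnK // mulnC exprM e_n // expr1n.
have h2 : ((cis ze)^*%C ^+ (n %/ p)) ^+ k = 1 by rewrite -!conjX h1 conjc1.
have h3 : (cis ze ^+ (n %/ p))^*%C * cis ze ^+ (n %/ p) = 1.
  by rewrite conjX -exprMn [_^*%C * _]mulrC cis_mulJ expr1n.
rewrite !(conjM, conjX) !exprMn h1 h2 !mulr1 [phase j * _ * _]mulrAC [phase j * _ * _]mulrC !mulrA.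
by rewrite -conjX h3 mul1r mulrC.
Qed.

(** At the site of phase 1, invariance under the rotation of order p forces
    cos (2 pi k / p) = 1. *)
Lemma mode_rot_dvd p c : (p %| n)%N -> c != 0 -> rot p (c *: mode) = c *: mode -> (p %| k)%N.
Proof.
move=> pn c_n0 /(congr1 (fun x => site x site0i)).
rewrite of_sitesK !siteZ !of_sitesK phase_iter // phase_site0 mul1r cisN cis_iter //.
set E := cis ze ^+ (n %/ p).
have EE : E^*%C * E = 1 by rewrite /E conjX -exprMn [_^*%C * _]mulrC cis_mulJ expr1n.
rewrite conjc1 !expr1n !mulr1 !mul1r -rmorphD /= => H.
have {}H : c%:C * ((- delta)%:C * E ^+ k + (kap R n k.+1 + delta)%:C * E^*%C ^+ k) = c%:C * (kap R n k.+1)%:C.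
  rewrite (_ : kap R n k.+1 = - delta + (kap R n k.+1 + delta)) -?H; last by ring.
  rewrite -[LHS]mul1r -EE; ring.
have c0' : c%:C != 0 by rewrite (_ : 0 = 0%:C) // (inj_eq (@complexI R)).
have {}H := mulfI c0' H.
have Ek : E ^+ k = cis ((n %/ p * k)%:R * ze) by rewrite cisX exprM.
have := congr1 (@complex.Re R) H; rewrite -conjX Ek /= !mul0r !subr0 -mulrDl addrCA addNr addr0.
rewrite -[RHS]mulr1 => /(mulfI kap_k_neq0).
have -> : cos ((n %/ p * k)%:R * ze) = cos (((n %/ p * k) %% n)%:R * ze).
  have := congr1 (@complex.Re R) (expr_mod (n %/ p * k) (@e_n R n hn)).
  by rewrite -!cisX /= => ->.
have [m0|m0] := posnP ((n %/ p * k) %% n)%N; last first.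
  by move/eqP; rewrite (negbTE (@cos_neq1 R n hn _ _)) // m0 ltn_pmod.
move=> _; have : (n %| n %/ p * k)%N by apply/eqP.
by rewrite -{1}(divnK pn) dvdn_pmul2l // divn_gt0 ?(dvdn_gt0 n0) // dvdn_leq.
Qed.

Lemma kernel_rot p v : (p %| n)%N -> ~~ (p %| k)%N -> rot p v = v -> refl v = v ->
  secant abar v 0 mu = 0 -> v = 0.
Proof.
move=> pn pk rv fv Lv; have [c vc] := kernel_span fv Lv.
have [c0'|cn0] := eqVneq c 0; first by rewrite vc c0' scale0r.
by case/negP: pk; apply: (@mode_rot_dvd p c) => //; rewrite -vc.
Qed.

End Mode.
End Critical.

(** * The restriction to a fixed-point space, in coordinates *)

(** One equation for four factors, so that a row basis and its inverse, which are
    products themselves, stay folded. *)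
Lemma mulmxA4 (R : realType) (a b c e g : nat) (u : 'M[R]_(a, b)) (A : 'M[R]_(b, c)) (B : 'M[R]_(c, e)) (C : 'M[R]_(e, g)) :
  u *m (A *m B *m C) = u *m A *m B *m C.
Proof. by rewrite !mulmxA. Qed.

Section Coordinates.
Variables (R : realType) (n : nat).
Hypothesis hn : (6 <= n)%N.
Notation X := 'rV[R]_(n + n).
Notation abar := (abar R n).
Implicit Types (x y v w : X) (mu s : R) (d p : nat).

Lemma closed0v (V : normedModType R) : closed [set (0 : V)].
Proof. by apply: accessible_closed_set1; apply: hausdorff_accessible; exact: norm_hausdorff. Qed.

Section FixedSpace.
Variable d : nat.
Notation E := (Ed_mx R n d).
Notation N := (\rank E).
Notation rb := (row_base E).
Notation co := (pinvmx rb).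

Lemma coK x : Ed d x -> x *m co *m rb = x.
Proof. by move/Ed_mxP => xE; apply: mulmxKpV; rewrite eq_row_base. Qed.

Lemma rbK (u : 'rV[R]_N) : u *m rb *m co = u.
Proof. by rewrite mulmxKp // row_base_free. Qed.

Lemma Ed_rb (u : 'rV[R]_N) : Ed d (u *m rb).
Proof. by apply/Ed_mxP; rewrite (submx_trans (submxMl _ _)) // eq_row_base. Qed.

Lemma Ed_lin (a : R) x y : Ed d x -> Ed d y -> Ed d (a *: x + y).
Proof.
by move=> /Ed_mxP Ex /Ed_mxP Ey; apply/Ed_mxP; apply: addmx_sub => //; exact: scalemx_sub.
Qed.

Lemma Ed0 : Ed d (0 : X).
Proof. by apply/Ed_mxP; exact: sub0mx. Qed.

Lemma EdZ (a : R) x : Ed d x -> Ed d (a *: x).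
Proof. by move=> Ex; rewrite -[_ *: _]addr0; apply: Ed_lin => //; exact: Ed0. Qed.

Lemma EdB x y : Ed d x -> Ed d y -> Ed d (x - y).
Proof. by move=> Ex Ey; rewrite addrC -scaleN1r; exact: Ed_lin. Qed.

Lemma co_eq0 x : Ed d x -> x *m co = 0 -> x = 0.
Proof. by move=> Ex x0; rewrite -(coK Ex) x0 mul0mx. Qed.

(** The secants at s = 1, -1, 2, -2 are quotients of differences of values of F,
    which preserves the fixed space; since the secant is quadratic in s, its
    value at 0 is the combination of these with weights 2/3, 2/3, -1/6, -1/6. *)
Lemma Ed_secant y v mu : Ed d y -> Ed d v -> Ed d (secant y v 0 mu).
Proof.
move=> Ey Ev.
have Es (s : R) : s != 0 -> Ed d (secant y v s mu).
  move=> s0; have : Ed d (s^-1 *: (dnlsF (y + s *: v) mu - dnlsF y mu)).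
    by apply/EdZ/EdB; apply: dnlsF_Ed => //; rewrite addrC; exact: Ed_lin.
  by rewrite dnlsF_secant addrC addKr scalerA mulVf // scale1r.
have -> : secant y v 0 mu = 6^-1 *: ((4 *: secant y v 1 mu + 4 *: secant y v (-1) mu)
    - (secant y v 2 mu + secant y v (-2) mu)).
  apply: (scalerI (_ : (6 : R) != 0)); first by rewrite pnatr_eq0.
  rewrite scalerA divff ?pnatr_eq0 // scale1r.
  apply: siteP => j; rewrite !(siteZ, siteDD, siteN) !of_sitesK.
  rewrite !(rmorphXn, rmorphN, rmorph_nat, rmorph0, rmorph1, rmorphM); ring.
apply/EdZ/EdB.
  by apply: Ed_lin; [|apply: EdZ]; apply: Es; rewrite ?oppr_eq0 oner_eq0.
by rewrite -[secant y v 2 mu]scale1r; apply: Ed_lin; apply: Es; rewrite ?oppr_eq0 pnatr_eq0.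
Qed.

Definition fcoord (z : 'rV[R]_N * R) : 'rV[R]_N := fd z.2 z.1.

Lemma fcoord_continuous : continuous fcoord.
Proof.
move=> z; apply: cvg_mulmx.
apply: (@cvg_comp _ _ _ (fun z : 'rV[R]_N * R => (z.1 *m rb, z.2)) (fun z : X * R => dnlsF z.1 z.2)).
  exact: mulmx_fst_continuous.
exact: (@dnlsF_continuous R n (z.1 *m rb, z.2)).
Qed.

Lemma fcoord_eq0 (z : 'rV[R]_N * R) : fcoord z = 0 -> dnlsF (z.1 *m rb) z.2 = 0.
Proof. by apply: co_eq0; apply: dnlsF_Ed; exact: Ed_rb. Qed.

(** The derivative of f_d in the coordinates of the row basis, at the point with
    coordinates [u]. *)
Definition Dcoord (u : 'rV[R]_N) mu : 'M[R]_N := rb *m linmx (u *m rb) mu *m co.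

Lemma fcoord_blowup y : Ed d y -> (forall mu, dnlsF y mu = 0) ->
  blowup fcoord (y *m co) (fun u s mu => secant y (u *m rb) s mu *m co) (Dcoord (y *m co)).
Proof.
move=> Ey y0; split.
- move=> u s mu; rewrite /fcoord /fd /= mulmxDl (coK Ey) -scalemxAl dnlsF_secant y0 add0r.
  by rewrite -scalemxAl.
- move=> p; apply: cvg_mulmx.
  apply: (@cvg_comp _ _ _ (fun p : 'rV[R]_N * (R * R) => (p.1 *m rb, p.2)) (fun p : X * (R * R) => secant y p.1 p.2.1 p.2.2)).
    exact: mulmx_fst_continuous.
  exact: (@secant_continuous R n y (p.1 *m rb, p.2)).
- by move=> u mu; rewrite /Dcoord (coK Ey) -mul_linmx; exact: esym (mulmxA4 _ _ _ _).
Qed.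

Lemma Dxfd_coord y mu : Ed d y -> (forall mu, dnlsF y mu = 0) -> Dxfd d y mu = Dcoord (y *m co) mu.
Proof.
move=> Ey y0; rewrite /Dxfd -(jacobian_blowup mu (fcoord_blowup Ey y0)).
by congr (jacobian _ _).
Qed.

Lemma Dcoord_unit y mu : Ed d y -> (forall v, Ed d v -> secant y v 0 mu = 0 -> v = 0) ->
  Dcoord (y *m co) mu \in unitmx.
Proof.
move=> Ey ker; apply: unitmx_left_kernel => u.
rewrite /Dcoord (coK Ey) mulmxA4 => uD.
have L0 : secant y (u *m rb) 0 mu = 0.
  apply: co_eq0; first by apply: Ed_secant => //; exact: Ed_rb.
  by rewrite -mul_linmx.
by rewrite -(rbK u) (ker _ (Ed_rb u) L0) mul0mx.
Qed.

(** The matrix is affine in mu ^ 2. *)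
Lemma det_Dcoord_poly (u : 'rV[R]_N) : exists q : {poly R}, forall mu, q.[mu] = \det (Dcoord u mu).
Proof.
have [p pE] := det_poly_path (rb *m lin1_mx (@lin0 R n) *m co) (rb *m lin1_mx (lin1 (u *m rb)) *m co).
exists (p \Po 'X^2) => mu; rewrite horner_comp hornerXn pE /Dcoord /linmx.
by rewrite mulmxDr mulmxDl -scalemxAr -scalemxAl.
Qed.

Lemma Ed_isolated y mu : Ed d y -> (forall mu, dnlsF y mu = 0) -> Dcoord (y *m co) mu \in unitmx ->
  \forall w \near (y, mu), Ed d w.1 -> dnlsF w.1 w.2 = 0 -> w.1 = y.
Proof.
move=> Ey y0 uD; have iso := blowup_isolated (fcoord_blowup Ey y0) uD.
have cc := @mulmx_fst_continuous R R _ _ co (y, mu).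
apply: (@filterS _ _ (nbhs_filter _) _ _ _ (cc _ iso)) => w /= iw Ew w0.
by rewrite -(coK Ew) iw ?(coK Ey) // /fcoord /fd /= (coK Ew) w0 mul0mx.
Qed.

Lemma Ed_closed : closed [set x : X | Ed d x].
Proof.
rewrite (_ : [set x | _] = (fun x : X => x *m co *m rb - x) @^-1` [set 0]).
  apply: closed_comp; last exact: closed0v.
  move=> x _.
  have c1 : (fun x : X => x) @ nbhs x --> x by exact: cvg_id.
  exact: (cvgB (cvg_mulmx (nbhs_filter x) (cvg_mulmx (nbhs_filter x) c1)) c1).
apply/seteqP; split=> x /=; first by move/coK => ->; rewrite subrr.
by move/subr0_eq => <-; exact: Ed_rb.
Qed.

Lemma zero_set_closed : closed (@zero_set R n d).
Proof.
rewrite (_ : zero_set d = (fst @^-1` [set x : X | Ed d x]) `&` ((fun z : X * R => dnlsF z.1 z.2) @^-1` [set 0]))//.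
apply: closedI.
  by apply: closed_comp; [move=> z _; exact: cvg_fst|exact: Ed_closed].
by apply: closed_comp; [move=> z _; exact: dnlsF_continuous|exact: closed0v].
Qed.

End FixedSpace.

Lemma Ed_refl d x : Ed d x -> refl x = x.
Proof. by move/EdP => []. Qed.

(** The rotation of order p is a power of the rotation of order d. *)
Lemma tildeD_dvd p d : (p %| d)%N -> (d %| n)%N -> (0 < d)%N -> tildeD p `<=` @tildeD R n d.
Proof.
move=> pd dn d0.
have rotE : @rot R n p = iter (d %/ p) (@rot R n d).
  have it m x : iter m (@rot R n d) x = of_sites (fun j => cis (- (2 * pi / d%:R)) ^+ m * site x (iter (m * (n %/ d)) (@ordS n) j)).
    elim: m x => [|m IH] x /=; first by apply: siteP => j; rewrite of_sitesK expr0 mul1r.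
    by apply: siteP => j; rewrite IH !of_sitesK exprS mulSnr iterD; exact: mulrA.
  apply: boolp.funext => x; rewrite it; apply: siteP => j; rewrite !of_sitesK.
  have p0 : (0 < p)%N by rewrite (dvdn_gt0 d0).
  rewrite -cisX; congr (cis _ * site x (iter _ _ _)).
    rewrite mulrN; congr (- _); rewrite mulrCA; congr (_ * _).
    apply: (mulIf (_ : (p%:R : R) != 0)); first by rewrite pnatr_eq0 -lt0n.
    by rewrite mulVf ?pnatr_eq0 -?lt0n // mulrAC -natrM divnK // divff // pnatr_eq0 -lt0n.
  by rewrite -{1}(divnK dn) -muln_divA // mulnC.
move=> g; elim=> {g} [|g [->|->]|g h _ Hg _ Hh|g h _ Hg gh hg].
- exact: Generated_id.
- rewrite rotE; elim: (d %/ p)%N => [|m IH]; first exact: Generated_id.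
  by apply: (@Generated_comp _ _ (@rot R n d) (iter m (@rot R n d))) => //; apply: Generated_gen; left.
- by apply: Generated_gen; right.
- exact: Generated_comp.
- exact: (Generated_inv Hg gh hg).
Qed.

Lemma Ed_abar d : (d %| n)%N -> Ed d abar.
Proof.
have n0 : (0 < n)%N by exact: leq_trans hn.
move=> dn; apply/EdP; split; apply: siteP => j; rewrite of_sitesK !site_abar.
  rewrite phase_iter // cisN (cis_iter _ hn) // conjX.
  set e := cis (zeta R n); have ee : e^*%C * e = 1 by rewrite mulrC cis_mulJ.
  by rewrite mulrCA -exprMn ee expr1n mulr1.
by rewrite phase_neg // conjcK.
Qed.

End Coordinates.

(** * Sums of local degrees over isolated pieces of the zero set *)

Lemma finite_fibers (T U : eqType) (l : seq T) (Q : T -> U -> Prop) :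
  (forall y, y \in l -> exists r : seq U, forall m, Q y m -> m \in r) ->
  exists S : seq (T * U), forall y m, y \in l -> Q y m -> (y, m) \in S.
Proof.
elim: l => [_|y l IH H]; first by exists [::].
have [S HS] := IH (fun z zl => H z (mem_behead (s := y :: l) zl)).
have [r Hr] := H y (mem_head _ _); exists ([seq (y, m) | m <- r] ++ S) => z m.
rewrite inE mem_cat => /orP[/eqP ->|zl] /=; last by move/(HS _ _ zl) => ->; rewrite orbT.
by move/Hr => mr; rewrite map_f.
Qed.

(** [det_sign_change] for a symmetric operator [L] restricted to an invariant
    subspace with basis [rb] and coordinates [co]: symmetry turns the row
    kernel vector [v] into a column kernel vector. *)
Lemma reduced_sign_change (R : realType) N m (rb : 'M[R]_(N, m)) (co : 'M[R]_(m, N))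
    (L L1 : 'M[R]_m) (v : 'rV[R]_m) :
  v *m co *m rb = v -> rb *m L *m co *m rb = rb *m L -> v *m L1 *m co *m rb = v *m L1 ->
  L^T = L -> v *m L = 0 ->
  (forall u : 'rV[R]_N, u *m (rb *m L *m co) = 0 -> exists c, u = c *: (v *m co)) ->
  (v *m L1 *m v^T) 0 0 != 0 ->
  exists2 s : int, s != 0 &
    \forall t \near (0 : R), sgz (\det (rb *m L *m co + t *: (rb *m L1 *m co))) = s * sgz t.
Proof.
move=> vE LE L1E Lsym vL ker pair.
apply: (@det_sign_change _ _ _ _ (rb *m v^T) (v *m co)) => //.
  by rewrite mulmxA LE -mulmxA -{1}Lsym -trmx_mul vL trmx0 mulmx0.
by rewrite !mulmxA vE L1E.
Qed.

Section Assembly.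
Variables (R : realType) (n : nat).
Hypothesis hn : (6 <= n)%N.
Notation X := 'rV[R]_(n + n).
Notation abar := (abar R n).

Section FixedSpace.
Variable d : nat.
Notation E := (Ed_mx R n d).
Notation N := (\rank E).
Notation rb := (row_base E).
Notation co := (pinvmx rb).
Notation K := (closure (@nontrivial_set R n d)).

(** The waves in the fixed space. There are at most four, by [orbit_wave]. *)
Definition waves : seq X := [seq y <- [:: abar; - abar; cconj abar; - cconj abar] |
  `[< Gamma_orbit abar y /\ Ed d y >]].

Lemma waves_sub y : y \in waves -> [/\ Gamma_orbit abar y, Ed d y & wave_like y].
Proof.
rewrite mem_filter => /andP[/asboolP[Gy Ey] _]; split=> //.
exact: (orbit_wave hn Gy (Ed_refl Ey)).
Qed.

Lemma waves_zero y mu : y \in waves -> dnlsF y mu = 0.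
Proof. by case/waves_sub => _ _ /wave_zero; apply. Qed.

Lemma waves_mem y : Gamma_orbit abar y -> Ed d y -> y \in waves.
Proof.
move=> Gy Ey; rewrite mem_filter; apply/andP; split; first exact/asboolP.
have [eps [e2 H]] := orbit_wave hn Gy (Ed_refl Ey).
have eps1 : eps = 1 \/ eps = -1.
  by move/eqP: e2; rewrite sqrf_eq1 => /orP[]/eqP ->; [left|right].
have aE j : site (cconj abar) j = (phase R j)^*%C by rewrite of_sitesK site_abar.
rewrite !inE; case: eps1 H => -> [] H.
- by rewrite (_ : y = abar) ?eqxx //; apply: siteP => j; rewrite H site_abar mul1r.
- by rewrite (_ : y = cconj abar) ?eqxx ?orbT //; apply: siteP => j; rewrite H aE mul1r.
- by rewrite (_ : y = - abar) ?eqxx ?orbT //; apply: siteP => j; rewrite H siteN site_abar rmorphN1 mulN1r.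
- by rewrite (_ : y = - cconj abar) ?eqxx ?orbT //; apply: siteP => j; rewrite H siteN aE rmorphN1 mulN1r.
Qed.

(** The determinant is a nonzero polynomial in the amplitude, by invertibility at
    mu = sqrt 3. *)
Lemma waves_det y : y \in waves ->
  exists2 q : {poly R}, q != 0 & forall mu, q.[mu] = \det (Dcoord (y *m co) mu).
Proof.
case/waves_sub => _ Ey wy; have [q qE] := det_Dcoord_poly (y *m co); exists q => //.
apply/eqP => q0; have := qE (Num.sqrt 3); rewrite q0 horner0 => /esym/eqP; apply/negP.
rewrite -unitfE -unitmxE; apply: Dcoord_unit => // v Ev Lv.
have [v' [rv' Lv' vv']] := wave_kernel wy (Ed_refl Ev) Lv.
by apply/vv'/(kernel_sqrt3 hn).
Qed.

(** A nonzero polynomial has a constant nonzero sign on either side of each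
    point. *)
Lemma wave_degree y mu : y \in waves ->
  (exists eta, is_local_degree d (y, mu) eta) /\
  \forall rho \near (0 : R)^'+,
    Dcoord (y *m co) (mu - rho) \in unitmx /\ Dcoord (y *m co) (mu + rho) \in unitmx.
Proof.
move=> yw; have [q q0 qE] := waves_det yw; have [_ Ey _] := waves_sub yw.
have [s s0 sE] := sgz_poly_left mu q0; have [s' s0' sE'] := sgz_poly_right mu q0.
split.
  exists (s - s'); apply: filterS2 sE sE' => rho <- <-.
  by rewrite !Dxfd_coord ?qE //= => m; exact: waves_zero.
have unit m : sgz q.[m] != 0 -> Dcoord (y *m co) m \in unitmx.
  by rewrite sgz_eq0 (qE m) unitmxE unitfE.
by apply: filterS2 sE sE' => rho E1 E2; split; apply: unit; rewrite ?E1 ?E2.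
Qed.

Lemma K_zero : K `<=` @zero_set R n d.
Proof. by rewrite [X in _ `<=` X](closure_id _).1; [apply: closureS => z []|exact: zero_set_closed]. Qed.

(** Where the derivative is invertible the trivial line is isolated in the zero
    set. *)
Lemma bifurcation_critical z : bifurcation_points d z ->
  z.1 \in waves /\ \det (Dcoord (z.1 *m co) z.2) = 0.
Proof.
case: z => y mu [Kz Nz]; have [Ey y0] := K_zero Kz.
have Gy : Gamma_orbit abar y.
  by apply: contrapT => Gy; apply: Nz; split=> // -[].
have yw : y \in waves by exact: waves_mem.
split=> //=; apply/eqP; apply: contraT => du.
have iso : \forall w \near (y, mu), Ed d w.1 -> dnlsF w.1 w.2 = 0 -> w.1 = y.
  by apply: Ed_isolated => //; [move=> m; exact: waves_zero|rewrite unitmxE unitfE].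
have [w [[[Ew w0] Tw] /= wy]] := Kz _ iso.
by case: Tw; split=> //; have -> : w.1 = y := wy Ew w0.
Qed.

(** Finitely many waves, and finitely many roots for each. *)
Lemma critical_finite : exists S : seq (X * R),
  forall z, z.1 \in waves -> \det (Dcoord (z.1 *m co) z.2) = 0 -> z \in S.
Proof.
have [y yw|S HS] := @finite_fibers _ _ waves (fun y m => \det (Dcoord (y *m co) m) = 0).
  have [q q0 qE] := waves_det yw; have [r rE] := poly_roots_finite q0.
  by exists r => m; rewrite -qE; exact: rE.
by exists S => -[y m] /=; exact: HS.
Qed.

(** [degree_balance] read in E_d: if [D] is compact and relatively open in the
    closure of the nontrivial zeros, then the local degrees at the points where
    it meets the trivial set add up to zero. *)
Lemma clopen_balance (D : set (X * R)) (PB : seq (X * R)) (eta : X * R -> int) :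
  compact D -> D `<=` K -> closed (K `\` D) -> uniq PB ->
  (forall z, z \in PB -> z.1 \in waves /\ ~ (K `\` D) z) ->
  (forall z, D z -> z.1 \in waves -> z \in PB) ->
  (forall z, z \in PB -> is_local_degree d z (eta z)) ->
  \sum_(z <- PB) eta z = 0.
Proof.
move=> Dc DK KDc uPB PBw DPB etaP.
(* up and down are the passage from coordinates to states, and back. *)
pose up (u : 'rV[R]_N * R) : X * R := (u.1 *m rb, u.2).
pose down (z : X * R) : 'rV[R]_N * R := (z.1 *m co, z.2).
have upc : continuous up by exact: mulmx_fst_continuous.
have downc : continuous down by exact: mulmx_fst_continuous.
have upK u : down (up u) = u by case: u => u m; rewrite /down /up /= rbK.
have downK z : Ed d z.1 -> up (down z) = z by case: z => x m Ex; rewrite /down /up /= coK.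
have wE y : y \in waves -> Ed d y by case/waves_sub.
have PBE z : z \in PB -> Ed d z.1 by move/PBw => [/wE].
have bal : \forall rho \near (0 : R)^'+, \sum_(p <- [seq down z | z <- PB])
   (sgz (\det (Dcoord p.1 (p.2 - rho))) - sgz (\det (Dcoord p.1 (p.2 + rho)))) = 0.
  apply: (@degree_balance R N (@fcoord R n d) (@Dcoord R n d) (up @^-1` D) (up @^-1` (K `\` D))
     [seq y *m co | y <- waves]).
  - exact: fcoord_continuous.
  - move=> u /fcoord_eq0 u0; have Zu : zero_set d (up u) by split=> //; exact: Ed_rb.
    have [Tu|Tu] := pselect (trivial_set (up u)).
      apply: Or33; apply/mapP; exists (u.1 *m rb); last by rewrite rbK.
      by apply: waves_mem; [case: Tu|case: Zu].
    have Ku : K (up u) by apply: subset_closure; split.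
    by have [Du|Du] := pselect (D (up u)); [exact: Or31|exact: Or32].
  - rewrite (_ : up @^-1` D = down @` D).
      by apply: continuous_compact => //; exact: continuous_subspaceT.
    apply/seteqP; split=> [u Du|u [z Dz <-]] /=; first by exists (up u).
    by rewrite downK //; have [] := K_zero (DK _ Dz).
  - by apply: closed_comp => // z _; exact: upc.
  - by move=> u Du [_].
  - move=> u Du /mapP[y yw uy]; apply/mapP; exists (up u); last by rewrite upK.
    have {}uy : u.1 *m rb = y by rewrite uy; exact: coK (wE y yw).
    by apply: DPB Du _; rewrite /up /= uy.
  - by move=> _ /mapP[z /PBw[zw _] ->]; apply/mapP; exists z.1.
  - move=> _ /mapP[z zP ->]; rewrite /preimage /mkset (downK z (PBE z zP)).
    exact: (PBw z zP).2.
  - rewrite map_inj_in_uniq // => z z' zP zP' /(congr1 up).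
    by rewrite !downK; [|exact: PBE|exact: PBE].
  - move=> _ /mapP[z /PBw[zw _] ->].
    exists (fun u s mu => secant z.1 (u *m rb) s mu *m co).
    by apply: fcoord_blowup; [exact: wE|move=> m; exact: waves_zero].
  - by move=> _ /mapP[z /PBw[zw _] ->]; exact: (wave_degree z.2 zw).2.
have etas : \forall rho \near (0 : R)^'+, forall z, z \in PB ->
    sgz (\det (Dxfd d z.1 (z.2 - rho))) - sgz (\det (Dxfd d z.1 (z.2 + rho))) = eta z.
  by apply: near_all => z zP; exact: etaP.
have /filter_ex[//] : \forall rho \near (0 : R)^'+, \sum_(z <- PB) eta z = 0.
apply: filterS2 bal etas => rho sum0 eta_rho; rewrite -[RHS]sum0 big_map; apply: eq_big_seq => z zP.
have [zw _] := PBw z zP.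
by rewrite -eta_rho // !(Dxfd_coord _ (wE _ zw) (fun m => waves_zero m zw)).
Qed.

End FixedSpace.

Lemma abar_orbit : Gamma_orbit abar abar.
Proof.
exists 1%g; first exact: group1.
exists id; first by exists 1; rewrite ?normr1 //; left; apply: boolp.funext => z; rewrite mul1r.
by apply: siteP => j; rewrite (of_sitesK (fun j => site abar ((1 : 'S_n)%g j))) perm1.
Qed.

Lemma abar_waves d : (d %| n)%N -> abar \in waves d.
Proof. by move=> dn; apply: waves_mem; [exact: abar_orbit|exact: Ed_abar]. Qed.

End Assembly.

(** * Bifurcation from the rotating wave *)

Section Bifurcation.
Variables (R : realType) (n k : nat).
Hypotheses (hn : (6 <= n)%N) (hk3 : (3 <= k)%N) (hkn : (k <= n./2)%N).
Notation X := 'rV[R]_(n + n).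
Notation abar := (abar R n).
Notation mu := (Num.sqrt (@deltak R n k)).
Notation d := (gcdn k n).
Notation E := (Ed_mx R n d).
Notation rb := (row_base E).
Notation co := (pinvmx rb).
Notation K := (closure (@nontrivial_set R n d)).
Let z0 : X * R := (abar, mu).
Let mode := @mode R n k.

Let dn : (d %| n)%N. Proof. exact: dvdn_gcdr. Qed.
Let mu0 : 0 < mu. Proof. exact: mu_gt0. Qed.
Let aw : abar \in waves R n d. Proof. exact: abar_waves. Qed.
Let Ea : Ed d abar. Proof. exact: Ed_abar. Qed.
Let Em : Ed d mode.
Proof. by apply/EdP; split; [apply: rot_mode => //; exact: dvdn_gcdl|exact: refl_mode]. Qed.

Lemma Ed_lin1 v : Ed d v -> Ed d (v *m lin1_mx (lin1 abar)).
Proof.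
move=> Ev; have -> : v *m lin1_mx (lin1 abar) = secant abar v 0 1 - secant abar v 0 0.
  by rewrite -!mul_linmx -mulmxBr /linmx expr1n scale1r expr0n scale0r addr0 addrAC subrr add0r.
by apply: EdB; exact: Ed_secant.
Qed.

Lemma row_stable (M : 'M[R]_(n + n)) : (forall v, Ed d v -> Ed d (v *m M)) ->
  rb *m M *m co *m rb = rb *m M.
Proof.
move=> ME; apply: mulmxKpV; apply/row_subP => i; rewrite row_mul eq_row_base.
by apply/Ed_mxP; apply: ME; apply/Ed_mxP; rewrite (submx_trans (row_sub _ _)) // eq_row_base.
Qed.

(** The kernel is the line of the mode, and the derivative in mu ^ 2 is nonzero
    on it. *)
Lemma local_sign_change : exists2 s : int, s != 0 &
  \forall t \near (0 : R), forall m, m ^+ 2 - mu ^+ 2 = t ->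
    sgz (\det (Dcoord (abar *m co) m)) = s * sgz t.
Proof.
have [] := @reduced_sign_change R _ _ rb co (linmx abar mu) (lin1_mx (lin1 abar)) mode.
- exact: coK.
- by apply: row_stable => v Ev; rewrite mul_linmx; exact: Ed_secant.
- by apply: coK; exact: Ed_lin1.
- exact: linmx_sym.
- by rewrite mul_linmx; exact: secant_mode.
- move=> u u0; have Eu := Ed_rb u.
  have Lu : secant abar (u *m rb) 0 mu = 0.
    apply: (@co_eq0 R n d); first exact: Ed_secant.
    by rewrite -mul_linmx -u0; exact: esym (mulmxA4 _ _ _ _).
  have [c uc] := kernel_span hn hk3 hkn (Ed_refl Eu) Lu.
  by exists c; rewrite -(rbK u) uc -scalemxAl.
- exact: mode_pairing.
move=> s s0 sE; exists s => //; apply: filterS sE => t <- m mt.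
rewrite /Dcoord (coK Ea); congr (sgz (\det _)).
have affine (A B : 'M[R]_(n + n)) (a : R) : rb *m (A + a *: B) *m co = rb *m A *m co + a *: (rb *m B *m co).
  by rewrite mulmxDr mulmxDl -scalemxAr -scalemxAl.
by rewrite /linmx !affine -addrA -scalerDl -mt subrKC.
Qed.

(** The difference mu ^ 2 - delta_k is negative before and positive after the
    critical amplitude. *)
Lemma local_degree_neq0 e : is_local_degree d z0 e -> e != 0.
Proof.
move=> degE; have [s s0 /nbhs_normP[r /= r0 sE]] := local_sign_change.
have r3 : 0 < r / (3 * mu) by rewrite divr_gt0 // mulr_gt0.
have /filter_ex[//] : \forall rho \near (0 : R)^'+, e != 0.
near=> rho.
have rp : 0 < rho by near: rho; exact: nbhs_right_gt.
have rm : rho < mu by near: rho; exact: nbhs_right_lt.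
have rr : rho * (3 * mu) < r by rewrite -ltr_pdivlMr ?mulr_gt0 //; near: rho; exact: nbhs_right_lt.
have m0 := mu0; move: rp rm rr m0 => rp rm rr m0.
have E1 : sgz (\det (Dcoord (abar *m co) (mu - rho))) = s * (-1).
  have tn : (mu - rho) ^+ 2 - mu ^+ 2 < 0 by nra.
  rewrite (sE _ _ _ erefl) ?(ltr0_sgz tn) //= sub0r normrN ltr0_norm //; nra.
have E2 : sgz (\det (Dcoord (abar *m co) (mu + rho))) = s * 1.
  have tn : 0 < (mu + rho) ^+ 2 - mu ^+ 2 by nra.
  rewrite (sE _ _ _ erefl) ?(gtr0_sgz tn) //= sub0r normrN gtr0_norm //; nra.
have <- : sgz (\det (Dxfd d abar (mu - rho))) - sgz (\det (Dxfd d abar (mu + rho))) = e.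
  by near: rho; exact: degE.
rewrite !(Dxfd_coord _ Ea (fun m => waves_zero hn m aw)) E1 E2; move: s0; lia.
Unshelve. all: by end_near. Qed.

Lemma nontrivial_abar : ~ nontrivial_set d z0.
Proof. by case=> _ []; split=> //; exact: abar_orbit. Qed.

(** Otherwise [clopen_balance] with the empty set and the single point gives a
    vanishing local degree. *)
Lemma closure_bifurcation : K z0.
Proof.
apply: contrapT => nK; have [e eE] := (wave_degree hn mu aw).1.
suff : \sum_(z <- [:: z0]) e = 0.
  by rewrite big_seq1 => e0; have := local_degree_neq0 eE; rewrite e0 eqxx.
apply: (@clopen_balance R n hn d set0 [:: z0] (fun=> e)).
- exact: compact0.
- exact: sub0set.
- by rewrite setD0; exact: closed_closure.
- by [].
- by move=> z; rewrite inE => /eqP ->; split; [exact: aw|case].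
- by move=> z [].
- by move=> z; rewrite inE => /eqP ->.
Qed.

Lemma bifurcation_abar : bifurcation_points d z0.
Proof. by split; [exact: closure_bifurcation|exact: nontrivial_abar]. Qed.

(** If p divides k, then p divides d and the group of p is not larger. If it does
    not, then the linearization on E_p is invertible, and the only zeros in E_p
    near the wave are trivial. *)
Lemma maximal_symmetry_abar : maximal_symmetry d z0.
Proof.
suff H : \forall w \near z0, forall p, p \in divisors n -> @tildeD R n d `<` @tildeD R n p ->
    nontrivial_set d w -> ~ Ed p w.1.
  apply: (@filterS _ _ (nbhs_filter _) _ _ _ H) => w wp Nw; split; first by case: Nw => -[].
  move=> p pn Dp; apply: wp => //; rewrite -dvdn_divisors //; exact: leq_trans hn.
apply: (@near_all _ _ _ (nbhs_filter z0)) => p; rewrite -dvdn_divisors; last exact: leq_trans hn.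
move=> pn; have [pk|pk] := boolP (p %| k)%N.
  apply: (@filterE _ _ (nbhs_filter z0)) => w [_ Dp] _; case: Dp.
  by apply: tildeD_dvd; rewrite ?dvdn_gcd ?pk ?pn // gcdn_gt0; apply/orP; left; exact: leq_trans hk3.
have Epa : Ed p abar by exact: Ed_abar.
have ap : abar \in waves R n p by exact: abar_waves.
have iso : \forall w \near z0, Ed p w.1 -> dnlsF w.1 w.2 = 0 -> w.1 = abar.
  apply: Ed_isolated => //; first by move=> m; exact: (waves_zero hn m ap).
  apply: Dcoord_unit => // v /EdP[rv fv].
  exact: (kernel_rot hn hk3 hkn pn pk rv fv).
apply: (@filterS _ _ (nbhs_filter _) _ _ _ iso) => w isow _ [[_ w0] Tw] Ew.
by apply: Tw; split=> //; rewrite (isow Ew w0); exact: abar_orbit.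
Qed.

(** The component is separated by [bounded_component_isolated] from the finitely
    many critical points that are not on it. *)
Lemma bounded_balance :
  let C := connected_component K z0 in
  let B := C `&` @trivial_set R n `&` @bifurcation_points R n d in
  bounded_set C ->
  [/\ finite_set B, B `\ z0 !=set0 &
      exists2 eta : X * R -> int, forall z, B z -> is_local_degree d z (eta z) &
        \sum_(z \in B) eta z = 0].
Proof.
move=> C B Cb; have [S HS] := critical_finite R hn d.
(* The critical points to be avoided. *)
pose F := [seq z <- S | `[< ~ C z >]].
have Fc : closed [set` F].
  have acc : accessible_space (X * R)%type by apply: hausdorff_accessible; exact: norm_hausdorff.
  exact: (accessible_finite_set_closed.1 acc _ (finite_seq F)).
have CF : C `<=` ~` [set` F].
  by move=> z Cz /=; rewrite mem_filter => /andP[/asboolP].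
have [D [Dc KDc DK DF CD]] := bounded_component_isolated (@ball_compact R (n + n))
  (@closed_closure _ _) closure_bifurcation (closed_openC Fc) CF Cb.
pose PB := undup [seq z <- S | `[< B z >]].
have BS z : bifurcation_points d z -> z \in S.
  by move=> /(bifurcation_critical hn)[zw dz]; exact: HS.
have PBE z : (z \in PB) = `[< B z >].
  rewrite mem_undup mem_filter; apply/andP/idP => [[]//|Bz]; split=> //.
  by apply: BS; move/asboolP: Bz => [].
have BE : B = [set` PB].
  by apply/seteqP; split=> z /=; rewrite PBE => /asboolP.
have Bw z : B z -> z.1 \in waves R n d by case=> _ /(bifurcation_critical hn)[].
have [eta etaP] : exists eta : X * R -> int, forall z, B z -> is_local_degree d z (eta z).
  have H z : exists e : int, B z -> is_local_degree d z e.
    have [Bz|nBz] := pselect (B z); last by exists 0.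
    by have [e eE] := (wave_degree hn z.2 (Bw z Bz)).1; exists e => _; case: (z) eE.
  by have [eta] := boolp.choice H; exists eta.
have PBsum : \sum_(z <- PB) eta z = 0.
  apply: (@clopen_balance R n hn d D PB eta).
  - exact: Dc.
  - exact: DK.
  - exact: KDc.
  - exact: undup_uniq.
  - move=> z; rewrite PBE => /asboolP Bz; split; first exact: Bw.
    by case=> _; apply; apply: CD; case: Bz => -[].
  - move=> z Dz zw; rewrite PBE; apply/asboolP.
    have Tz : trivial_set z by split=> //; case/waves_sub: zw.
    have bz : bifurcation_points d z by split; [exact: DK|case].
    split=> //; split=> //; apply: contrapT => nCz; have := DF z Dz; apply.
    by rewrite /= mem_filter BS // andbT; apply/asboolP.
  - by move=> z; rewrite PBE => /asboolP; exact: etaP.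
have Cz0 : C z0 by apply: connected_component_refl; exact: closure_bifurcation.
have Bz0 : B z0.
  by split; [split=> //; split=> //; exact: abar_orbit|exact: bifurcation_abar].
split; first by rewrite BE; exact: finite_seq.
  apply: contrapT => noB; have := local_degree_neq0 (etaP _ Bz0).
  have zP : z0 \in PB by rewrite PBE; apply/asboolP.
  have := PBsum; rewrite (bigD1_seq z0) ?undup_uniq //= big_seq_cond big1 => [|z /andP[zB zz0]].
    by rewrite addr0 => ->; rewrite eqxx.
  by case: noB; exists z; split; [rewrite BE|move=> /= zE; rewrite zE eqxx in zz0].
exists eta => //; by rewrite BE -fsbig_seq ?undup_uniq.
Qed.

End Bifurcation.

Theorem theorem39 (R : realType) (n k : nat) (hn : (6 <= n)%N)
    (hk3 : (3 <= k)%N) (hkn : (k <= n./2)%N) :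
  @global_bifurcation R n (gcdn k n) (Num.sqrt (@deltak R n k)).
Proof.
split; [exact: bifurcation_abar|exact: maximal_symmetry_abar|exact: bounded_balance].
Qed.
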